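(* Let $K=K_{\mathbf x}\times I_n$ be a space–time mesh element of diameter $h_K$ which is star-shaped with respect to a ball $B\subset K$ of radius $\rho h_K$ for some $0<\rho\le\frac12$, and let $\psi\in\mathbf T(K)\cap H^{p+1}(K)$. Assume that the finite-dimensional space $\mathbb T_p(K)\subset\mathbf T(K)$, with its basis $\{\phi_1,\dots,\phi_{n_{d,p}}\}$, satisfies the Taylor-matching Condition stated in the context. Then there exist an element $\Phi\in\mathbb T_p(K)$ and a constant $C>0$, which depends on the constant $C_\star$ of the Condition but is independent of $h_K$ and $\psi$, such that $$\|D^{\boldsymbol j}(\psi-\Phi)\|_{L^2(K)}\le C\,h_K^{\,p+1-|\boldsymbol j|}\,\|\psi\|_{H^{p+1}(K)},\qquad 0\le|\boldsymbol j|\le p.$$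
   Context: $d\ge1$ is the space dimension and $p\in\mathbb N$, $p\ge 1$. $K_{\mathbf x}\subset\mathbb R^d$ is an element (polytope) of a partition of a bounded Lipschitz domain $\Omega\subset\mathbb R^d$, $I_n$ is a bounded open time interval, and $K=K_{\mathbf x}\times I_n\subset\mathbb R^{d+1}$. The real potential $V$ is constant on $K$. Functions are complex valued, and $$\mathbf T(K)=\{w\in H^1(I_n;L^2(K_{\mathbf x}))\cap L^2(I_n;H^2(K_{\mathbf x})):\ i\partial_tw+\Delta w-Vw=0\text{ on }K\},$$ with $\Delta$ the Laplacian in $\mathbf x$. $H^{p+1}(K)$ is the space–time Sobolev space on $K$. For $\boldsymbol j=(j_{x_1},\dots,j_{x_d},j_t)\in\mathbb N_0^{d+1}$, $|\boldsymbol j|=j_{x_1}+\dots+j_{x_d}+j_t$ and $D^{\boldsymbol j}f=\partial_{x_1}^{j_{x_1}}\cdots\partial_{x_d}^{j_{x_d}}\partial_t^{j_t}f$. $|K|$ is the Lebesgue measure of $K$, and $|\mathbf a|_1=\sum_\ell|a_\ell|$. **Condition.** Let $B\subset K$ be a $(d+1)$-dimensional ball such that $K$ is star-shaped with respect to $B$. Let $\{\phi_1,\dots,\phi_{n_{d,p}}\}\subset C^\infty(K)$ (smooth up to the boundary of $K$) be a basis of $\mathbb T_p(K)$. For every $\psi\in\mathbf T(K)\cap H^{p+1}(K)$ there exists a vector-valued function $\mathbf a\in L^1(B)^{n_{d,p}}$ such that $$D^{\boldsymbol j}\psi(\mathbf z,s)=\sum_{\ell=1}^{n_{d,p}}a_\ell(\mathbf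 z,s)\,D^{\boldsymbol j}\phi_\ell(\mathbf z,s)\quad\text{for all }|\boldsymbol j|\le p\text{ and a.e. }(\mathbf z,s)\in B,$$ $$\big\||\mathbf a|_1\big\|_{L^1(B)}=\int_B\sum_{\ell=1}^{n_{d,p}}|a_\ell(\mathbf z,s)|\,\mathrm dV(\mathbf z,s)\le C_\star|K|^{1/2}\|\psi\|_{H^{p+1}(K)},$$ where $C_\star>0$ might depend on $d$, $p$ and $\{\phi_\ell\}$ but is independent of $K$ and $\psi$. The pointwise values $D^{\boldsymbol j}\psi(\mathbf z,s)$ are those of the order-$p$ differential (Taylor polynomial) at $(\mathbf z,s)$ of an $H^{p+1}(\mathbb R^{d+1})$ extension of $\psi$, which exists for a.e. $(\mathbf z,s)$; they agree a.e. with the weak derivatives of $\psi$. The ball $B$ in the Condition is the one appearing in the star-shapedness hypothesis of the claim. *)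

(* Defs.v *)
From HB Require Import structures.
From mathcomp Require Import all_boot all_order all_algebra.
From mathcomp Require Import all_classical all_reals all_analysis.
From mathcomp Require Import complex.

Set Implicit Arguments.
Unset Strict Implicit.
Unset Printing Implicit Defensive.

Import Order.TTheory GRing.Theory Num.Theory numFieldNormedType.Exports.

Local Open Scope classical_set_scope.
Local Open Scope ring_scope.

(* The product sigma-algebra; for T = R it is the Borel one. *)
Section measurable_row.
Context {d} {T : measurableType d} (n : nat).

Definition row_coord : 'I_n -> 'rV[T]_n -> T := fun i x => x ord0 i.

Let row_set0 : g_sigma_preimage row_coord set0.
Proof. exact: sigma_algebra0. Qed.

Let row_setC A : g_sigma_preimage row_coord A ->
  g_sigma_preimage row_coord (~` A).
Proof. exact: sigma_algebraC. Qed.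

Let row_bigcup (F : (set 'rV[T]_n)^nat) :
  (forall i, g_sigma_preimage row_coord (F i)) ->
  g_sigma_preimage row_coord (\bigcup_i (F i)).
Proof. exact: sigma_algebra_bigcup. Qed.

HB.instance Definition _ := @isMeasurable.Build (measure_tuple_display d)
  'rV[T]_n (g_sigma_preimage row_coord) row_set0 row_setC row_bigcup.

End measurable_row.

Lemma measurable_row_coord {d} {T : measurableType d} n (i : 'I_n) :
  measurable_fun [set: 'rV[T]_n] (fun x => x ord0 i).
Proof.
move=> _ Y mY; rewrite setTI; apply: sub_sigma_algebra => /=.
rewrite -bigcup_seq/=; exists i => /=; first by rewrite mem_index_enum.
by exists Y => //; rewrite setTI.
Qed.

Lemma measurable_fun_rowP {d1 d2} {T1 : measurableType d1}
    {T2 : measurableType d2} n (f : T1 -> 'rV[T2]_n) :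
  (forall i, measurable_fun [set: T1] (fun x => f x ord0 i)) ->
  measurable_fun [set: T1] f.
Proof.
move=> mf.
suff : g_sigma_preimage (fun i => @row_coord _ T2 n i \o f) `<=` measurable.
  by rewrite g_sigma_preimage_comp => prefS _ A mA; apply: prefS; exists A.
apply: smallest_sub; first exact: sigma_algebra_measurable.
rewrite -bigcup_seq; apply: bigcup_sub => i _ A [B mB <-].
exact: mf.
Qed.

Section lebesgue_row.
Context {R : realType}.

Definition row_cons n (q : measurableTypeR R * 'rV[R]_n) : 'rV[R]_n.+1 :=
  row_mx (q.1)%:M (q.2) : 'rV[R]_(1 + n).

Definition row_uncons n (x : 'rV[R]_n.+1) : measurableTypeR R * 'rV[R]_n :=
  (x ord0 ord0, \row_j x ord0 (lift ord0 j)).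

Lemma row_consK n : cancel (@row_cons n) (@row_uncons n).
Proof.
move=> [t x]; rewrite /row_uncons /row_cons /=; congr pair.
  rewrite (_ : ord0 = lshift n (ord0 : 'I_1) :> 'I_(1 + n)); last exact/val_inj.
  by apply: etrans (row_mxEl _ _ _ _) _; rewrite mxE eqxx mulr1n.
apply/rowP => j; rewrite mxE.
rewrite (_ : lift ord0 j = rshift 1 j :> 'I_(1 + n)); last exact/val_inj.
by apply: etrans (row_mxEr _ _ _ _) _.
Qed.

Lemma measurable_row_cons n : measurable_fun setT (@row_cons n).
Proof.
apply: measurable_fun_rowP => i.
have [->|[j ->]] : i = ord0 \/ exists j : 'I_n, i = lift ord0 j.
  by case: (unliftP ord0 i) => [j ->|->]; [right; exists j|left].
- rewrite [X in measurable_fun _ X](_ : _ = fst); first exact: measurable_fst.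
  by apply/funext => q; rewrite -[in RHS](row_consK q).
- rewrite [X in measurable_fun _ X](_ : _ = (fun x : 'rV[R]_n => x ord0 j) \o snd); last first.
    by apply/funext => q; rewrite -[in RHS](row_consK q)/= mxE.
  by apply: measurableT_comp => //; exact: measurable_row_coord.
Qed.

Lemma measurable_row_uncons n : measurable_fun setT (@row_uncons n).
Proof.
apply/measurable_fun_pairP; split; first exact: measurable_row_coord.
apply: measurable_fun_rowP => i.
rewrite [X in measurable_fun _ X](_ : _ = fun x : 'rV[R]_n.+1 => x ord0 (lift ord0 i)).
  exact: measurable_row_coord.
by apply/funext => x; rewrite /= mxE.
Qed.

Section step.
Variables (n : nat) (m : {sigma_finite_measure set 'rV[R]_n -> \bar R}).

Let mcons : measurable_fun setT (@row_cons n).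
Proof. exact: measurable_row_cons. Qed.

Definition lebesgue_step : set 'rV[R]_n.+1 -> \bar R :=
  pushforward ((@lebesgue_measure R) \x m)%E (@row_cons n).

Let step0 : lebesgue_step set0 = 0%E.
Proof. by rewrite /lebesgue_step /pushforward preimage_set0 measure0. Qed.

Let step_ge0 A : (0 <= lebesgue_step A)%E.
Proof. exact: measure_ge0. Qed.

Let step_sigma_additive : semi_sigma_additive lebesgue_step.
Proof.
move=> F mF tF mUF; rewrite /lebesgue_step /pushforward preimage_bigcup.
apply: measure_semi_sigma_additive.
- by move=> k; rewrite -[X in measurable X]setTI; exact: mcons.
- apply/trivIsetP => /= i j _ _ ij; rewrite -preimage_setI.
  by move/trivIsetP : tF => /(_ _ _ _ _ ij) ->//; rewrite preimage_set0.
- by rewrite -preimage_bigcup -[X in measurable X]setTI; exact: mcons.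
Qed.

HB.instance Definition _ := isMeasure.Build _ _ _ lebesgue_step
  step0 step_ge0 step_sigma_additive.

Let step_sigma_finite : sigma_finite setT lebesgue_step.
Proof.
have /sigma_finiteP[F [TF ndF Foo]] := sigma_finiteT (@lebesgue_measure R).
have /sigma_finiteP[G [TG ndG Goo]] := sigma_finiteT m.
exists (fun k => @row_uncons n @^-1` (F k `*` G k)).
  rewrite -preimage_bigcup -[LHS](preimage_setT (@row_uncons n)).
  congr (_ @^-1` _); rewrite -setXTT TF TG predeqE => -[x y]; split.
    move=> [/= [k _ Fkx] [l _ Gly]]; exists (maxn k l) => //; split.
    - by move: x Fkx; exact/subsetPset/ndF/leq_maxl.
    - by move: y Gly; exact/subsetPset/ndG/leq_maxr.
  by move=> [k _ []/= ? ?]; split; exists k.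
move=> k; have [mF Fk] := Foo k; have [mG Gk] := Goo k.
have mFG : measurable (F k `*` G k) by exact: measurableX.
split; first by rewrite -[X in measurable X]setTI; exact: measurable_row_uncons.
rewrite /lebesgue_step /pushforward (_ : _ @^-1` _ = F k `*` G k).
  by rewrite product_measure1E// lte_mul_pinfty// ge0_fin_numE.
by apply/funext => q; exact: (congr1 (F k `*` G k) (row_consK q)).
Qed.

HB.instance Definition _ := Measure_isSigmaFinite.Build _ _ _ lebesgue_step
  step_sigma_finite.

End step.

(* Lebesgue measure on R^n, by iterated products; R^0 is a point of mass 1. *)
Fixpoint lebesgue_row n : {sigma_finite_measure set 'rV[R]_n -> \bar R} :=
  match n with
  | 0%N => @dirac _ 'rV[R]_0 0 R
  | k.+1 => @lebesgue_step k (lebesgue_row k)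
  end.

End lebesgue_row.

Definition mi_order n (j : 'I_n -> nat) : nat := (\sum_i j i)%N.

Definition mi_of_ffun n m (j : {ffun 'I_n -> 'I_m}) : 'I_n -> nat :=
  fun i => j i.

Section derivatives.
Context {R : realType} (n : nat).
Implicit Types (f : 'rV[R]_n -> R) (g : 'rV[R]_n -> R[i]) (j : 'I_n -> nat).

Definition partial (i : 'I_n) f : 'rV[R]_n -> R :=
  fun x => 'D_(delta_mx ord0 i) f x.

Definition partials (s : seq 'I_n) f : 'rV[R]_n -> R := foldr partial f s.

Definition mpartial j f : 'rV[R]_n -> R :=
  partials (flatten [seq nseq (j i) i | i <- enum 'I_n]) f.

(* Complex-valued functions are differentiated componentwise. *)
Definition cmpartial j g : 'rV[R]_n -> R[i] :=
  fun x => (mpartial j (@complex.Re R \o g) x +i* mpartial j (@complex.Im R \o g) x)%C.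

(* C^infinity on the open set K, all derivatives extending continuously to the
   closure of K. *)
Definition smooth_closure (K : set 'rV[R]_n) f :=
  forall s : seq 'I_n,
    (forall x, K x -> differentiable (partials s f) x) /\
    exists h : 'rV[R]_n -> R,
      {within closure K, continuous h} /\
      (forall x, K x -> h x = partials s f x).

Definition csmooth_closure (K : set 'rV[R]_n) g :=
  smooth_closure K (@complex.Re R \o g) /\ smooth_closure K (@complex.Im R \o g).

Definition test_function (K : set 'rV[R]_n) f :=
  [/\ (forall (s : seq 'I_n) x, differentiable (partials s f) x),
      compact (closure [set x | f x != 0]) &
      closure [set x | f x != 0] `<=` K].

End derivatives.

(* Elements of a function space on K are represented by Borel functions that are
   total on R^n; only their values on K matter. *)

Section sobolev.
Context {R : realType} (n : nat).
Local Notation mu := (lebesgue_row n).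
Local Notation normc := ComplexField.Normc.normc.
Implicit Types (f g : 'rV[R]_n -> R[i]) (j : 'I_n -> nat) (K : set 'rV[R]_n).

Definition cintegral K f : R[i] :=
  (Rintegral mu K (@complex.Re R \o f) +i* Rintegral mu K (@complex.Im R \o f))%C.

Definition L2norm K f : \bar R :=
  'N[mu]_2%:E[(fun x => (normc (f x))%:E) \_ K]%E.

Definition in_L2 K f :=
  [/\ measurable_fun K (@complex.Re R \o f),
      measurable_fun K (@complex.Im R \o f) & (L2norm K f < +oo)%E].

Definition in_L1 K f :=
  mu.-integrable K (EFin \o @complex.Re R \o f) /\
  mu.-integrable K (EFin \o @complex.Im R \o f).

(* Integration by parts of f and its candidate derivative g against v; by
   linearity real-valued test functions suffice. *)
Definition ibp K j f g (v : 'rV[R]_n -> R) :=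
  cintegral K (fun x => f x * (mpartial j v x)%:C%C) =
  (-1) ^+ mi_order j * cintegral K (fun x => g x * (v x)%:C%C).

Definition is_wderiv K j f g :=
  in_L2 K g /\ forall v, test_function K v -> ibp K j f g v.

(* The weak derivative D^j f on K; a representative, as it is unique only up to
   a null set. *)
Definition wderiv K j f : 'rV[R]_n -> R[i] :=
  xget (fun=> 0) [set g | is_wderiv K j f g].

Definition in_H K (m : nat) f :=
  in_L2 K f /\
  forall j, (mi_order j <= m)%N -> exists g, is_wderiv K j f g.

(* The multi-indices of order at most m take values in 'I_m.+1. *)
Definition Hnorm K (m : nat) f : \bar R :=
  ((\sum_(j : {ffun 'I_n -> 'I_m.+1} | (mi_order (mi_of_ffun j) <= m)%N)
      L2norm K (wderiv K (mi_of_ffun j) f) `^ 2) `^ 2^-1)%E.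

(* Finite when K is bounded and the members of phi are smooth up to the boundary
   of K. *)
Definition Cnorm K (m N : nat) (phi : 'I_N -> 'rV[R]_n -> R[i]) : R :=
  sup [set r | exists l j x, [/\ (mi_order j <= m)%N, K x &
                                 r = normc (cmpartial j (phi l) x)]].

Definition is_basis K (W : set ('rV[R]_n -> R[i])) (N : nat)
    (phi : 'I_N -> 'rV[R]_n -> R[i]) :=
  (forall f, W f <-> exists c : 'I_N -> R[i],
     forall x, K x -> f x = \sum_l c l * phi l x) /\
  (forall c : 'I_N -> R[i],
     (forall x, K x -> \sum_l c l * phi l x = 0) -> forall l, c l = 0).

End sobolev.

Section geometry.
Context {R : realType}.

(* The library norm on 'rV[R]_n is the sup norm. *)
Definition enorm n (x : 'rV[R]_n) : R := Num.sqrt (\sum_i x ord0 i ^+ 2).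

Definition eball n (c : 'rV[R]_n) (r : R) : set 'rV[R]_n :=
  [set x | enorm (x - c) < r].

Definition diam n (A : set 'rV[R]_n) : R :=
  sup [set r | exists x y, [/\ A x, A y & r = enorm (x - y)]].

Definition star_shaped n (K B : set 'rV[R]_n) :=
  forall x z (s : R), K x -> B z -> 0 <= s <= 1 ->
    K ((1 - s) *: x + s *: z).

Definition convex_polytope n (P : set 'rV[R]_n) :=
  bounded_set P /\
  exists (m : nat) (A : 'M[R]_(n, m)) (b : 'rV[R]_m),
    P = [set x | forall i, (x *m A) ord0 i <= b ord0 i].

(* Polytopes need not be convex. *)
Definition open_polytope n (K : set 'rV[R]_n) :=
  K !=set0 /\
  exists (m : nat) (P : 'I_m -> set 'rV[R]_n),
    (forall i, convex_polytope (P i)) /\ K = interior (\bigcup_i P i).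

Section cylinder.
Context (d : nat).
Implicit Types (Kx : set 'rV[R]_d) (I : set 'rV[R]_1).

Definition time_interval (a b : R) : set 'rV[R]_1 :=
  [set t | a < t ord0 ord0 < b].

(* Space-time points are (x_1, ..., x_d, t). *)
Definition cylinder Kx I : set 'rV[R]_(d + 1) :=
  [set z | Kx (lsubmx z) /\ I (rsubmx z)].

End cylinder.
End geometry.

Section schroedinger.
Context {R : realType} (d : nat).
Local Notation normc := ComplexField.Normc.normc.
Implicit Types (Kx : set 'rV[R]_d) (I : set 'rV[R]_1)
  (w wt : 'rV[R]_(d + 1) -> R[i]).

(* w in H^1(I; L^2(Kx)) with time derivative wt: for each scalar test function
   on I, the identity of integrals over I holds in L^2(Kx). *)
Definition in_H1_L2 Kx I w wt :=
  [/\ in_L2 (cylinder Kx I) w, in_L2 (cylinder Kx I) wt &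
      forall v, test_function I v ->
        {ae lebesgue_row d, forall x, Kx x ->
           ibp I (fun=> 1%N) (fun t => w (row_mx x t))
             (fun t => wt (row_mx x t)) v}].

(* w in L^2(I; H^2(Kx)), wx j being its spatial derivative of multi-index j. *)
Definition in_L2_H2 Kx I w (wx : ('I_d -> nat) -> 'rV[R]_(d + 1) -> R[i]) :=
  [/\ in_L2 (cylinder Kx I) w,
      (forall j, (mi_order j <= 2)%N -> in_L2 (cylinder Kx I) (wx j)) &
      {ae lebesgue_row 1, forall t, I t ->
         in_L2 Kx (fun x => w (row_mx x t)) /\
         forall j, (mi_order j <= 2)%N ->
           is_wderiv Kx j (fun x => w (row_mx x t))
             (fun x => wx j (row_mx x t))}].

(* i dw/dt + Laplacian w - V w = 0, with V the value of the potential on K. *)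
Definition trefftz Kx I (V : R) : set ('rV[R]_(d + 1) -> R[i]) :=
  [set w | exists wt wx, [/\ in_H1_L2 Kx I w wt, in_L2_H2 Kx I w wx &
     {ae lebesgue_row (d + 1), forall z, cylinder Kx I z ->
        'i%C * wt z + \sum_(i < d) wx (fun k => (k == i).*2) z
          - V%:C%C * w z = 0}]].

(* The pointwise values of D^j psi are those of the weak derivative on K, with
   which the Taylor coefficients of an extension of psi agree a.e. *)
Definition taylor_matching Kx I V (B : set 'rV[R]_(d + 1)) (p N : nat)
    (phi : 'I_N -> 'rV[R]_(d + 1) -> R[i]) (Cstar : R) :=
  let K := cylinder Kx I in
  forall psi, trefftz Kx I V psi -> in_H K p.+1 psi ->
    exists a : 'I_N -> 'rV[R]_(d + 1) -> R[i],
      [/\ (forall l, in_L1 B (a l)),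
          (forall j, (mi_order j <= p)%N ->
             {ae lebesgue_row (d + 1), forall z, B z ->
                wderiv K j psi z = \sum_l a l z * cmpartial j (phi l) z}) &
          (\int[lebesgue_row (d + 1)]_(z in B) (\sum_l normc (a l z))%:E <=
           Cstar%:E * lebesgue_row (d + 1) K `^ 2^-1 * Hnorm K p.+1 psi)%E].

End schroedinger.

(* Main.v *)
Require Import Defs.
From HB Require Import structures.
From mathcomp Require Import all_boot all_order all_algebra.
From mathcomp Require Import all_classical all_reals all_analysis.
From mathcomp Require Import measurable_realfun complex.
From mathcomp Require Import ring lra.

Set Implicit Arguments.
Unset Strict Implicit.
Unset Printing Implicit Defensive.

Import Order.TTheory GRing.Theory Num.Theory numFieldNormedType.Exports.

Local Open Scope classical_set_scope.
Local Open Scope ring_scope.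

(** Let n = d + 1 and let a be the functions provided by the Taylor-matching
    condition for psi. For almost every z in B, all derivatives of order at most
    p of psi - sum_l a_l(z) phi_l vanish at z. The approximant Phi is this
    combination for one well-chosen z, and the work is to bound the remainders
    R_j = D^j psi - sum_l a_l(z) D^j phi_l on the whole of K.

    Weak derivatives satisfy the fundamental theorem of calculus on almost every
    segment: [line_identity] is the statement for parallel segments, obtained by
    testing and from the fundamental lemma of the calculus of variations
    [fundamental_lemma], and [ae_segment_ftc] turns it into one about the
    segments that issue from a fixed z, for almost every z. These segments stay
    in K because K is star-shaped with respect to B. As R_j(z) = 0, this gives
      R_j(z + t e) = int_0^t sum_i e_i R_(j + e_i)(z + s e) ds,
    and p + 1 - |j| iterations ([line_bound]) give
      |R_j(y)| <= (n h)^(p + 1 - |j|) int_0^1 G(z + s (y - z)) ds,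
    where G dominates the remainders of order p + 1. One may take
    G = Psi + Cnorm * A(z), with Psi the Euclidean norm of the derivatives of psi
    of order at most p + 1 ([majorant]) and A(z) = sum_l |a_l(z)|.

    By Cauchy-Schwarz the squared L^2 norm of R_j on K is therefore controlled
    ([comb_sqL2_bound]) by Cnorm^2 A(z)^2 |K| and by
      Q(z) = int_K int_0^1 Psi^2(z + s (y - z)) ds dy.
    The integral of A over B is bounded by the matching condition. That of Q is
    at most 2^n (|B| + |K|) int Psi^2 ([star_average]): when s >= 1/2 the
    change of variable in y costs a factor s^(-n) <= 2^n, and when s <= 1/2 the
    change of variable in z costs (1 - s)^(-n) <= 2^n. By Markov's inequality
    each of A and Q exceeds three times its mean over B on at most a third of B,
    so some z avoids both exceptional sets ([good_point]). Finally
    |K| <= (4 n / rho)^n |B| ([eball_ratio]), which makes all constants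
    independent of h; [constant_bound] collects them, and [remainder_bound] is
    the resulting estimate on K.

    Two facts about weak derivatives on K link this to the norms of the theorem.
    The classical derivatives of the phi_l are weak derivatives
    ([csmooth_is_wderiv]), and weak derivatives are unique almost everywhere
    ([sqL2_wderiv]); hence R_j has the same norm as the weak derivative D^j of
    psi - Phi. *)

(** * Lebesgue measure on R^n: affine maps and boxes *)

Section row_measure.
Context {R : realType}.
Local Notation mu := (@lebesgue_row R).

Local Open Scope ereal_scope.

Lemma row_ordP n (i : 'I_n.+1) : i = ord0 \/ exists j : 'I_n, i = lift ord0 j.
Proof. by case: (unliftP ord0 i) => [j ->|->]; [right; exists j|left]. Qed.

Lemma row_consE0 n t (x : 'rV[R]_n) : row_cons (t, x) ord0 ord0 = t.
Proof. by have := congr1 fst (row_consK (t, x)). Qed.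

Lemma row_consE1 n t (x : 'rV[R]_n) j :
  row_cons (t, x) ord0 (lift ord0 j) = x ord0 j.
Proof. by have /rowP/(_ j) := congr1 snd (row_consK (t, x)); rewrite mxE. Qed.

Lemma measurable_row_cons1 n t :
  measurable_fun [set: 'rV[R]_n] (fun x : 'rV[R]_n => row_cons (t, x) : 'rV[R]_n.+1).
Proof.
apply: measurable_fun_rowP => i; case: (row_ordP i) => [->|[j ->]].
  by under eq_fun do rewrite row_consE0; exact: measurable_cst.
by under eq_fun do rewrite row_consE1; exact: measurable_row_coord.
Qed.

(** The recursive definition of [lebesgue_row] makes an integral over R^(n+1) an
    iterated integral, so that affine changes of variables and volumes of boxes
    reduce to dimension one by induction on n. *)
Lemma lebesgue_rowS_tonelli n (F : 'rV[R]_n.+1 -> \bar R) :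
  measurable_fun setT F -> (forall x, 0 <= F x) ->
  \int[mu n.+1]_x F x =
  \int[@lebesgue_measure R]_t \int[mu n]_x F (row_cons (t, x)).
Proof.
move=> mF F0.
have mc : measurable_fun setT (@row_cons R n) by exact: measurable_row_cons.
have := @ge0_integral_pushforward _ _ _ _ R _ mc (@lebesgue_measure R \x mu n)%E
  setT F measurableT mF (fun y _ => F0 y).
rewrite preimage_setT => H; apply: (etrans H).
have mFc : measurable_fun setT (F \o @row_cons R n) := measurableT_comp mF mc.
exact: (fubini_tonelli1 (F \o @row_cons R n) mFc (fun z => F0 _)).
Qed.

(** The image of Lebesgue measure under x |-> s x + b, scaled by s, agrees with
    Lebesgue measure on half-open intervals, hence on all measurable sets. *)
Lemma ge0_integral_lebesgue_affine (F : R -> \bar R) (s b : R) :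
  (0 < s)%R -> measurable_fun setT F -> (forall x, 0 <= F x) ->
  \int[@lebesgue_measure R]_x F (s * x + b)%R =
  (s^-1)%:E * \int[@lebesgue_measure R]_x F x.
Proof.
move=> s0 mF F0.
pose T := (fun x : measurableTypeR R => (s * x + b)%R : measurableTypeR R).
have mT : measurable_fun setT T.
  by apply: measurable_funD => //; exact: measurable_funM.
have s0' : (0 <= s)%R by exact: ltW.
pose m' : {measure set (measurableTypeR R) -> \bar R} :=
  mscale (NngNum s0') (pushforward (@lebesgue_measure R) T).
pose m := m' mT.
have mE A : measurable A -> lebesgue_measure A = m A.
  apply: lebesgue_measure_unique => _ [[u v] _ <-] /=.
  have E : T @^-1` `]u, v]%classic = `]((u - b) / s)%R, ((v - b) / s)%R]%classic.
    apply/seteqP; split => x /=; rewrite !in_itv/= /T.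
      by rewrite ltr_pdivrMr// ler_pdivlMr// [(x * s)%R]mulrC ltrBlDr lerBrDr.
    by rewrite ltr_pdivrMr// ler_pdivlMr// [(x * s)%R]mulrC ltrBlDr lerBrDr.
  have -> : m `]u, v]%classic =
      s%:E * lebesgue_measure `]((u - b) / s)%R, ((v - b) / s)%R]%classic.
    by rewrite -E.
  rewrite !lebesgue_measure_itv/= !lte_fin ltr_pM2r ?invr_gt0// ltrD2r.
  case: ifPn => _; last by rewrite mule0.
  by rewrite -!EFinB -EFinM; congr (_%:E); field; rewrite gt_eqF.
have H1 : \int[@lebesgue_measure R]_x F x = s%:E * \int[@lebesgue_measure R]_x F (T x).
  transitivity (\int[m]_x F x).
    by apply: eq_measure_integral => A mA _; exact: mE.
  rewrite ge0_integral_mscale//; congr (_ * _).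
  exact: (@ge0_integral_pushforward _ _ _ _ R T mT (@lebesgue_measure R) setT F).
by rewrite H1 muleA -EFinM mulVf ?gt_eqF// mul1e.
Qed.

Lemma measurable_row_affine n (s : R) (b : 'rV[R]_n) :
  measurable_fun setT (fun x : 'rV[R]_n => s *: x + b)%R.
Proof.
apply: measurable_fun_rowP => i.
under eq_fun do rewrite !mxE.
apply: measurable_funD => //; apply: measurable_funM => //.
exact: measurable_row_coord.
Qed.

Lemma ge0_integral_lebesgue_row_affine n (F : 'rV[R]_n -> \bar R) (s : R)
    (b : 'rV[R]_n) :
  (0 < s)%R -> measurable_fun setT F -> (forall x, 0 <= F x) ->
  \int[mu n]_x F (s *: x + b)%R = (s^-1 ^+ n)%:E * \int[mu n]_x F x.
Proof.
move=> s0; elim: n F b => [|n IH] F b mF F0.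
  by rewrite expr0 mul1e; apply: eq_integral => x _; congr F; apply/rowP => -[].
have mFa : measurable_fun setT (fun x : 'rV[R]_n.+1 => F (s *: x + b)%R).
  exact: measurableT_comp (measurable_row_affine _ _).
rewrite lebesgue_rowS_tonelli//.
pose b0 := b ord0 ord0; pose b1 := (\row_j b ord0 (lift ord0 j))%R.
have E t x : (s *: row_cons (t, x) + b = row_cons (s * t + b0, s *: x + b1))%R.
  by apply/rowP => i; case: (row_ordP i) => [->|[j ->]];
    rewrite [LHS]mxE [X in (X + _)%R]mxE ?row_consE0 ?row_consE1 ?mxE.
transitivity (\int[@lebesgue_measure R]_t
   ((s^-1 ^+ n)%:E * \int[mu n]_x F (row_cons ((s * t + b0)%R, x)))).
  apply: eq_integral => t _.
  rewrite -(IH (fun x => F (row_cons ((s * t + b0)%R, x))) b1)//.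
    by apply: eq_integral => x _; rewrite E.
  exact: measurableT_comp mF (measurable_row_cons1 _).
have mG : measurable_fun setT (fun t => \int[mu n]_x F (row_cons (t, x))).
  have mFc : measurable_fun setT (F \o @row_cons R n) :=
    measurableT_comp mF (@measurable_row_cons R n).
  exact: (@measurable_fun_fubini_tonelli_F _ _ _ _ R (mu n) _ mFc (fun z => F0 _)).
have G0 t : 0 <= \int[mu n]_x F (row_cons (t, x)) by exact: integral_ge0.
have mGs : measurable_fun setT (fun t => \int[mu n]_x F (row_cons ((s * t + b0)%R, x))).
  by apply: (measurableT_comp mG); apply: measurable_funD.
rewrite ge0_integralZl//; last by rewrite lee_fin exprn_ge0// invr_ge0 ltW.
rewrite (ge0_integral_lebesgue_affine b0 s0 mG G0) muleA -EFinM -exprSr.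
by rewrite (lebesgue_rowS_tonelli mF F0).
Qed.

Lemma integral_lebesgue_row_shift n (F : 'rV[R]_n -> \bar R) (b : 'rV[R]_n) :
  measurable_fun setT F ->
  \int[mu n]_x F (x + b)%R = \int[mu n]_x F x.
Proof.
move=> mF.
have H G : measurable_fun setT G -> (forall x, 0 <= G x) ->
    \int[mu n]_x G (x + b)%R = \int[mu n]_x G x.
  move=> mG G0; have := ge0_integral_lebesgue_row_affine b ltr01 mG G0.
  rewrite invr1 expr1n mul1e => <-.
  by apply: eq_integral => x _; rewrite scale1r.
rewrite integralE [RHS]integralE; congr (_ - _).
  etransitivity; last first.
    by apply: (H F^\+); [exact: measurable_funepos|move=> x; exact: funepos_ge0].
  by apply: eq_integral => x _; rewrite !funeposE.
etransitivity; last first.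
  by apply: (H F^\-); [exact: measurable_funeneg|move=> x; exact: funeneg_ge0].
by apply: eq_integral => x _; rewrite !funenegE.
Qed.

Definition obox n (a b : 'rV[R]_n) : set 'rV[R]_n :=
  [set x | forall i, (a ord0 i < x ord0 i < b ord0 i)%R].

Lemma measurable_obox n (a b : 'rV[R]_n) : measurable (obox a b).
Proof.
have -> : obox a b = \bigcap_(i in [set: 'I_n])
    ((fun x : 'rV[R]_n => x ord0 i) @^-1` `]a ord0 i, b ord0 i[%classic).
  apply/seteqP; split => x /= H i.
    by move=> _ /=; rewrite in_itv/=; exact: H.
  by have := H i I; rewrite /= in_itv/=.
apply: fin_bigcap_measurable => //= i _.
rewrite -[X in measurable X]setTI; exact: (@measurable_row_coord _ R n i).
Qed.

Lemma lebesgue_row_obox n (a b : 'rV[R]_n) :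
  (forall i, (a ord0 i <= b ord0 i)%R) ->
  mu n (obox a b) = (\prod_i (b ord0 i - a ord0 i)%R)%:E.
Proof.
elim: n a b => [|n IH] a b ab.
  rewrite big_ord0 /=.
  rewrite diracE mem_set//=.
  by move=> [].
rewrite -[LHS]mul1e -integral_cst; last exact: measurable_obox.
rewrite integral_mkcond /=.
rewrite lebesgue_rowS_tonelli; last 2 first.
- apply/(measurable_restrictT _ _).1; first exact: measurable_obox.
  exact: measurable_cst.
- by move=> x; rewrite patchE; case: ifP.
pose a1 := (\row_j a ord0 (lift ord0 j))%R; pose b1 := (\row_j b ord0 (lift ord0 j))%R.
have E t x : (obox a b) (row_cons (t, x)) <->
    (a ord0 ord0 < t < b ord0 ord0)%R /\ obox a1 b1 x.
  split => [H|[H1 H2] i].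
    split; first by have := H ord0; rewrite row_consE0.
    by move=> j; have := H (lift ord0 j); rewrite row_consE1 !mxE.
  case: (row_ordP i) => [->|[j ->]]; first by rewrite row_consE0.
  by rewrite row_consE1; have := H2 j; rewrite !mxE.
transitivity (\int[@lebesgue_measure R]_t
   ((fun _ => mu n (obox a1 b1)) \_ `]a ord0 ord0, b ord0 ord0[%classic) t).
  apply: eq_integral => t _; rewrite patchE; case: ifPn => [|] tab.
    rewrite inE/= in_itv/= in tab.
    rewrite -[RHS]mul1e -integral_cst; last exact: measurable_obox.
    rewrite [RHS]integral_mkcond; apply: eq_integral => x _.
    rewrite !patchE; congr (if _ then _ else _).
    by apply/idP/idP; rewrite !inE => H; [apply (E t x).1 in H; case: H|apply/E; split].
  rewrite integral0_eq// => x _; rewrite patchE ifF//.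
  apply/negP; rewrite inE => /E[H _].
  by move: tab; rewrite notin_setE/= in_itv/=; apply.
rewrite -integral_mkcond integral_cst//.
rewrite IH; last by move=> i; rewrite !mxE.
rewrite [X in _ * X](_ : _ = (b ord0 ord0 - a ord0 ord0)%:E).
  rewrite -EFinM big_ord_recl mulrC; congr ((_ * _)%R)%:E.
  by apply: eq_bigr => i _; rewrite !mxE.
etransitivity; first exact: lebesgue_measure_itv.
rewrite /= lte_fin; case: ltP => h; first by rewrite EFinB.
have /eqP -> : (a ord0 ord0 == b ord0 ord0)%R by rewrite eq_le h ab.
by rewrite subrr.
Qed.

End row_measure.

(** * Boxes and the topology of R^n *)

Section row_topology.
Context {R : realType}.
Local Notation mu := (@lebesgue_row R).

Lemma row_coord_le_norm n (x : 'rV[R]_n) i : `|x ord0 i| <= `|x|.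
Proof.
rewrite [leRHS]/Num.Def.normr /= mx_normrE; apply/bigmax_geP; right => /=.
by exists (ord0, i).
Qed.

Lemma row_norm_le n (x : 'rV[R]_n) (e : R) : 0 <= e ->
  (forall i, `|x ord0 i| <= e) -> `|x| <= e.
Proof.
move=> e0 H; rewrite [leLHS]/Num.Def.normr /= mx_normrE; apply: bigmax_le => //.
by move=> [i j] _ /=; rewrite ord1.
Qed.

Definition cbox n (a b : 'rV[R]_n) : set 'rV[R]_n :=
  [set x | forall i, a ord0 i <= x ord0 i <= b ord0 i].

Lemma obox_cbox n (a b : 'rV[R]_n) : obox a b `<=` cbox a b.
Proof. by move=> x H i; have /andP[/ltW -> /ltW ->] := H i. Qed.

Lemma closed_cbox n (a b : 'rV[R]_n) : closed (cbox a b).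
Proof.
have -> : cbox a b = \bigcap_(i in [set: 'I_n])
    ((fun x : 'rV[R]_n => x ord0 i) @^-1` `[a ord0 i, b ord0 i]%classic).
  apply/seteqP; split => x /= H i.
    by move=> _ /=; rewrite in_itv/=; exact: H.
  by have := H i I; rewrite /= in_itv/=.
apply: closed_bigI => i _; apply: closed_comp; last exact: itv_closed.
by move=> x _; exact: coord_continuous.
Qed.

Lemma bounded_cbox n (a b : 'rV[R]_n) : bounded_set (cbox a b).
Proof.
exists (`|a| + `|b|); split; first exact: num_real.
move=> M hM x /= H; apply: row_norm_le.
  by apply: le_trans (ltW hM); exact: addr_ge0.
move=> i; have /andP[h1 h2] := H i.
apply: le_trans (ltW hM).
have := row_coord_le_norm a i; have := row_coord_le_norm b i.
by rewrite !ler_norml => /andP[? ?] /andP[? ?]; apply/andP; split; lra.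
Qed.

Lemma compact_cbox n (a b : 'rV[R]_n) : compact (cbox a b).
Proof. exact: bounded_closed_compact (@bounded_cbox _ _ _) (@closed_cbox _ _ _). Qed.

Definition ratrow n (a : 'rV[rat]_n) : 'rV[R]_n := map_mx ratr a.

Lemma row_nbhs_ball n (U : set 'rV[R]_n) x : open U -> U x ->
  exists2 e : R, 0 < e & forall y, `|x - y| < e -> U y.
Proof.
move=> oU Ux; have /nbhs_ballP[e /= e0 eU] : nbhs x U by exact: open_nbhs_nbhs.
by exists e => // y; have := eU y; rewrite mx_norm_ball /ball_ /=.
Qed.

Lemma open_ratbox_cover n (U : set 'rV[R]_n) x : open U -> U x ->
  exists q : 'rV[rat]_n * 'rV[rat]_n,
    obox (ratrow q.1) (ratrow q.2) x /\ cbox (ratrow q.1) (ratrow q.2) `<=` U.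
Proof.
move=> oU Ux; have [e e0 eU] := row_nbhs_ball oU Ux.
have H (u v : R) : u < v -> exists q : rat, u < ratr q < v.
  by move=> uv; have [q] := rat_in_itvoo uv; rewrite in_itv /=; exists q.
have Ha i : exists q : rat, x ord0 i - e / 2 < (ratr q : R) < x ord0 i by apply: H; lra.
have Hb i : exists q : rat, x ord0 i < (ratr q : R) < x ord0 i + e / 2 by apply: H; lra.
have [a aP] := choice Ha; have [b bP] := choice Hb.
exists (\row_i a i, \row_i b i) => /=; split.
  by move=> i; rewrite !mxE; have /andP[_ ->] := aP i; have /andP[-> _] := bP i.
move=> y Hy; apply: eU; apply: (@le_lt_trans _ _ (e / 2)); last lra.
apply: row_norm_le; first lra.
move=> i; have := Hy i; rewrite !mxE => /andP[h1 h2].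
have /andP[h3 h4] := aP i; have /andP[h5 h6] := bP i.
by rewrite ler_norml; apply/andP; split; lra.
Qed.

Definition oboxes n : set (set 'rV[R]_n) := [set A | exists a b, A = obox a b].

Lemma oboxes_open n (U : set 'rV[R]_n) : open U -> <<s @oboxes n >> U.
Proof.
move=> oU.
pose F (k : nat) : set 'rV[R]_n :=
  if (unpickle k : option ('rV[rat]_n * 'rV[rat]_n)) is Some q then
    if `[< cbox (ratrow q.1) (ratrow q.2) `<=` U >] then
      obox (ratrow q.1) (ratrow q.2) else set0
  else set0.
have -> : U = \bigcup_k F k.
  apply/seteqP; split => [x Ux|x [k _]].
    have [q [q1 q2]] := open_ratbox_cover oU Ux.
    by exists (pickle q) => //; rewrite /F pickleK; case: asboolP.
  rewrite /F; case: unpickle => // q; case: asboolP => // h /obox_cbox; exact: h.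
apply: sigma_algebra_bigcup => k; rewrite /F; case: unpickle => [q|]; last exact: sigma_algebra0.
case: asboolP => // _; last exact: sigma_algebra0.
by apply: sub_sigma_algebra; exists (ratrow q.1), (ratrow q.2).
Qed.

(** The sigma-algebra is generated by the coordinates. It contains an open set
    because the latter is a countable union of boxes with rational corners. *)
Lemma open_row_measurable n (U : set 'rV[R]_n) : open U -> measurable U.
Proof.
move=> /oboxes_open; apply: smallest_sub; first exact: sigma_algebra_measurable.
by move=> _ [a [b ->]]; exact: measurable_obox.
Qed.

Lemma row_continuous_measurable n (K : set 'rV[R]_n) (f : 'rV[R]_n -> R) :
  open K -> {in K, continuous f} -> measurable_fun K f.
Proof.
move=> oK cf mK; apply: (measurability _ (RGenOpens.measurableE R)) => //.
move=> _ [_ [a [b ->] <-]]; apply: open_row_measurable.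
rewrite openE => x [Kx fx]; rewrite /interior.
apply: filterI; first exact: open_nbhs_nbhs.
apply: (cf x); first by rewrite inE.
by apply: open_nbhs_nbhs; split => //; exact: interval_open.
Qed.

Lemma continuous_row_measurable n (f : 'rV[R]_n -> R) :
  continuous f -> measurable_fun setT f.
Proof. by move=> cf; apply: row_continuous_measurable; [exact: openT|move=> x _; exact: cf]. Qed.

(** Countably many rational boxes cover U, so the null sets of the individual
    boxes can be united. *)
Lemma ae_ratbox n (U : set 'rV[R]_n) (P : 'rV[R]_n -> Prop) : open U ->
  (forall a b, cbox a b `<=` U -> {ae mu n, forall x, obox a b x -> P x}) ->
  {ae mu n, forall x, U x -> P x}.
Proof.
move=> oU H.
have Hk (k : nat) : {ae mu n, forall x,
    match (unpickle k : option ('rV[rat]_n * 'rV[rat]_n)) with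
    | Some q => cbox (ratrow q.1) (ratrow q.2) `<=` U ->
      obox (ratrow q.1) (ratrow q.2) x -> P x
    | None => True end}.
  case: unpickle => [q|]; last exact: aeW.
  have [h|h] := pselect (cbox (ratrow q.1) (ratrow q.2) `<=` U).
    by apply: filterS (H _ _ h) => x Hx _.
  by apply: aeW.
have := ae_foralln Hk; apply: filterS => x Hx Ux.
have [q [q1 q2]] := open_ratbox_cover oU Ux.
by have := Hx (pickle q); rewrite pickleK; apply.
Qed.

End row_topology.

(** * Flat functions *)

Section flat.
Context {R : realType}.

(** The functions P(1/x) exp(-1/x), extended by 0 to x <= 0, form a class that
    is closed under differentiation; smoothness follows by a plain induction. *)
Definition flat (P : {poly R}) (x : R) : R :=
  if 0 < x then P.[x^-1] * expR (- x^-1) else 0.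

(** As the derivative of 1/x is - (1/x)^2, differentiation acts on the
    polynomial factor by P |-> X^2 (P - P'). *)
Definition flat_deriv (P : {poly R}) : {poly R} := 'X^2 * (P - P^`()).

(** Quadratic decay at 0 makes the derivative there exist and vanish. It comes
    from exp(-y) <= (m + 2)! / y^(m + 2), where m bounds the growth of P. *)
Lemma flat_bound P : exists2 C : R, 0 <= C &
  forall h : R, 0 < h < 1 -> `|flat P h| <= C * h ^+ 2.
Proof.
pose A := \sum_(i < size P) `|P`_i|; pose m := size P.
have A0 : 0 <= A by apply: sumr_ge0.
exists (A * m.+2`!%:R); first by rewrite mulr_ge0.
move=> h /andP[h0 h1]; rewrite /flat h0; set y := h^-1.
have y1 : 1 <= y by rewrite /y invf_ge1// ltW.
have y0 : 0 < y by rewrite invr_gt0.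
have HP : `|P.[y]| <= A * y ^+ m.
  rewrite horner_coef; apply: (le_trans (ler_norm_sum _ _ _)).
  rewrite mulr_suml; apply: ler_sum => i _; rewrite normrM ler_wpM2l//.
  rewrite ger0_norm ?exprn_ge0 ?(ltW y0)//; apply: ler_weXn2l => //.
  by rewrite ltnW// /m ltn_ord.
(* one term of the exponential series beats the polynomial factor by y^2 *)
have HE : expR (- y) <= m.+2`!%:R * y^-1 ^+ m.+2.
  rewrite expRN -[leRHS]invrK lef_pV2 ?posrE ?expR_gt0//; last first.
    by rewrite invr_gt0 mulr_gt0// ?exprn_gt0 ?invr_gt0// ltr0n fact_gt0.
  rewrite invfM exprVn invrK mulrC.
  by apply: le_trans (expR_ge1Dxn m.+1 (ltW y0)); rewrite lerDr.
rewrite normrM (ger0_norm (expR_ge0 _)).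
apply: (le_trans (ler_pM _ _ HP HE)) => //.
have -> : h = y^-1 by rewrite /y invrK.
rewrite [leLHS](_ : _ = A * m.+2`!%:R * y^-1 ^+ 2 * (y * y^-1) ^+ m).
  by rewrite mulfV ?gt_eqF// expr1n mulr1.
by rewrite exprMn -addn2 exprD; ring.
Qed.

Lemma flat_is_derive P (x : R) : is_derive x 1 (flat P) (flat (flat_deriv P) x).
Proof.
have [x0|x0|->] := ltgtP x 0.
- rewrite {2}/flat ltNge (ltW x0)/=.
  have D0 : is_derive x (1 : R) (cst (0 : R)) 0 by exact: is_derive_cst.
  apply: near_eq_is_derive D0.
  have : \forall y \near x, y < 0 by apply: open_nbhs_nbhs; split => //; exact: open_lt.
  by apply: filterS => y y0; rewrite /flat ltNge (ltW y0).
- rewrite {2}/flat x0.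
  have xn0 : x != 0 by rewrite gt_eqF.
  have dV : is_derive x 1 (fun y : R => y^-1) (- x ^- 2 *: 1).
    exact: (@is_deriveV _ id).
  have d1 := @is_derive1_comp _ (horner P) _ x _ _ (is_derive_poly P x^-1) dV.
  have d2 := @is_derive1_comp _ expR (fun y : R => - y^-1) x _ _ (is_derive_expR _) (is_deriveN dV).
  have D0 : is_derive x (1 : R) (fun y : R => P.[y^-1] * expR (- y^-1))
      ((flat_deriv P).[x^-1] * expR (- x^-1)).
    apply: is_derive_eq (is_deriveM d1 d2) _.
    by rewrite /flat_deriv !hornerE /GRing.scale/= exprVn; ring.
  apply: near_eq_is_derive D0.
  have : \forall y \near x, 0 < y by apply: open_nbhs_nbhs; split => //; exact: open_gt.
  by apply: filterS => y y0; rewrite /flat y0.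
have -> : flat (flat_deriv P) 0 = 0 by rewrite /flat ltxx.
have [C C0 HC] := flat_bound P.
have f0 : flat P 0 = 0 by rewrite /flat ltxx.
have H : (fun h : R => h^-1 *: ((flat P \o shift 0) (h *: 1) - flat P 0)) @ 0^' --> (0 : R).
  apply/cvgrPdist_le => e e0; rewrite !near_withinE.
  have d0 : 0 < Num.min 1 (e / (C + 1)) by rewrite lt_min ltr01 divr_gt0//; lra.
  have : \forall h \near (0 : R), `|h| < Num.min 1 (e / (C + 1)).
    by have := @nbhs0_lt R R _ d0.
  apply: filterS => h hd hn0.
  rewrite sub0r normrN /= f0 subr0 addr0 [h *: 1]mulr1 /GRing.scale/=.
  have [h0|h0] := ltP 0 h; last first.
    by rewrite /flat ltNge h0/= mulr0 normr0 ltW.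
  move: hd; rewrite gtr0_norm// lt_min => /andP[h1 h2].
  rewrite normrM normfV (gtr0_norm h0).
  have := HC h; rewrite h0 h1 => /(_ isT) Hb.
  rewrite mulrC ler_pdivrMr//; apply: (le_trans Hb).
  rewrite expr2 mulrA ler_pM2r//.
  move: h2; rewrite ltr_pdivlMr; last lra.
  by move=> h2; nra.
by apply: DeriveDef; [apply/cvg_ex; exists 0|apply/cvg_lim].
Qed.

Lemma flat1_le0 (x : R) : x <= 0 -> flat 1 x = 0.
Proof. by move=> x0; rewrite /flat ltNge x0. Qed.

Lemma flat1_ge0_le1 (x : R) : 0 <= flat 1 x <= 1.
Proof.
rewrite /flat; case: ifPn => x0; last by rewrite lexx ler01.
rewrite hornerE mul1r expR_ge0/= expR_le1 ?oppr_le0 ?invr_ge0; first exact: ltW.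
Qed.

Lemma flat1_cvg (x : R) : 0 < x -> flat 1 (k.+1%:R * x) @[k --> \oo] --> (1 : R).
Proof.
move=> x0.
have -> : (fun k : nat => flat 1 (k.+1%:R * x)) = (fun k => expR (- (k.+1%:R^-1 * x^-1))).
  apply/funext => k; rewrite /flat mulr_gt0// hornerE mul1r invfM//.
rewrite -[X in _ --> X]expR0.
apply: continuous_cvg; first exact: continuous_expR.
rewrite -oppr0; apply: cvgN; rewrite -[X in _ --> X](mul0r x^-1).
apply: cvgMl; exact: cvg_harmonic.
Qed.

End flat.

(** * Smooth functions and test functions *)

Section smooth.
Context {R : realType}.

Lemma line_is_derive n (f : 'rV[R]_n -> R) (y e : 'rV[R]_n) (s : R) :
  derivable f (y + s *: e) e ->
  is_derive s 1 (fun t : R => f (y + t *: e)) ('D_e f (y + s *: e)).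
Proof.
have E : (fun h : R => h^-1 *: ((f \o shift (y + s *: e)) (h *: e) - f (y + s *: e))) =
   (fun h : R => h^-1 *: (((fun t : R => f (y + t *: e)) \o shift s) (h *: 1) - f (y + s *: e))).
  apply/funext => h /=; congr (_ *: (f _ - _)).
  by rewrite [h *: 1]mulr1 scalerDl addrCA.
rewrite /derivable /derive E => H; exact: DeriveDef.
Qed.

Lemma derive_rowE n (f : 'rV[R]_n -> R) (x e : 'rV[R]_n) :
  differentiable f x -> 'D_e f x = \sum_i e ord0 i * partial i f x.
Proof.
move=> df; rewrite deriveE// [X in 'd f x X]row_sum_delta linear_sum/=.
by apply: eq_bigr => i _; rewrite linearZ/= /partial deriveE.
Qed.

(** Unlike the lists of partial derivatives in [test_function], this recursion
    fits proofs by induction on the order; [CkP] says that both describe the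
    same smooth functions. *)
Fixpoint Ck n (k : nat) (f : 'rV[R]_n -> R) : Prop :=
  (forall x, differentiable f x) /\
  if k is k'.+1 then forall i, Ck k' (partial i f) else True.

Lemma CkS n k (f : 'rV[R]_n -> R) : Ck k.+1 f <->
  (forall x, differentiable f x) /\ forall i, Ck k (partial i f).
Proof. by []. Qed.

Lemma Ck_diff n k (f : 'rV[R]_n -> R) x : Ck k f -> differentiable f x.
Proof. by case: k => [|k] []. Qed.

Lemma Ck_partial n k (f : 'rV[R]_n -> R) i : Ck k.+1 f -> Ck k (partial i f).
Proof. by move=> /CkS[_]. Qed.

Lemma CkW n k (f : 'rV[R]_n -> R) : Ck k.+1 f -> Ck k f.
Proof.
elim: k f => [|k IH] f; first by case.
by move=> /CkS[H1 H2]; apply/CkS; split => // i; exact: IH.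
Qed.

Lemma CkP n (f : 'rV[R]_n -> R) :
  (forall s x, differentiable (partials s f) x) <-> forall k, Ck k f.
Proof.
split.
  move=> H k; elim: k f H => [|k IH] f H; first by split => //; exact: (H [::]).
  apply/CkS; split; first exact: (H [::]).
  move=> i; apply: IH => s x.
  by have := H (rcons s i) x; rewrite /partials foldr_rcons.
move=> H s; elim/last_ind: s f H => [|s i IH] f H x; first exact: (Ck_diff _ (H 0%N)).
by rewrite /partials foldr_rcons; apply: IH => k; exact: Ck_partial.
Qed.

Lemma Ck_cst n k (c : R) : Ck k (fun _ : 'rV[R]_n => c).
Proof.
elim: k c => [|k IH] c; first by [].
apply/CkS; split=> // i; rewrite (_ : partial i _ = fun=> 0)//.
by apply/funext => x; rewrite /partial derive_cst.
Qed.

Lemma CkD n k (f g : 'rV[R]_n -> R) : Ck k f -> Ck k g -> Ck k (f \+ g).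
Proof.
elim: k f g => [|k IH] f g.
  by move=> [f1 _] [g1 _]; split => // x; exact: differentiableD.
move=> /CkS[f1 f2] /CkS[g1 g2]; apply/CkS; split.
  by move=> x; exact: differentiableD.
move=> i; rewrite (_ : partial i _ = partial i f \+ partial i g); first exact: IH.
apply/funext => x; rewrite /partial; apply: deriveD; exact: diff_derivable.
Qed.

Lemma CkM n k (f g : 'rV[R]_n -> R) : Ck k f -> Ck k g -> Ck k (f \* g).
Proof.
elim: k f g => [|k IH] f g.
  by move=> [f1 _] [g1 _]; split => // x; exact: differentiableM.
move=> fk gk; have /CkS[f1 f2] := fk; have /CkS[g1 g2] := gk; apply/CkS; split.
  by move=> x; exact: differentiableM.
move=> i; rewrite (_ : partial i _ = (f \* partial i g) \+ (g \* partial i f)).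
  by apply: CkD; apply: IH => //; exact: CkW.
apply/funext => x; rewrite /partial; apply: deriveM; exact: diff_derivable.
Qed.

Lemma Ck_prod n k (I : Type) (s : seq I) (F : I -> 'rV[R]_n -> R) :
  (forall i, Ck k (F i)) -> Ck k (fun x => \prod_(i <- s) F i x).
Proof.
move=> H; elim: s => [|i s IH].
  under eq_fun do rewrite big_nil; exact: Ck_cst.
under eq_fun do rewrite big_cons; exact: (CkM (H i) IH).
Qed.

Lemma flat_differentiable P (x : R) : differentiable (flat P : R -> R) x.
Proof. by apply/derivable1_diffP; case: (flat_is_derive P x). Qed.

Lemma flat_diffE P (x h : R) : 'd (flat P) x h = h * flat (flat_deriv P) x.
Proof.
have E : h = h *: (1 : R) by rewrite /GRing.scale/= mulr1.
rewrite {1}E linearZ/=; congr (_ * _).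
rewrite -deriveE; last exact: flat_differentiable.
by case: (flat_is_derive P x).
Qed.

Lemma Ck_flat n k P (a b : R) (i : 'I_n) :
  Ck k (fun x : 'rV[R]_n => flat P (a * x ord0 i + b)).
Proof.
pose l (x : 'rV[R]_n) : R := x ord0 i.
have dl x : differentiable l x by exact: differentiable_coord.
have dla x : differentiable (fun x => a * l x + b) x.
  by apply: differentiableD => //; apply: differentiableM.
have derl x v : 'D_v (fun x => a * l x + b) x = a * v ord0 i.
  rewrite /derive; apply/cvg_lim => //.
  apply: cvg_near_cst; rewrite near_withinE; near=> h => h0.
  by rewrite /= /l !mxE /GRing.scale/=; field; exact: h0.
have dF Q x : differentiable (fun x : 'rV[R]_n => flat Q (a * x ord0 i + b)) x.
  apply: (@differentiable_comp _ _ _ _ (fun x : 'rV[R]_n => a * l x + b) (flat Q)) => //.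
  exact: flat_differentiable.
elim: k P => [|k IH] P; first by split.
apply/CkS; split => //.
move=> j; rewrite (_ : partial j _ =
  (fun=> a * (delta_mx ord0 j : 'rV[R]_n) ord0 i) \*
     (fun x : 'rV[R]_n => flat (flat_deriv P) (a * x ord0 i + b))).
  by apply: CkM; [exact: Ck_cst|exact: IH].
apply/funext => x; rewrite /partial deriveE//.
rewrite (_ : (fun x : 'rV[R]_n => _) = flat P \o (fun x => a * l x + b))//.
rewrite diff_comp//=; last exact: flat_differentiable.
by rewrite flat_diffE -deriveE// derl.
Unshelve. all: by end_near. Qed.

Lemma continuous_within (f : R -> R) (a b : R) : continuous f ->
  {within `[a, b], continuous f}.
Proof. by move=> cf; apply: continuous_subspaceT. Qed.

(** Apply the mean value theorem in direction i to x |-> f (x + h e_j) - f x,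
    then in direction j to the i-th partial derivative of f. The left-hand side
    is symmetric in i and j, which leads to [Schwarz] as h tends to 0. *)
Lemma second_difference n (f : 'rV[R]_n -> R) (i j : 'I_n) (x : 'rV[R]_n) (h : R) :
  Ck 2 f -> 0 < h ->
  let u := delta_mx ord0 i in let w := delta_mx ord0 j in
  exists p, `|x - p| <= 2 * h /\
    f (x + h *: w + h *: u) - f (x + h *: u) - (f (x + h *: w) - f x) =
    h ^+ 2 * partial j (partial i f) p.
Proof.
move=> f2 h0 u w.
pose g s := f (x + h *: w + s *: u) - f (x + s *: u).
pose dg s := partial i f (x + h *: w + s *: u) - partial i f (x + s *: u).
have dgP (s : R) : is_derive s (1 : R) g (dg s).
  by apply: is_deriveB; apply: line_is_derive; apply: diff_derivable;
    exact: (Ck_diff _ f2).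
have cg : continuous g.
  by move=> s; apply: differentiable_continuous; apply/derivable1_diffP; case: (dgP s).
have [c ci gc] := MVT h0 (fun s _ => dgP s) (continuous_within cg).
pose k t := partial i f (x + c *: u + t *: w).
pose dk t := partial j (partial i f) (x + c *: u + t *: w).
have dkP (s : R) : is_derive s (1 : R) k (dk s).
  apply: line_is_derive; apply: diff_derivable.
  exact: (Ck_diff _ (Ck_partial i f2)).
have ck : continuous k.
  by move=> s; apply: differentiable_continuous; apply/derivable1_diffP; case: (dkP s).
have [d di kd] := MVT h0 (fun s _ => dkP s) (continuous_within ck).
exists (x + c *: u + d *: w); split.
  have nd l : `|(delta_mx ord0 l : 'rV[R]_n)| <= 1.
    apply: row_norm_le => // m; rewrite mxE; case: (_ && _) => /=.
      by rewrite normr1.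
    by rewrite normr0.
  rewrite -addrA opprD addNKr normrN.
  apply: (le_trans (ler_normD _ _)); rewrite !normrZ.
  move: ci di; rewrite !in_itv/= => /andP[c0 c1] /andP[d0 d1].
  have := nd i; have := nd j; rewrite -/u -/w => hw hu.
  rewrite !gtr0_norm//.
  have : c * `|u| <= h * 1 by apply: ler_pM => //; exact: ltW.
  have : d * `|w| <= h * 1 by apply: ler_pM => //; exact: ltW.
  by lra.
move: gc; rewrite /g scale0r !addr0 subr0 => ->.
have -> : dg c = k h - k 0.
  by rewrite /dg /k scale0r addr0 -!addrA [h *: w + _]addrC.
by rewrite kd subr0 /dk expr2; ring.
Qed.

Lemma Schwarz n (f : 'rV[R]_n -> R) (i j : 'I_n) : Ck 2 f ->
  partial i (partial j f) = partial j (partial i f).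
Proof.
move=> f2; apply/funext => x.
have cont a b : continuous (partial a (partial b f)).
  move=> y; apply: differentiable_continuous.
  exact: (Ck_diff _ (Ck_partial a (Ck_partial b f2))).
apply/eqP; rewrite -subr_eq0 -normr_le0; apply/ler_addgt0Pr => e e0; rewrite add0r.
have e20 : 0 < e / 2 by rewrite divr_gt0.
have near1 a b : \forall y \near x, `|partial a (partial b f) x - partial a (partial b f) y| < e / 2.
  by have /cvgrPdist_lt/(_ _ e20) := cont a b x.
have [d /= d0 H] := (nbhs_ballP _ _).1 (filterI (near1 i j) (near1 j i)).
have d4 : 0 < d / 4 by rewrite divr_gt0.
have [p [p1 p2]] := second_difference i j x f2 d4.
have [q [q1 q2]] := second_difference j i x f2 d4.
have E : partial j (partial i f) p = partial i (partial j f) q.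
  have := p2; rewrite (_ : x + _ + _ = x + d / 4 *: delta_mx ord0 i + d / 4 *: delta_mx ord0 j); last by rewrite addrAC.
  have h2 : (d / 4) ^+ 2 != 0 by rewrite expf_neq0// gt_eqF.
  move=> p2'; apply: (mulfI h2).
  have aux (a1 a2 a3 a4 : R) : a1 - a2 - (a3 - a4) = a1 - a3 - (a2 - a4) by ring.
  exact: etrans (esym p2') (etrans (aux _ _ _ _) q2).
have dd : 2 * (d / 4) < d by clear -d0; lra.
have Hp : ball x d p by rewrite mx_norm_ball; exact: le_lt_trans p1 dd.
have Hq : ball x d q by rewrite mx_norm_ball; exact: le_lt_trans q1 dd.
have [_ Hp2] := H _ Hp; have [Hq1 _] := H _ Hq.
rewrite /= E in Hp2; move: Hp2 Hq1.
move: (partial i (partial j f) x) (partial j (partial i f) x) (partial i (partial j f) q) => A B D.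
clear -e0; rewrite !ltr_norml => /andP[? ?] /andP[? ?].
by rewrite ler_norml; apply/andP; split; lra.
Qed.

Lemma Ck_partials n (f : 'rV[R]_n -> R) s : (forall k, Ck k f) ->
  forall k, Ck k (partials s f).
Proof.
by move/CkP => fS; apply/CkP => t x; rewrite /partials -foldr_cat; exact: fS.
Qed.

Lemma partial_partials n (f : 'rV[R]_n -> R) i s : (forall k, Ck k f) ->
  partial i (partials s f) = partials s (partial i f).
Proof.
move=> fS; elim: s => //= j s IH; rewrite Schwarz; first by rewrite IH.
exact: Ck_partials.
Qed.

Lemma partials_perm n (f : 'rV[R]_n -> R) s t : (forall k, Ck k f) ->
  perm_eq s t -> partials s f = partials t f.
Proof.
move=> fS; elim: s t => [|i s IH] t.
  by rewrite perm_sym => /perm_nilP ->.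
move=> st; have it : i \in t by rewrite -(perm_mem st) mem_head.
move: st; case/splitPr: it => t1 t2; rewrite perm_sym -cat1s perm_catCA /= perm_cons perm_sym => st.
rewrite /= (IH _ st) /partials !foldr_cat /=.
exact/partial_partials/Ck_partials.
Qed.

Definition mi_add n (j : 'I_n -> nat) (i : 'I_n) : 'I_n -> nat :=
  fun l => (j l + (l == i))%N.

Lemma mi_order_add n (j : 'I_n -> nat) i : mi_order (mi_add j i) = (mi_order j).+1.
Proof.
rewrite /mi_order /mi_add big_split/= -[RHS]addn1; congr addn.
by rewrite (bigD1 i)//= eqxx big1 ?addn0// => l /negbTE ->.
Qed.

Lemma mi_seq_count n (j : 'I_n -> nat) i :
  count_mem i (flatten [seq nseq (j k) k | k <- enum 'I_n]) = j i.
Proof.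
rewrite count_flatten -map_comp.
rewrite (_ : sumn _ = (\sum_(k <- enum 'I_n) j k * (k == i))%N); last first.
  rewrite sumnE big_map; apply: eq_bigr => k _ /=.
  by rewrite count_nseq /= mulnC.
rewrite big_enum/= (bigD1 i)//= eqxx muln1 big1 ?addn0// => l /negbTE ->.
by rewrite muln0.
Qed.

(** [mpartial] takes derivatives in a fixed order of the coordinates; Schwarz'
    theorem allows one more derivative to be moved to its place. *)
Lemma mpartial_partial n (f : 'rV[R]_n -> R) j i : (forall k, Ck k f) ->
  mpartial j (partial i f) = mpartial (mi_add j i) f.
Proof.
move=> fS; rewrite /mpartial -[LHS]/(partials _ (partials [:: i] f)).
rewrite /partials -foldr_cat; apply: partials_perm => //.
apply/allP => l _; apply/eqP => /=.
by rewrite count_cat !mi_seq_count /= addn0 /mi_add eq_sym.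
Qed.

Lemma mpartialE n (j : 'I_n -> nat) : exists s : seq 'I_n,
  size s = mi_order j /\ forall f : 'rV[R]_n -> R, mpartial j f = partials s f.
Proof.
exists (flatten [seq nseq (j k) k | k <- enum 'I_n]); split => //.
rewrite size_flatten /shape -map_comp sumnE big_map /mi_order big_enum/=.
by apply: eq_bigr => k _; rewrite size_nseq.
Qed.

Lemma test_functionP n (K : set 'rV[R]_n) v : test_function K v <->
  [/\ forall k, Ck k v, compact (closure [set x | v x != 0]) &
   closure [set x | v x != 0] `<=` K].
Proof.
by split => -[H1 H2 H3]; split => //; [apply/CkP => s x|move/CkP: H1 => H1 s x].
Qed.

Lemma partial_support n (v : 'rV[R]_n -> R) i :
  [set x | partial i v x != 0] `<=` closure [set x | v x != 0].
Proof.
move=> x /= dx; apply: contrapT => nx; move/eqP: dx; apply.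
have : \forall y \near x, v y = 0.
  have oC : open (~` closure [set x | v x != 0]) by exact/closed_openC/closed_closure.
  have := open_nbhs_nbhs (conj oC nx); apply: filterS => y Hy.
  apply/eqP/negPn/negP => vy; apply: Hy; exact: subset_closure.
move=> H; rewrite /partial (@near_eq_derive _ _ _ v (fun=> 0))//.
exact: derive_cst.
Qed.

Lemma test_function_partial n (K : set 'rV[R]_n) v i :
  test_function K v -> test_function K (partial i v).
Proof.
move=> /test_functionP[H1 H2 H3]; apply/test_functionP.
have sub : closure [set x | partial i v x != 0] `<=` closure [set x | v x != 0].
  rewrite [X in _ `<=` X](closure_id _).1; last exact: closed_closure.
  by apply: closure_subset; exact: partial_support.
split.
- by move=> k; exact: Ck_partial (H1 k.+1).
- by apply: subclosed_compact sub => //; exact: closed_closure.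
- exact: subset_trans sub H3.
Qed.

Lemma partials_shift n (v : 'rV[R]_n -> R) (e : 'rV[R]_n) s :
  partials s (fun x => v (x + e)) = fun x => partials s v (x + e).
Proof.
elim: s => //= i s ->; apply/funext => x; rewrite /partial /derive.
have -> // : (fun x0 : 'rV[R]_n => partials s v (x0 + e)) \o shift x = partials s v \o shift (x + e).
by apply/funext => h /=; rewrite addrA.
Qed.

Lemma test_function_shift n (K K' : set 'rV[R]_n) v e : test_function K v ->
  (forall x, K x -> K' (x - e)) ->
  test_function K' (fun x => v (x + e)).
Proof.
move=> [H1 H2 H3] KK'.
have dS (c : 'rV[R]_n) x : differentiable (fun x : 'rV[R]_n => x + c) x by exact: differentiableD.
have sub : closure [set x | v (x + e) != 0] `<=`
   (fun x => x - e) @` closure [set x | v x != 0].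
  move=> x Hx; exists (x + e); last by rewrite addrK.
  move=> B /= HB; have : nbhs x ((fun x => x + e) @^-1` B).
    exact: (differentiable_continuous (dS e x)).
  by move=> /Hx[y /= [vy By]]; exists (y + e).
have cpt : compact ((fun x => x - e) @` closure [set x | v x != 0]).
  apply: continuous_compact => //; apply: continuous_subspaceT => x.
  exact: (differentiable_continuous (dS (- e) x)).
split.
- move=> s x; rewrite partials_shift.
  by apply: (@differentiable_comp _ _ _ _ (fun x : 'rV[R]_n => x + e)).
- by apply: subclosed_compact sub => //; exact: closed_closure.
- by move=> x /sub[y /H3 Ky <-]; exact: KK'.
Qed.

(** Smooth functions that are positive exactly on the open box and converge to
    its indicator as k grows. *)
Definition bump n (a b : 'rV[R]_n) (k : nat) (x : 'rV[R]_n) : R :=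
  \prod_i (flat 1 (k.+1%:R * (x ord0 i - a ord0 i)) *
           flat 1 (k.+1%:R * (b ord0 i - x ord0 i))).

Lemma bump_Ck n (a b : 'rV[R]_n) k m : Ck m (bump a b k).
Proof.
apply: Ck_prod => i; apply: (@CkM _ _
  (fun x : 'rV[R]_n => flat 1 (k.+1%:R * (x ord0 i - a ord0 i)))
  (fun x : 'rV[R]_n => flat 1 (k.+1%:R * (b ord0 i - x ord0 i)))).
  rewrite (_ : (fun x : 'rV[R]_n => _) =
    (fun x => flat 1 (k.+1%:R * x ord0 i + (- k.+1%:R * a ord0 i)))); first exact: Ck_flat.
  by apply/funext => x; rewrite mulrBr mulNr.
rewrite (_ : (fun x : 'rV[R]_n => _) =
    (fun x => flat 1 ((- k.+1%:R) * x ord0 i + (k.+1%:R * b ord0 i)))); first exact: Ck_flat.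
by apply/funext => x; rewrite mulrBr mulNr addrC.
Qed.

Lemma bump_ge0_le1 n (a b : 'rV[R]_n) k x : 0 <= bump a b k x <= 1.
Proof.
rewrite /bump; elim/big_rec: _ => [|i y _ /andP[y0 y1]]; first by rewrite ler01 lexx.
have /andP[f0 f1] := flat1_ge0_le1 (k.+1%:R * (x ord0 i - a ord0 i)).
have /andP[g0 g1] := flat1_ge0_le1 (k.+1%:R * (b ord0 i - x ord0 i)).
by rewrite !mulr_ge0//= !mulr_ile1// mulr_ge0.
Qed.

Lemma bump_out n (a b : 'rV[R]_n) k x : ~ obox a b x -> bump a b k x = 0.
Proof.
move=> /existsNP[i /negP]; rewrite negb_and -!leNgt => H.
rewrite /bump (bigD1 i)//=; case/orP: H => H.
  by rewrite flat1_le0 ?mul0r// mulr_ge0_le0// subr_le0.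
by rewrite [X in _ * X * _]flat1_le0 ?mulr0 ?mul0r// mulr_ge0_le0// subr_le0.
Qed.

Lemma bump_cvg n (a b : 'rV[R]_n) x : obox a b x -> bump a b k x @[k --> \oo] --> (1 : R).
Proof.
move=> H; rewrite (_ : 1 = \prod_(i : 'I_n) (1 * 1 : R)); last first.
  by rewrite big1// => i _; rewrite mulr1.
rewrite /bump; elim: (index_enum 'I_n) => [|i s IH].
  rewrite big_nil; under eq_fun do rewrite big_nil; exact: cvg_cst.
rewrite big_cons; under eq_fun do rewrite big_cons.
have /andP[h1 h2] := H i.
by apply: cvgM => //; apply: cvgM; apply: flat1_cvg; rewrite subr_gt0.
Qed.

Lemma test_function_bump n (U : set 'rV[R]_n) (a b : 'rV[R]_n) k :
  cbox a b `<=` U -> test_function U (bump a b k).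
Proof.
move=> abU.
have sub : closure [set x | bump a b k x != 0] `<=` cbox a b.
  rewrite [X in _ `<=` X](closure_id _).1; last exact: closed_cbox.
  apply: closure_subset => x /= /eqP nx; apply: obox_cbox.
  by apply: contrapT => /(bump_out k).
apply/test_functionP; split.
- by move=> m; exact: bump_Ck.
- by apply: subclosed_compact (@compact_cbox _ _ a b) sub; exact: closed_closure.
- exact: subset_trans sub abU.
Qed.

End smooth.

(** * The fundamental lemma of the calculus of variations *)

Lemma dominated_cvg_integral d (T : measurableType d) (R : realType) (m : {measure set T -> \bar R})
    (D : set T) (mD : measurable D) (f_ : (T -> \bar R)^nat) (f g : T -> \bar R) :
  (forall k, measurable_fun D (f_ k)) -> measurable_fun D f ->
  {ae m, forall x, D x -> f_ ^~ x @ \oo --> f x} -> m.-integrable D g ->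
  {ae m, forall x k, D x -> (`|f_ k x| <= g x)%E} ->
  ((\int[m]_(x in D) f_ k x) @[k --> \oo] --> \int[m]_(x in D) f x)%E.
Proof.
by move=> mf_ mf f_f ig f_g; have [] := dominated_convergence mD mf_ mf f_f ig f_g.
Qed.

Section fundamental.
Context {R : realType}.
Local Notation mu := (@lebesgue_row R).

(** Open boxes are stable under intersection and generate the sigma-algebra, so
    Dynkin's lemma applies to them. *)
Lemma measurable_oboxes n (A : set 'rV[R]_n) : measurable A -> <<s @oboxes R n >> A.
Proof.
move: A; apply: smallest_sub; first exact: smallest_sigma_algebra.
rewrite -bigcup_seq; apply: bigcup_sub => i _ A [B mB <-].
have : measurable_fun [set: g_sigma_algebraType (@oboxes R n)]
    (fun x : g_sigma_algebraType (@oboxes R n) => (x : 'rV[R]_n) ord0 i).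
  apply: (measurability _ (RGenOpens.measurableE R)) => //.
  move=> _ [_ [a [b ->] <-]]; apply: oboxes_open; rewrite setTI.
  apply: open_comp; last exact: interval_open.
  by move=> x _; exact: coord_continuous.
by move=> /(_ measurableT B mB).
Qed.

Lemma oboxI n (a b a' b' : 'rV[R]_n) : obox a b `&` obox a' b' =
  obox (\row_i Num.max (a ord0 i) (a' ord0 i)) (\row_i Num.min (b ord0 i) (b' ord0 i)).
Proof.
apply/seteqP; split => x /=.
  move=> [H1 H2] i; rewrite !mxE gt_max lt_min.
  by have /andP[-> ->] := H1 i; have /andP[-> ->] := H2 i.
move=> H; split=> i; have := H i; rewrite !mxE gt_max lt_min.
  by move=> /andP[/andP[-> _] /andP[-> _]].
by move=> /andP[/andP[_ ->] /andP[_ ->]].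
Qed.

Local Open Scope ereal_scope.

(** The sets over which g integrates to 0 form a lambda-system: increasing
    unions are handled by dominated convergence. *)
Lemma integral_zero_of_oboxes n (Q : set 'rV[R]_n) (g : 'rV[R]_n -> \bar R) :
  measurable Q -> (mu n).-integrable Q g ->
  \int[mu n]_(x in Q) g x = 0 ->
  (forall a b, \int[mu n]_(x in Q `&` obox a b) g x = 0) ->
  {ae mu n, forall x, Q x -> g x = 0}.
Proof.
move=> mQ ig gQ gB.
have H : <<s @oboxes R n >> `<=` [set A | measurable A /\ \int[mu n]_(x in Q `&` A) g x = 0].
  apply: lambda_system_subset.
  - by move=> _ _ [a [b ->]] [a' [b' ->]]; rewrite oboxI; do 2 eexists.
  - split => //.
    + by split; [exact: measurableT|rewrite setIT].
    + move=> A B BA [mA gA] [mB gB']; split; first exact: measurableD.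
      have AE : Q `&` A = (Q `&` (A `\` B)) `|` (Q `&` B).
        by rewrite -setIUr setUC setDUK.
      move: gA; rewrite AE integral_setU//=.
      * by rewrite gB' adde0.
      * by apply: measurableI => //; exact: measurableD.
      * exact: measurableI.
      * rewrite -AE; apply: measurable_funS (measurable_int _ ig) => //; exact: subIsetl.
      * apply/disj_set2P; rewrite -subset0 => x.
        by case=> -[_ [_ nb]] [_ bx]; case: (nb bx).
    + move=> F ndF HF; split; first by apply: bigcupT_measurable => k; case: (HF k).
      have mF k : measurable (F k) by case: (HF k).
      have mUF : measurable (\bigcup_k F k) by exact: bigcupT_measurable.
      rewrite integral_mkcondr.
      have mgF (A : set 'rV[R]_n) : measurable A -> measurable_fun Q (g \_ A).
        move=> mA; apply/(measurable_restrict _ mA mQ).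
        by apply: measurable_funS (measurable_int _ ig) => //; exact: subIsetl.
      have cv : (\int[mu n]_(x in Q) (g \_ (F k)) x) @[k --> \oo] -->
            \int[mu n]_(x in Q) (g \_ (\bigcup_k F k)) x.
        apply: (@dominated_cvg_integral _ _ R (mu n) Q mQ _ _ (abse \o g)).
        - by move=> k; exact: mgF.
        - exact: mgF.
        - apply: aeW => x Qx; have [[k _ Fkx]|nF] := pselect ((\bigcup_k F k) x).
            apply: cvg_near_cst; exists k => // m /= km; rewrite !patchE !mem_set//.
              by exists k.
            by move: x Fkx {Qx}; exact/subsetPset/ndF.
          apply: cvg_near_cst; apply: nearW => m; rewrite !patchE !memNset//.
          by move=> Fmx; apply: nF; exists m.
        - exact: integrable_abse.
        - apply: aeW => x k Qx; rewrite patchE; case: ifP => //= _.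
          by rewrite normr0 abse_ge0.
      rewrite -(cvg_lim _ cv)//; apply/cvg_lim => //; apply: cvg_near_cst.
      apply: nearW => k; case: (HF k) => _ h; apply: etrans h.
      by rewrite integral_mkcondr.
  - by move=> _ [a [b ->]]; split => //; exact: measurable_obox.
  - by [].
have := @integral_ae_eq _ _ R (mu n) Q mQ (cst 0) g ig (measurable_cst _).
have H' : forall E, E `<=` Q -> measurable E -> \int[mu n]_(x in E) g x = \int[mu n]_(x in E) (cst 0) x.
  move=> E EQ mE; rewrite integral_cst// mul0e.
  have [_] := H _ (measurable_oboxes mE).
  by rewrite setIidr.
by move=> /(_ H').
Qed.

Lemma integrable_mul_bounded_on n (U : set 'rV[R]_n) (g v : 'rV[R]_n -> R) (M : R) :
  measurable U -> (mu n).-integrable U (EFin \o g) ->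
  measurable_fun U v -> (forall x, U x -> `|v x| <= M)%R ->
  (mu n).-integrable U (fun x => (g x * v x)%:E).
Proof.
move=> mU ig mv vM.
apply: (@le_integrable _ _ _ _ _ _ _ (fun x => (`|M| * `|g x|)%:E)) => //.
- apply/measurable_EFinP; apply: measurable_funM => //.
  by apply/measurable_EFinP; exact: measurable_int ig.
- move=> x Ux /=; rewrite lee_fin normrM mulrC [leRHS]ger0_norm; last by rewrite mulr_ge0.
  by rewrite ler_wpM2r//; apply: le_trans (vM x Ux) _; exact: ler_norm.
- under eq_fun do rewrite EFinM.
  apply: integrableZl => //.
  exact: (integrable_abse ig).
Qed.

(** Bumps converge to indicators of boxes, so g integrates to 0 over each box
    whose closure lies in U. Inside such a box this covers a generating family
    of sets, so g vanishes almost everywhere there, and countably many of these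
    boxes cover U. *)
Lemma fundamental_lemma n (U : set 'rV[R]_n) (g : 'rV[R]_n -> R) :
  open U -> (mu n).-integrable U (EFin \o g) ->
  (forall v, test_function U v -> \int[mu n]_(x in U) (g x * v x)%:E = 0) ->
  {ae mu n, forall x, U x -> g x = 0%R}.
Proof.
move=> oU ig gv; have mU := open_row_measurable oU.
have box a b : cbox a b `<=` U -> \int[mu n]_(x in obox a b) (g x)%:E = 0.
  move=> abU; have mB := measurable_obox a b.
  have BU : obox a b `<=` U by apply: subset_trans abU; exact: obox_cbox.
  rewrite -(setIidr BU) integral_mkcondr.
  have mbump k : measurable_fun U (bump a b k).
    apply: row_continuous_measurable => // x _; apply: differentiable_continuous.
    exact: (Ck_diff _ (bump_Ck a b k 0)).
  have igb k : (mu n).-integrable U (fun x => (g x * bump a b k x)%:E).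
    apply: (@integrable_mul_bounded_on _ _ _ _ 1%R) => //.
    move=> x _; have /andP[h0 h1] := bump_ge0_le1 a b k x.
    by rewrite ger0_norm.
  have mg := measurable_int _ ig.
  have cv : (\int[mu n]_(x in U) (g x * bump a b k x)%:E) @[k --> \oo] -->
       \int[mu n]_(x in U) ((EFin \o g) \_ (obox a b)) x.
    apply: (@dominated_cvg_integral _ _ R (mu n) U mU
      (fun k x => (g x * bump a b k x)%:E) _ (abse \o (EFin \o g))).
    - by move=> k; exact: measurable_int (igb k).
    - apply/(measurable_restrict _ mB mU).
      by apply: measurable_funS mg => //; exact: subIsetl.
    - apply: aeW => x Ux; rewrite patchE; case: ifPn => [|/negP] xB.
        rewrite /= -[X in _ --> X%:E]mulr1; apply: cvg_EFin; first exact: nearW.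
        by apply: cvgM; [exact: cvg_cst|apply: bump_cvg; rewrite inE in xB].
      apply: cvg_near_cst; apply: nearW => k; rewrite bump_out ?mulr0//.
      by move=> h; apply: xB; rewrite inE.
    - exact: integrable_abse.
    - apply: aeW => x k Ux; rewrite /= lee_fin normrM.
      have /andP[h0 h1] := bump_ge0_le1 a b k x.
      by rewrite (ger0_norm h0) ler_piMr.
  rewrite -(cvg_lim _ cv)//; apply/cvg_lim => //; apply: cvg_near_cst.
  by apply: nearW => k; apply: gv; exact: test_function_bump.
apply: ae_ratbox => // a b abU.
have mB := measurable_obox a b.
have BU : obox a b `<=` U by apply: subset_trans abU; exact: obox_cbox.
have := @integral_zero_of_oboxes n (obox a b) (EFin \o g) mB.
have -> : (mu n).-integrable (obox a b) (EFin \o g).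
  by apply: integrableS ig.
move=> /(_ isT (box _ _ abU)) H.
have {H} : {ae mu n, forall x, obox a b x -> (EFin \o g) x = 0}.
  apply: H => a' b'; rewrite oboxI; apply: box => x Hx; apply: abU => i.
  by have := Hx i; rewrite !mxE ge_max le_min => /andP[/andP[-> _] /andP[-> _]].
by apply: filterS => x H /H [].
Qed.

End fundamental.

(** * Integration by parts *)

Section byparts.
Context {R : realType}.
Local Notation mu := (@lebesgue_row R).

Lemma bounded_sub_obox n (A : set 'rV[R]_n) : bounded_set A ->
  exists2 M : R, 0 < M & A `<=` obox (const_mx (- M)) (const_mx M).
Proof.
move=> [M0 [_ HM]].
exists (`|M0| + 2); first by rewrite ltr_wpDl.
move=> x Ax i; rewrite !mxE -ltr_norml.
apply: (le_lt_trans (row_coord_le_norm x i)).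
apply: (@le_lt_trans _ _ (`|M0| + 1)); last by rewrite ltrD2l ltr1n.
by apply: (HM _ _ x Ax); rewrite (le_lt_trans (ler_norm _))// ltrDl.
Qed.

Lemma bounded_lebesgue_row_fin n (A : set 'rV[R]_n) : measurable A -> bounded_set A ->
  (mu n A < +oo)%E.
Proof.
move=> mA /bounded_sub_obox[M M0 AM].
apply: (@le_lt_trans _ _ (mu n (obox (const_mx (- M)) (const_mx M)))).
  by apply: le_measure => //; rewrite inE//; exact: measurable_obox.
rewrite lebesgue_row_obox ?ltry// => i; rewrite !mxE; lra.
Qed.

Lemma integrable_row_shift n (F : 'rV[R]_n -> \bar R) (b : 'rV[R]_n) :
  (mu n).-integrable setT F -> (mu n).-integrable setT (fun x => F (x + b)).
Proof.
move=> /integrableP[mF iF]; apply/integrableP; split.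
  apply: (measurableT_comp mF); have := measurable_row_affine 1 b.
  by under eq_fun do rewrite scale1r.
have maF : measurable_fun setT (fun x => `|F x|%E) by exact: measurableT_comp.
by rewrite (integral_lebesgue_row_shift b maF).
Qed.

Lemma integrable_indic_fin n (B : set 'rV[R]_n) : measurable B -> (mu n B < +oo)%E ->
  (mu n).-integrable setT (fun x => (\1_B x)%:E).
Proof.
move=> mB Bfin; apply/integrableP; split.
  by apply/measurable_EFinP; exact: measurable_indic.
rewrite (eq_integral (fun x => (\1_B x)%:E)); last first.
  by move=> x _ /=; rewrite ger0_norm.
by rewrite integral_indic// setIT.
Qed.

Lemma bounded_support_integrable n (B : set 'rV[R]_n) (f : 'rV[R]_n -> R) (M : R) :
  measurable B -> bounded_set B -> measurable_fun setT f ->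
  (forall x, `|f x| <= M) -> (forall x, ~ B x -> f x = 0) ->
  (mu n).-integrable setT (EFin \o f).
Proof.
move=> mB bB mf fM f0.
apply: (@le_integrable _ _ _ _ _ _ _ (fun x => (M * \1_B x)%:E)) => //.
- exact/measurable_EFinP.
- move=> x _ /=; rewrite lee_fin indicE; case: (boolP (x \in B)) => xB.
    by rewrite mulr1; apply: le_trans (fM x) _; exact: ler_norm.
  by rewrite f0 ?normr0// => h; move: xB; rewrite mem_set.
- under eq_fun do rewrite EFinM.
  apply: integrableZl => //.
  apply: integrable_indic_fin => //.
  exact: bounded_lebesgue_row_fin.
Qed.

Lemma compact_support_bounded n (f : 'rV[R]_n -> R) : continuous f ->
  compact (closure [set x | f x != 0]) -> exists M, forall x, `|f x| <= M.
Proof.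
move=> cf cpt.
have : compact (f @` closure [set x | f x != 0]).
  by apply: continuous_compact => //; exact: continuous_subspaceT.
move=> /compact_bounded[M0 [_ HM]]; exists (`|M0| + 1) => x.
have [->|fx] := eqVneq (f x) 0; first by rewrite normr0 addr_ge0.
apply: (HM (`|M0| + 1)); first by rewrite (le_lt_trans (ler_norm _))// ltrDl.
by exists x => //; exact: subset_closure.
Qed.

Lemma compact_support_integrable n (f : 'rV[R]_n -> R) : continuous f ->
  compact (closure [set x | f x != 0]) -> (mu n).-integrable setT (EFin \o f).
Proof.
move=> cf cpt; have [M HM] := compact_support_bounded cf cpt.
apply: (@bounded_support_integrable _ (closure [set x | f x != 0]) _ M) => //.
- rewrite -[X in measurable X]setCK; apply: measurableC; apply: open_row_measurable.
  exact/closed_openC/closed_closure.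
- exact: compact_bounded.
- exact: continuous_row_measurable.
- move=> x nx; apply/eqP/negPn/negP => h; apply: nx; exact: subset_closure.
Qed.

(** By translation invariance the difference quotients of w have integral 0.
    They are bounded by the supremum of the derivative and supported in a common
    box, so dominated convergence applies. *)
Lemma integral_partial_eq0 n (w : 'rV[R]_n -> R) i : continuous w ->
  (forall x, derivable w x (delta_mx ord0 i)) -> continuous (partial i w) ->
  compact (closure [set x | w x != 0]) ->
  (\int[mu n]_x (partial i w x)%:E = 0)%E.
Proof.
move=> cw dw cdw cpt; set e := (delta_mx ord0 i : 'rV[R]_n).
have cpt' : compact (closure [set x | partial i w x != 0]).
  apply: (subclosed_compact _ cpt); first exact: closed_closure.
  rewrite [X in _ `<=` X](closure_id _).1; last exact: closed_closure.
  by apply: closure_subset; exact: partial_support.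
have [M HM] := compact_support_bounded cdw cpt'.
have [N N0 HN] := bounded_sub_obox (compact_bounded cpt).
pose B := obox (const_mx (- (N + 1)) : 'rV[R]_n) (const_mx (N + 1)).
have w0 x : ~ obox (const_mx (- N)) (const_mx N) x -> w x = 0.
  move=> nx; apply/eqP/negPn/negP => h; apply: nx; apply: HN; exact: subset_closure.
pose t (k : nat) : R := k.+1%:R^-1.
have t0 k : 0 < t k by rewrite invr_gt0.
have t1 k : t k <= 1 by rewrite invf_le1// ler1n.
(* difference quotients with step 1 / (k + 1) *)
pose u k x := (t k)^-1 * (w (x + t k *: e) - w x).
have cu k : continuous (u k).
  move=> x.
  have c1 : {for x, continuous (fun x : 'rV[R]_n => w (x + t k *: e))}.
    apply: (@continuous_comp _ _ _ (fun x : 'rV[R]_n => x + t k *: e) w); last exact: cw.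
    by apply: differentiable_continuous; exact: differentiableD.
  exact: (cvgM (cvg_cst (t k)^-1) (cvgB c1 (cw x))).
have mu_ k : measurable_fun setT (u k).
  exact: continuous_row_measurable.
have uM k x : `|u k x| <= M.
  have H (s : R) : is_derive s (1 : R) (fun s : R => w (x + s *: e)) (partial i w (x + s *: e)).
    by apply: line_is_derive; exact: dw.
  have cH : continuous (fun s : R => w (x + s *: e)).
    by move=> s; apply: differentiable_continuous; apply/derivable1_diffP; case: (H s).
  have [c _] := MVT (t0 k) (fun s _ => H s) (continuous_within cH).
  rewrite scale0r addr0 subr0 /u => ->.
  by rewrite mulrC mulfK ?gt_eqF.
have u0 k x : ~ B x -> u k x = 0.
  move=> nB; rewrite /u !w0 ?subrr ?mulr0// => H; apply: nB => j; have := H j; rewrite !mxE.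
    by move=> /andP[? ?]; apply/andP; split; lra.
  have e1 : 0 <= t k * ((ord0 == ord0 :> 'I_1) && (j == i))%:R <= 1.
    by case: ((ord0 == ord0 :> 'I_1) && (j == i)) => /=; rewrite ?mulr1 ?mulr0 ?t1 ?(ltW (t0 k)) ?ler01 ?lexx.
  by move: e1 => /andP[? ?] /andP[? ?]; apply/andP; split; lra.
have mB := measurable_obox (const_mx (- (N + 1)) : 'rV[R]_n) (const_mx (N + 1)).
have iw : (mu n).-integrable setT (EFin \o w) by exact: compact_support_integrable.
have mw : measurable_fun setT (EFin \o w) by exact: measurable_int iw.
(* w and its translate have the same integral *)
have iu k : (\int[mu n]_x (u k x)%:E = 0)%E.
  have sh := integral_lebesgue_row_shift (t k *: e) mw.
  have iws := integrable_row_shift (t k *: e) iw.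
  under eq_integral do rewrite /u EFinM EFinB.
  rewrite integralZl//; last exact: integrableB.
  rewrite integralB//= sh subee ?mule0//.
  exact: integrable_fin_num.
have cv : ((\int[mu n]_x (u k x)%:E) @[k --> \oo] --> \int[mu n]_x (partial i w x)%:E)%E.
  apply: (@dominated_cvg_integral _ _ R (mu n) setT measurableT
    (fun k x => (u k x)%:E) (EFin \o partial i w) (fun x => (M * \1_B x)%:E)).
  - by move=> k; exact/measurable_EFinP.
  - apply/measurable_EFinP; exact: continuous_row_measurable.
  - apply: aeW => x _; apply: cvg_EFin; first exact: nearW.
    have h := dw x; rewrite /derivable in h.
    have tc : t k @[k --> \oo] --> 0^'.
      move=> A hA.
      have H : \forall k \near \oo, t k != 0 -> A (t k) := @cvg_harmonic R _ hA.
      have : \forall k \near \oo, A (t k) by apply: filterS H => k; apply; exact: lt0r_neq0 (t0 k).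
      by [].
    have := cvg_comp _ _ tc h.
    apply: cvg_trans; apply: near_eq_cvg; apply: nearW => k /=.
    by rewrite /u /GRing.scale/= [t k *: _ + x]addrC.
  - under eq_fun do rewrite EFinM.
    apply: integrableZl => //; apply: integrable_indic_fin => //.
    rewrite lebesgue_row_obox ?ltry// => j; rewrite !mxE; lra.
  - apply: aeW => x k _ /=; rewrite lee_fin indicE; case: (boolP (x \in B)) => xB.
      by rewrite mulr1 uM.
    by rewrite u0 ?normr0 ?mulr0// => h; move: xB; rewrite mem_set.
rewrite -(cvg_lim _ cv)//; apply/cvg_lim => //; apply: cvg_near_cst.
by apply: nearW => k; exact: iu.
Qed.

(** A test function on K vanishes near each point outside K. Its product with a
    function that is regular on K only therefore extends by 0 to a function that
    is regular everywhere. *)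
Lemma ext0_near n (K : set 'rV[R]_n) (v : 'rV[R]_n -> R) x :
  closure [set x | v x != 0] `<=` K -> ~ K x -> \forall y \near x, v y = 0.
Proof.
move=> vK nK.
have oC : open (~` closure [set x | v x != 0]) by exact/closed_openC/closed_closure.
have := open_nbhs_nbhs (conj oC (fun h => nK (vK x h))); apply: filterS => y Hy.
by apply/eqP/negPn/negP => vy; apply: Hy; exact: subset_closure.
Qed.

Lemma ext0_continuous n (K : set 'rV[R]_n) (g v : 'rV[R]_n -> R) : open K ->
  (forall x, K x -> {for x, continuous g}) -> continuous v ->
  closure [set x | v x != 0] `<=` K -> continuous ((g \* v) \_ K).
Proof.
move=> oK cg cv vK x; have [Kx|nKx] := pselect (K x).
  have near_eq : \forall y \near x, (g \* v) y = ((g \* v) \_ K) y.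
    have := open_nbhs_nbhs (conj oK Kx); apply: filterS => y Ky.
    by rewrite patchE mem_set.
  rewrite /continuous_at patchE mem_set//.
  apply: cvg_trans (near_eq_cvg near_eq) _.
  by apply: continuousM; [exact: cg|exact: cv].
have near_eq : \forall y \near x, (0 : R) = ((g \* v) \_ K) y.
  have := ext0_near vK nKx; apply: filterS => y vy.
  by rewrite patchE; case: ifP => //= _; rewrite vy mulr0.
rewrite /continuous_at patchE memNset//.
apply: cvg_trans (near_eq_cvg near_eq) _; exact: cvg_cst.
Qed.

Lemma ext0_support n (K : set 'rV[R]_n) (g v : 'rV[R]_n -> R) :
  compact (closure [set x | v x != 0]) ->
  compact (closure [set x | ((g \* v) \_ K) x != 0]).
Proof.
move=> cpt; apply: (subclosed_compact _ cpt); first exact: closed_closure.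
apply: closure_subset => x /=; apply: contra_neq => vx; rewrite patchE.
by case: ifP => //= _; rewrite vx mulr0.
Qed.

Lemma ext0_integrable n (K : set 'rV[R]_n) (g v : 'rV[R]_n -> R) : open K ->
  (forall x, K x -> {for x, continuous g}) -> continuous v ->
  compact (closure [set x | v x != 0]) ->
  closure [set x | v x != 0] `<=` K ->
  (mu n).-integrable K (fun x => (g x * v x)%:E).
Proof.
move=> oK cg cv cpt vK.
have : (mu n).-integrable setT (EFin \o ((g \* v) \_ K)).
  by apply: compact_support_integrable; [exact: ext0_continuous|exact: ext0_support].
rewrite (_ : EFin \o _ = (fun x => (g x * v x)%:E) \_ K).
  by move=> H; apply/(integrable_mkcond _ (open_row_measurable oK)).
by apply/funext => x /=; rewrite !patchE; case: ifP.
Qed.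

Lemma test_function_continuous n (K : set 'rV[R]_n) v : test_function K v -> continuous v.
Proof. by move=> [H _ _] x; apply: differentiable_continuous; exact: (H [::]). Qed.

(** The product g v, extended by 0, satisfies the hypotheses of
    [integral_partial_eq0]. *)
Lemma ibp_partial n (K : set 'rV[R]_n) (g : 'rV[R]_n -> R) i v : open K ->
  (forall x, K x -> differentiable g x) ->
  (forall x, K x -> {for x, continuous (partial i g)}) ->
  test_function K v ->
  (\int[mu n]_(x in K) (g x * partial i v x)%:E =
   - \int[mu n]_(x in K) (partial i g x * v x)%:E)%E.
Proof.
move=> oK dg cdg tv.
have tdv := test_function_partial i tv.
have [H1 H2 H3] := tv.
have cg x : K x -> {for x, continuous g} by move=> /dg; exact: differentiable_continuous.
pose w := (g \* v) \_ K.
have dv x e : derivable v x e by apply: diff_derivable; exact: (H1 [::]).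
have dwP x : derivable w x (delta_mx ord0 i) /\
    partial i w x = ((g \* partial i v) \_ K) x + ((partial i g \* v) \_ K) x.
  have [Kx|nKx] := pselect (K x).
    have near_eq : \forall y \near x, (g * v : 'rV[R]_n -> R) y = w y.
      have := open_nbhs_nbhs (conj oK Kx); apply: filterS => y Ky.
      by rewrite /w patchE mem_set.
    have dgx := @diff_derivable _ _ _ g x (delta_mx ord0 i) (dg x Kx).
    split.
      apply: (near_eq_derivable near_eq).
      exact: (derivableM dgx (dv x _)).
    have dE := near_eq_derive (delta_mx ord0 i) near_eq.
    rewrite /partial -dE.
    rewrite (deriveM dgx (dv x _)).
    by rewrite !patchE mem_set//= /GRing.scale/= [v x * _]mulrC.
  have near_eq : \forall y \near x, (fun=> 0 : R) y = w y.
    have := ext0_near H3 nKx; apply: filterS => y vy.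
    by rewrite /w patchE; case: ifP => //= _; rewrite vy mulr0.
  split.
    by apply: (near_eq_derivable near_eq).
  by rewrite /partial -(near_eq_derive _ near_eq) derive_cst !patchE memNset// addr0.
have dwE : partial i w = ((g \* partial i v) \_ K) \+ ((partial i g \* v) \_ K).
  by apply/funext => x; case: (dwP x).
have cv := test_function_continuous tv.
have cdv := test_function_continuous tdv.
have [_ T2 T3] := tdv.
have := @integral_partial_eq0 n w i (ext0_continuous oK cg cv H3) (fun x => (dwP x).1).
move=> /(_ _ (@ext0_support n K g v H2)); rewrite dwE => H.
have mK := open_row_measurable oK.
have i1 := ext0_integrable oK cg cdv T2 T3.
have i2 := ext0_integrable oK cdg cv H2 H3.
have : (\int[mu n]_(x in K) ((g x * partial i v x)%:E + (partial i g x * v x)%:E) = 0)%E.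
  rewrite integral_mkcond -[RHS]H.
    by apply: eq_integral => x _; rewrite /= !patchE; case: ifP => //; rewrite addr0.
  by move=> x; apply: continuousD; exact: ext0_continuous.
rewrite integralD//.
have := integrable_fin_num mK i1; have := integrable_fin_num mK i2.
move: (integral _ _ _) (integral _ _ _) => [a| |] // [b| |] // _ _ [] /eqP.
by rewrite addr_eq0 => /eqP ->.
Qed.

End byparts.

(** * The fundamental theorem of calculus along parallel segments *)

Section line.
Context {R : realType}.
Local Notation mu := (@lebesgue_row R).
Local Notation lambda := (@lebesgue_measure R).

Lemma measurable_line n (e : 'rV[R]_n) :
  measurable_fun setT (fun p : measurableTypeR R * 'rV[R]_n => p.2 + p.1 *: e).
Proof.
apply: measurable_fun_rowP => i; under eq_fun do rewrite !mxE.
apply: measurable_funD.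
  exact: (measurableT_comp (measurable_row_coord i) measurable_snd).
apply: measurable_funM => //; exact: measurable_fst.
Qed.

(** By translation invariance each slice at fixed time has L^1 norm at most M
    times that of G, so the double integral is finite. Two directions e1 and e2
    are allowed in order to cover both G (x + s e) v(x) and f(x) (D_e v)(x - s
    e). *)
Lemma integrable_line n (G w : 'rV[R]_n -> R) (D : set R) (e1 e2 : 'rV[R]_n) (M : R) :
  (mu n).-integrable setT (EFin \o G) -> measurable_fun setT w ->
  (forall x, `|w x| <= M) -> measurable D -> (lambda D < +oo)%E ->
  (lambda \x mu n)%E.-integrable setT
    (fun p : measurableTypeR R * 'rV[R]_n =>
      (\1_D p.1 * (G (p.2 + p.1 *: e1) * w (p.2 + p.1 *: e2)))%:E).
Proof.
move=> iG mw wM mD D_fin.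
have M0 : 0 <= M by apply: le_trans (wM 0).
have mG : measurable_fun setT G by apply/measurable_EFinP; exact: measurable_int iG.
have m1 : measurable_fun setT (fun p : measurableTypeR R * 'rV[R]_n => \1_D p.1 : R).
  by apply: measurableT_comp; [exact: measurable_indic|exact: measurable_fst].
have mF : measurable_fun setT (fun p : measurableTypeR R * 'rV[R]_n =>
    (\1_D p.1 * (G (p.2 + p.1 *: e1) * w (p.2 + p.1 *: e2)))%:E).
  apply/measurable_EFinP; apply: measurable_funM => //; apply: measurable_funM.
    exact: (measurableT_comp mG (measurable_line e1)).
  exact: (measurableT_comp mw (measurable_line e2)).
apply/integrable12ltyP => //.
have [/= iGf _] : (\int[mu n]_x `|(G x)%:E| < +oo)%E /\ True by case/integrableP: iG.
apply: (@le_lt_trans _ _ (\int[lambda]_s ((\1_D s)%:E * (M%:E * \int[mu n]_x `|(G x)%:E|)))%E).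
  apply: ge0_le_integral => //.
  - by move=> s _; exact: integral_ge0.
  - have mFa : measurable_fun setT (fun p : measurableTypeR R * 'rV[R]_n =>
        `|(\1_D p.1 * (G (p.2 + p.1 *: e1) * w (p.2 + p.1 *: e2)))%:E|%E).
      exact: measurableT_comp.
    exact: (@measurable_fun_fubini_tonelli_F _ _ _ _ R (mu n) _ mFa (fun p => abse_ge0 _)).
  - apply: emeasurable_funM => //; apply/measurable_EFinP; exact: measurable_indic.
  move=> s _.
  have -> : (\int[mu n]_x `|(G x)%:E| = \int[mu n]_x `|(G (x + s *: e1)%R)%:E|)%E.
    have mG' : measurable_fun setT (fun x => `|(G x)%:E|%E).
      by apply: measurableT_comp => //; exact/measurable_EFinP.
    by rewrite (integral_lebesgue_row_shift (s *: e1) mG').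
  have mGs : measurable_fun setT (fun x : 'rV[R]_n => `|(G (x + s *: e1)%R)%:E|%E).
    apply: measurableT_comp => //; apply/measurable_EFinP.
    have := measurableT_comp mG (measurable_row_affine 1 (s *: e1)).
    by under eq_fun do rewrite /= scale1r.
  rewrite -ge0_integralZl//.
  have mM : measurable_fun setT (fun x : 'rV[R]_n => M%:E * `|(G (x + s *: e1)%R)%:E|)%E.
    exact: emeasurable_funM.
  have p0 (x : 'rV[R]_n) : setT x -> (0 <= M%:E * `|(G (x + s *: e1)%R)%:E|)%E.
    by rewrite mule_ge0.
  rewrite -ge0_integralZl//.
  apply: ge0_le_integral => //.
  - have mFs : measurable_fun setT (fun x : 'rV[R]_n =>
        (\1_D s * (G (x + s *: e1) * w (x + s *: e2)))%:E).
      exact: (measurableT_comp mF (pair1_measurable s)).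
    exact: (measurableT_comp (@abse_measurable R setT) mFs).
  - by apply: emeasurable_funM => //; exact: emeasurable_funM.
  move=> x _ /=; rewrite -!EFinM lee_fin normrM ger0_norm// ler_wpM2l//.
  by rewrite normrM mulrC ler_wpM2r.
under eq_integral do rewrite muleC.
rewrite ge0_integralZl//; last first.
- by rewrite mule_ge0//; exact: integral_ge0.
- by apply/measurable_EFinP; exact: measurable_indic.
rewrite integral_indic// setIT.
have -> : (M%:E * \int[mu n]_x `|(G x)%:E| = (M * fine (\int[mu n]_x `|(G x)%:E|))%:E)%E.
  by rewrite EFinM fineK// ge0_fin_numE//; exact: integral_ge0.
by rewrite lte_mul_pinfty// lee_fin mulr_ge0// fine_ge0//; exact: integral_ge0.
Qed.

Lemma FTC_line n (v : 'rV[R]_n -> R) (y e : 'rV[R]_n) (t : R) : Ck 1 v -> 0 <= t ->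
  (\int[lambda]_s (\1_(`[0, t]%classic) s * \sum_i e ord0 i * partial i v (y - s *: e))%:E =
   (v y - v (y - t *: e))%:E)%E.
Proof.
move=> v1; rewrite le_eqVlt => /orP[/eqP <-|t0].
  rewrite scale0r subr0 subrr set_itv1.
  have -> : (\int[lambda]_s (\1_[set 0] s * \sum_i e ord0 i * partial i v (y - s *: e))%:E =
    \int[lambda]_(s in [set 0%R]) (\sum_i e ord0 i * partial i v (y - s *: e))%:E)%E.
    rewrite [RHS]integral_mkcond; apply: eq_integral => s _.
    by rewrite patchE indicE; case: ifP => _; rewrite ?mul1r ?mul0r.
  by rewrite integral_set1.
pose F s := - v (y - s *: e).
pose f s := \sum_i e ord0 i * partial i v (y - s *: e).
have dF (s : R) : is_derive s (1 : R) F (f s).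
  have d1 := line_is_derive (@diff_derivable _ _ _ v (y + s *: - e) (- e) (Ck_diff (y + s *: - e) v1)).
  have d2 := is_deriveN d1.
  have -> : f s = - ('D_(- e) v (y + s *: - e)).
    rewrite derive_rowE; last exact: Ck_diff v1.
    rewrite -sumrN; apply: eq_bigr => i _.
    by rewrite mxE mulNr opprK scalerN.
  by rewrite (_ : F = (fun t => - v (y + t *: - e)))//; apply/funext => u; rewrite scalerN.
have cf : continuous f.
  rewrite /f; elim: (index_enum 'I_n) => [|i l IH].
    by under eq_fun do rewrite big_nil; exact: cst_continuous.
  under eq_fun do rewrite big_cons; move=> s; apply: cvgD; last exact: IH.
  have c1 : {for s, continuous (fun s : R => partial i v (y - s *: e))}.
    apply: (@continuous_comp _ _ _ (fun s : R => y - s *: e) (partial i v)).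
      by apply: cvgB; [exact: cvg_cst|exact: scalel_continuous].
    exact/differentiable_continuous/(Ck_diff _ (Ck_partial _ v1)).
  exact: (cvgM (cvg_cst _) c1).
have cF : continuous F.
  by move=> s; apply: differentiable_continuous; apply/derivable1_diffP; case: (dF s).
have := @continuous_FTC2 R f F 0 t t0 (continuous_subspaceT cf).
have H1 : derivable_oo_LRcontinuous F 0 t.
  split; first by move=> s _; case: (dF s).
    by apply: cvg_at_right_filter; exact: cF.
  by apply: cvg_at_left_filter; exact: cF.
move=> /(_ H1) H2.
rewrite (_ : (v y - v (y - t *: e))%:E = ((F t)%:E - (F 0)%:E)%E); last first.
  by rewrite -EFinB /F scale0r subr0 opprK addrC.
rewrite -H2.
  rewrite [RHS]integral_mkcond; apply: eq_integral => s _.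
  by rewrite patchE indicE; case: ifP => _; rewrite ?mul1r ?mul0r.
by move=> s _; rewrite derive1E; case: (dF s).
Qed.

Definition dirder n (e : 'rV[R]_n) (v : 'rV[R]_n -> R) : 'rV[R]_n -> R :=
  fun x => \sum_i e ord0 i * partial i v x.

Lemma continuous_row_sum n m (F : 'I_m -> 'rV[R]_n -> R) (c : 'I_m -> R) :
  (forall i, continuous (F i)) -> continuous (fun x => \sum_i c i * F i x).
Proof.
move=> cF; elim: (index_enum 'I_m) => [|i l IH].
  by under eq_fun do rewrite big_nil; exact: cst_continuous.
under eq_fun do rewrite big_cons; move=> s.
have c2 : {for s, continuous ((fun=> c i) \* F i)}.
  by apply: continuousM; [exact: cst_continuous|exact: cF].
exact: (continuousD c2 (IH s)).
Qed.

Lemma integrable_mul_bounded n (f w : 'rV[R]_n -> R) (M : R) :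
  (mu n).-integrable setT (EFin \o f) -> measurable_fun setT w ->
  (forall x, `|w x| <= M) -> (mu n).-integrable setT (fun x => (f x * w x)%:E).
Proof.
move=> fi mw wM; by apply: (@integrable_mul_bounded_on _ _ _ _ _ M).
Qed.

Section line_identity.
Variables (n : nat) (K W : set 'rV[R]_n) (f : 'rV[R]_n -> R) (g : 'I_n -> 'rV[R]_n -> R).
Variables (e : 'rV[R]_n) (t : R).
Hypothesis fi : (mu n).-integrable setT (EFin \o f).
Hypothesis gi : forall i, (mu n).-integrable setT (EFin \o g i).
Hypothesis fg : forall i v, test_function K v ->
  (\int[mu n]_x (f x * partial i v x)%:E = - \int[mu n]_x (g i x * v x)%:E)%E.
Hypothesis oW : open W.
Hypothesis WK : forall x (s : R), W x -> 0 <= s <= 1 -> K (x + s *: e).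
Hypothesis t01 : 0 <= t <= 1.

Let G x := \sum_i e ord0 i * g i x.
Let D : set R := `[0, t]%classic.
Let Q x := (\int[lambda]_s (\1_D s * G (x + s *: e))%:E)%E.

Let iG : (mu n).-integrable setT (EFin \o G).
Proof.
rewrite (_ : EFin \o G = fun x => (\sum_i (e ord0 i * g i x)%:E)%E); last first.
  by apply/funext => x; rewrite /= -sumEFin.
apply: integrable_sum => // i _.
have := integrableZl measurableT (e ord0 i) (gi i).
by under eq_fun do rewrite -EFinM.
Qed.

Let mD : measurable D. Proof. exact: measurable_itv. Qed.

Let D_fin : (lambda D < +oo)%E.
Proof. by rewrite /D lebesgue_measure_itv/=; case: ifP => _; rewrite ?ltry. Qed.

Lemma integrable_line_Q :
  (lambda \x mu n)%E.-integrable setT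
    (fun p : measurableTypeR R * 'rV[R]_n => (\1_D p.1 * G (p.2 + p.1 *: e))%:E).
Proof.
have := @integrable_line n G (fun=> 1) D e e 1 iG (measurable_cst _) _ mD D_fin.
under eq_fun do rewrite mulr1; apply => x; rewrite normr1//.
Qed.

(** After a translation by s e the test function becomes x |-> v (x - s e),
    which is supported in K, so the weak derivatives g can be traded for
    derivatives of v. *)
Lemma line_step v (s : R) : test_function W v -> 0 <= s <= 1 ->
  (\int[mu n]_x (G (x + s *: e) * v x)%:E =
   - \int[mu n]_x (f x * dirder e v (x - s *: e))%:E)%E.
Proof.
move=> tv s01.
have tvs : test_function K (fun x => v (x - s *: e)).
  by apply: test_function_shift tv _ => x Wx; rewrite opprK; exact: WK.
have cv := test_function_continuous tvs.
have [T1 T2 T3] := tvs.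
have [M HM] := compact_support_bounded cv T2.
have mv : measurable_fun setT (fun x : 'rV[R]_n => v (x - s *: e)).
  exact: continuous_row_measurable.
have igv i : (mu n).-integrable setT (fun x => (g i x * v (x - s *: e))%:E).
  exact: integrable_mul_bounded HM.
have ifv i : (mu n).-integrable setT (fun x => (f x * partial i (fun x => v (x - s *: e)) x)%:E).
  have tp := test_function_partial i tvs.
  have [_ P2 _] := tp; have cp := test_function_continuous tp.
  have [M' HM'] := compact_support_bounded cp P2.
  apply: integrable_mul_bounded HM' => //.
  exact: continuous_row_measurable.
transitivity (\int[mu n]_x (G x * v (x - s *: e))%:E)%E.
  have mGv : measurable_fun setT (fun x => (G x * v (x - s *: e))%:E).
    by apply/measurable_EFinP; apply: measurable_funM => //; apply/measurable_EFinP; exact: measurable_int iG.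
  rewrite -(integral_lebesgue_row_shift (s *: e) mGv).
  by apply: eq_integral => x _; rewrite addrK.
transitivity (\sum_i (e ord0 i)%:E * \int[mu n]_x (g i x * v (x - s *: e))%:E)%E.
  under eq_integral.
    move=> x _; rewrite /G mulr_suml -sumEFin.
    under eq_bigr do rewrite -mulrA EFinM.
    over.
  rewrite integral_sum//=; last by move=> i; exact: integrableZl.
  by apply: eq_bigr => i _; rewrite integralZl.
transitivity (\sum_i - ((e ord0 i)%:E * \int[mu n]_x (f x * partial i (fun x => v (x - s *: e)) x)%:E))%E.
  by apply: eq_bigr => i _; rewrite fg// muleN oppeK.
rewrite fin_num_sumeN; last first.
  by move=> i _; rewrite fin_numM// integrable_fin_num.
congr (- _)%E.
transitivity (\int[mu n]_x \sum_i ((e ord0 i)%:E * (f x * partial i (fun x => v (x - s *: e)) x)%:E))%E.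
  rewrite integral_sum//=; last by move=> i; exact: integrableZl.
  by apply: eq_bigr => i _; rewrite integralZl.
apply: eq_integral => x _; rewrite /dirder mulr_sumr -sumEFin.
apply: eq_bigr => i _; rewrite -EFinM mulrCA.
have := congr1 (fun F => F x) (partials_shift v (- (s *: e)) [:: i]).
by rewrite /partials /= => ->.
Qed.

(** Integrate [line_step] over s in [0, t]. By Fubini's theorem and [FTC_line]
    the right-hand side becomes the integral of f(x) (v(x - t e) - v(x)), and a
    translation moves the shift from v to f. *)
Lemma line_tested v : test_function W v ->
  (\int[mu n]_x (Q x * (v x)%:E) = \int[mu n]_x ((f (x + t *: e) - f x) * v x)%:E)%E.
Proof.
move=> tv; have cv := test_function_continuous tv; have [T1 T2 T3] := tv.
have [M HM] := compact_support_bounded cv T2.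
have mv : measurable_fun setT v.
  exact: continuous_row_measurable.
have vC k : Ck k v by move/CkP: T1.
have cdv : continuous (dirder e v).
  apply: continuous_row_sum => i; exact: test_function_continuous (test_function_partial i tv).
have [M' HM'] : exists M', forall x, `|dirder e v x| <= M'.
  have Hi i : exists M, forall x, `|partial i v x| <= M.
    have tp := test_function_partial i tv; have [_ P2 _] := tp.
    exact: compact_support_bounded (test_function_continuous tp) P2.
  have [Mi HMi] := choice Hi.
  exists (\sum_i `|e ord0 i| * Mi i) => x.
  apply: (le_trans (ler_norm_sum _ _ _)); apply: ler_sum => i _.
  by rewrite normrM ler_wpM2l.
have mdv : measurable_fun setT (dirder e v).
  exact: continuous_row_measurable.
have I1 := @integrable_line n G v D e 0 M iG mv HM mD D_fin.
have I2 := @integrable_line n f (dirder e v) D 0 (- e) M' fi mdv HM' mD D_fin.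
have F1 := Fubini I1; have F2 := Fubini I2.
have mQ : measurable_fun setT Q by exact: measurable_fubini_G integrable_line_Q.
have E1 : (\int[mu n]_x (Q x * (v x)%:E) =
    \int[mu n]_x \int[lambda]_s (\1_D s * (G (x + s *: e) * v (x + s *: 0)))%:E)%E.
  apply: ae_eq_integral => //.
  - by apply: emeasurable_funM => //; exact/measurable_EFinP.
  - exact: measurable_fubini_G I1.
  have := ae_integrable2 integrable_line_Q; apply: filterS => x /= iQ _.
  rewrite muleC /Q -integralZl//; apply: eq_integral => s _.
  by rewrite scaler0 addr0 -EFinM; congr (_%:E); ring.
rewrite E1 -F1 /=.
have E2 : (\int[lambda]_s \int[mu n]_x (\1_D s * (G (x + s *: e) * v (x + s *: 0)))%:E =
   - \int[lambda]_s \int[mu n]_x (\1_D s * (f (x + s *: 0) * dirder e v (x + s *: - e)))%:E)%E.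
  have iF2 := integrable_fubini_F I2.
  rewrite -muleN1 -integralZr//; apply: eq_integral => s _ /=.
  rewrite indicE; case: (boolP (s \in D)) => [|_].
    rewrite inE /D/= in_itv/= => /andP[s0 st].
    have s01 : 0 <= s <= 1 by rewrite s0/=; case/andP: t01 => _; exact: le_trans.
    rewrite muleN1; under eq_integral do rewrite mul1r scaler0 addr0.
    by rewrite line_step//; congr (- _)%E; apply: eq_integral => x _; rewrite mul1r scaler0 addr0 scalerN.
  by rewrite !integral0_eq ?mul0e// => x _; rewrite mul0r.
rewrite E2 F2 /=.
have t0 : 0 <= t by case/andP: t01.
have E3 x : (\int[lambda]_s (\1_D s * (f (x + s *: 0) * dirder e v (x + s *: - e)))%:E =
    (f x * (v x - v (x - t *: e)))%:E)%E.
  have cv1 : Ck 1 (fun y => f x * v y) := CkM (@Ck_cst _ n 1 (f x)) (vC 1%N).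
  rewrite mulrBr -(FTC_line x e cv1 t0); apply: eq_integral => s _.
  congr (_ * _)%:E; rewrite scaler0 addr0 scalerN mulr_sumr; apply: eq_bigr => i _.
  rewrite mulrCA; congr (_ * _).
  rewrite /partial; symmetry; apply: (@deriveMl _ _ v (f x)).
  apply: diff_derivable; exact: (Ck_diff _ (vC 0%N)).
under eq_integral do rewrite E3.
have mvt : measurable_fun setT (fun x : 'rV[R]_n => v (x - t *: e)).
  have := measurableT_comp mv (measurable_row_affine 1 (- (t *: e))).
  by under eq_fun do rewrite /= scale1r.
have ia := integrable_mul_bounded fi mv HM.
have ib := integrable_mul_bounded fi mvt (fun x => HM (x - t *: e)).
have ic : (mu n).-integrable setT (fun x => (f (x + t *: e) * v x)%:E).
  have := integrable_row_shift (t *: e) ib.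
  by under eq_fun do rewrite addrK.
have bc : (\int[mu n]_x (f x * v (x - t *: e))%:E = \int[mu n]_x (f (x + t *: e) * v x)%:E)%E.
  rewrite -(integral_lebesgue_row_shift (t *: e) (measurable_int _ ib)).
  by apply: eq_integral => x _; rewrite addrK.
under eq_integral do rewrite mulrBr EFinB.
rewrite integralB//= bc.
under [RHS]eq_integral do rewrite mulrBl EFinB.
rewrite integralB//= fin_num_oppeB ?integrable_fin_num// addeC//.
Qed.

(** Q is integrable, hence finite almost everywhere. By [line_tested] the
    difference of both sides integrates to 0 against all test functions on W, so
    it vanishes by [fundamental_lemma]. *)
Lemma line_identity :
  {ae mu n, forall x, W x ->
     lambda.-integrable setT (fun s => (\1_D s * G (x + s *: e))%:E) /\
     ((f (x + t *: e) - f x)%:E = \int[lambda]_s (\1_D s * G (x + s *: e))%:E)%E}.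
Proof.
have mF := measurable_int _ integrable_line_Q.
have mQ : measurable_fun setT Q by exact: measurable_fubini_G integrable_line_Q.
have iQ : (mu n).-integrable setT Q.
  apply/integrableP; split => //.
  have lt := (@integrable21ltyP _ _ _ _ R lambda (mu n) _ mF).1 integrable_line_Q.
  apply: (le_lt_trans _ lt).
  apply: ge0_le_integral => //.
  - exact: measurableT_comp.
  - have mFa : measurable_fun setT (fun p : measurableTypeR R * 'rV[R]_n =>
        `|(\1_D p.1 * G (p.2 + p.1 *: e))%:E|%E).
      exact: (measurableT_comp (@abse_measurable R setT) mF).
    exact: (@measurable_fun_fubini_tonelli_G _ _ _ _ R lambda _ mFa (fun p => abse_ge0 _)).
  move=> x _; apply: le_abse_integral => //.
  exact: (measurableT_comp mF (pair2_measurable x)).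
pose H x := f (x + t *: e) - f x - fine (Q x).
have Qfin : {ae mu n, forall x, Q x \is a fin_num}.
  by have := integrable_ae measurableT iQ; apply: filterS => x; apply.
have iQ' : (mu n).-integrable setT (EFin \o (fun x => fine (Q x))).
  apply: le_integrable iQ => //.
    by apply/measurable_EFinP; apply: measurableT_comp.
  by move=> x _ /=; case: (Q x) => [r| |] //=; rewrite normr0 leey.
have ift : (mu n).-integrable setT (fun x => (f (x + t *: e))%:E) := integrable_row_shift (t *: e) fi.
have iH : (mu n).-integrable setT (EFin \o H).
  rewrite (_ : EFin \o H = (fun x => (f (x + t *: e))%:E) \- (EFin \o f) \- (EFin \o (fun x => fine (Q x))))%E//.
  by apply: integrableB => //; exact: integrableB.
have HW : {ae mu n, forall x, W x -> H x = 0}.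
  apply: fundamental_lemma => //.
    by apply: integrableS iH => //; exact: open_row_measurable.
  move=> v tv; have cv := test_function_continuous tv; have [T1 T2 T3] := tv.
  have [M HM] := compact_support_bounded cv T2.
  have mv : measurable_fun setT v.
    exact: continuous_row_measurable.
  have iftf : (mu n).-integrable setT (EFin \o (fun x => f (x + t *: e) - f x)).
    rewrite (_ : EFin \o _ = (fun x => (f (x + t *: e))%:E) \- (EFin \o f))%E//.
    exact: integrableB.
  have i1 := integrable_mul_bounded iftf mv HM.
  have i2 := integrable_mul_bounded iQ' mv HM.
  have E : (\int[mu n]_x (fine (Q x) * v x)%:E =
      \int[mu n]_x ((f (x + t *: e) - f x) * v x)%:E)%E.
    rewrite -line_tested//; apply: ae_eq_integral => //.
    - exact: measurable_int i2.
    - by apply: emeasurable_funM => //; exact/measurable_EFinP.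
    by apply: filterS Qfin => x Qx _; rewrite EFinM fineK.
  transitivity (\int[mu n]_x (((f (x + t *: e) - f x) * v x)%:E - (fine (Q x) * v x)%:E))%E.
    rewrite integral_mkcond; apply: eq_integral => x _; rewrite patchE.
    case: ifPn => [_|/negP xW]; first by rewrite -EFinB /H; congr (_%:E); ring.
    have -> : v x = 0.
      apply/eqP/negPn/negP => h; apply: xW; rewrite inE; apply: T3; exact: subset_closure.
    by rewrite !mulr0 subee.
  by rewrite integralB//= E subee// integrable_fin_num.
apply: filterS3 HW Qfin (ae_integrable2 integrable_line_Q) => x Hx Qx iQx Wx; split => //.
rewrite -/(Q x) -[RHS]fineK//; congr (_%:E).
by apply/eqP; rewrite -subr_eq0; apply/eqP; exact: Hx.
Qed.

End line_identity.

End line.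

(** * The fundamental theorem of calculus along segments from a point *)

Section sections.
Context d1 d2 (X : measurableType d1) (Y : measurableType d2) (R : realType).
Variables (m1 : {sigma_finite_measure set X -> \bar R}).
Variables (m2 : {sigma_finite_measure set Y -> \bar R}).

Lemma ae_section (P : X * Y -> Prop) :
  {ae (m1 \x m2)%E, forall p, P p} -> {ae m1, forall x, {ae m2, forall y, P (x, y)}}.
Proof.
move=> [N [mN N0 sub]].
have H : {ae m1, forall x, m2 (xsection N x) = 0%E}.
  have mx := measurable_fun_xsection m2 mN.
  have := (ae_eq_integral_abs m1 measurableT mx).1 _.
  have -> : (\int[m1]_x `|(m2 \o xsection N) x| = 0)%E.
    rewrite -[RHS]N0 /product_measure1; apply: eq_integral => x _.
    by rewrite gee0_abs.
  by move=> /(_ erefl); apply: filterS => x /(_ I).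
apply: filterS H => x Hx; exists (xsection N x); split => //.
  exact: measurable_xsection.
by move=> y nP; rewrite xsectionE; exact: sub.
Qed.

(** Together with [ae_section] this exchanges two almost-everywhere quantifiers
    on a measurable set. *)
Lemma ae_of_sections (E : set (X * Y)) : measurable E ->
  (forall y, {ae m1, forall x, ~ E (x, y)}) -> {ae (m1 \x m2)%E, forall p, ~ E p}.
Proof.
move=> mE H; exists E; split => //; last by move=> p /contrapT.
rewrite (@product_measure_unique _ _ _ _ R m1 m2 (m1 \x^ m2)%E)//; last first.
  by move=> A B mA mB; exact: product_measure2E.
transitivity (\int[m2]_y m1 (ysection E y))%E; first by [].
rewrite integral0_eq// => y _ /=.
have := H y => -[N [mN N0 sub]].
apply: (@subset_measure0 _ _ _ m1 _ N) => //; first exact: measurable_ysection.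
by move=> x; rewrite ysectionE => Ex; apply: sub => /= nE; exact: nE.
Qed.

End sections.

Section star_line.
Context {R : realType}.
Local Notation mu := (@lebesgue_row R).
Local Notation lambda := (@lebesgue_measure R).
Variables (n : nat) (K B : set 'rV[R]_n) (f : 'rV[R]_n -> R) (g : 'I_n -> 'rV[R]_n -> R).
Hypothesis fi : (mu n).-integrable setT (EFin \o f).
Hypothesis gi : forall i, (mu n).-integrable setT (EFin \o g i).
Hypothesis fg : forall i v, test_function K v ->
  (\int[mu n]_x (f x * partial i v x)%:E = - \int[mu n]_x (g i x * v x)%:E)%E.
Hypothesis oK : open K.
Hypothesis oB : open B.
Hypothesis starK : star_shaped K B.

(** Integrability is part of the property because integrals of non-integrable
    functions have a value too. *)
Definition segment_ftc (z e : 'rV[R]_n) (t : R) :=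
  lambda.-integrable setT (fun s => (\1_(`[0, t]%classic) s * \sum_i e ord0 i * g i (z + s *: e))%:E) /\
     ((f (z + t *: e) - f z)%:E =
      \int[lambda]_s (\1_(`[0, t]%classic) s * \sum_i e ord0 i * g i (z + s *: e))%:E)%E.

Local Notation Y := ('rV[R]_n * measurableTypeR R)%type.
Local Notation W := ('rV[R]_n * Y)%type.

Let F (p : W * measurableTypeR R) : \bar R :=
  (((0 <= p.2 <= p.1.2.2)%R%:R : R) * \sum_i p.1.2.1 ord0 i * g i (p.1.1 + p.2 *: p.1.2.1))%:E.

Let FE z e t s : F ((z, (e, t)), s) =
  (\1_(`[0, t]%classic) s * \sum_i e ord0 i * g i (z + s *: e))%:E.
Proof.
rewrite /F /= indicE (_ : (s \in _) = (0 <= s <= t))//.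
by apply/idP/idP => h; [rewrite inE/= in_itv in h|rewrite inE/= in_itv].
Qed.

Let coord_z i : measurable_fun setT (fun p : W * measurableTypeR R => p.1.1 ord0 i).
Proof.
exact: (measurableT_comp (measurable_row_coord i) (measurableT_comp measurable_fst measurable_fst)).
Qed.

Let coord_e i : measurable_fun setT (fun p : W * measurableTypeR R => p.1.2.1 ord0 i).
Proof.
exact: (measurableT_comp (measurable_row_coord i)
  (measurableT_comp measurable_fst (measurableT_comp measurable_snd measurable_fst))).
Qed.

Let mpt : measurable_fun setT (fun p : W * measurableTypeR R => p.1.1 + p.2 *: p.1.2.1).
Proof.
apply: measurable_fun_rowP => i; under eq_fun do rewrite !mxE.
apply: measurable_funD => //; apply: measurable_funM => //; exact: measurable_snd.
Qed.

Let mf : measurable_fun setT f.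
Proof. by apply/measurable_EFinP; exact: measurable_int fi. Qed.

Let mg i : measurable_fun setT (g i).
Proof. by apply/measurable_EFinP; exact: measurable_int (gi i). Qed.

Let mF : measurable_fun setT F.
Proof.
apply/measurable_EFinP; apply: measurable_funM; last first.
  apply: measurable_sum => i; apply: measurable_funM => //.
  exact: (measurableT_comp (mg i) mpt).
have mt : measurable_fun setT (fun p : W * measurableTypeR R => p.1.2.2).
  exact: (measurableT_comp measurable_snd (measurableT_comp measurable_snd measurable_fst)).
have mb : measurable_fun setT (fun p : W * measurableTypeR R => (0 <= p.2 <= p.1.2.2)%R).
  apply: measurable_and; apply: measurable_fun_ler => //; exact: measurable_snd.
rewrite (_ : (fun p : W * measurableTypeR R => _) =
    \1_[set p : W * measurableTypeR R | (0 <= p.2 <= p.1.2.2)%R]).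
  apply: measurable_indic; rewrite -[X in measurable X]setTI.
  exact: (mb measurableT [set true]).
apply/funext => p; rewrite indicE; congr ((nat_of_bool _)%:R).
by apply/idP/idP; rewrite inE.
Qed.

Let L (w : W) : \bar R := (f (w.1 + w.2.2 *: w.2.1) - f w.1)%:E.
Let A (w : W) : \bar R := (\int[lambda]_s `|F (w, s)|)%E.
Let Q (w : W) : \bar R := (\int[lambda]_s F (w, s))%E.

Let mL : measurable_fun setT L.
Proof.
apply/measurable_EFinP; apply: measurable_funB; last first.
  exact: (measurableT_comp mf measurable_fst).
apply: (measurableT_comp mf).
apply: measurable_fun_rowP => i; under eq_fun do rewrite !mxE.
apply: measurable_funD.
  exact: (measurableT_comp (measurable_row_coord i) measurable_fst).
apply: measurable_funM.
  exact: (measurableT_comp measurable_snd measurable_snd).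
exact: (measurableT_comp (measurable_row_coord i)
  (measurableT_comp measurable_fst measurable_snd)).
Qed.

Let mA : measurable_fun setT A.
Proof.
have mFa : measurable_fun setT (fun p => `|F p|%E) by exact: measurableT_comp.
exact: (@measurable_fun_fubini_tonelli_F _ _ _ _ R lambda _ mFa (fun p => abse_ge0 _)).
Qed.

Let mQ : measurable_fun setT Q.
Proof.
rewrite (_ : Q = fun w => (\int[lambda]_s F^\+ (w, s) - \int[lambda]_s F^\- (w, s))%E); last first.
  apply/funext => w; rewrite /Q integralE; congr (_ - _)%E.
    by apply: eq_integral => s _; rewrite !funeposE.
  by apply: eq_integral => s _; rewrite !funenegE.
apply: emeasurable_funB.
  have mFp : measurable_fun setT (F^\+)%E by exact: measurable_funepos.
  exact: (@measurable_fun_fubini_tonelli_F _ _ _ _ R lambda _ mFp (fun p => funepos_ge0 _ p)).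
have mFn : measurable_fun setT (F^\-)%E by exact: measurable_funeneg.
exact: (@measurable_fun_fubini_tonelli_F _ _ _ _ R lambda _ mFn (fun p => funeneg_ge0 _ p)).
Qed.

(** For fixed e and t, [line_identity] holds for almost every z. The set of bad
    triples (z, e, t) is measurable, so Tonelli's theorem yields the property
    for almost every z, almost every e and m-almost every t. Two instances of m
    matter: Lebesgue measure for the points under the integral sign, and the
    Dirac mass at 1 for the end point of the segment. *)
Lemma ae_segment_ftc (m : {sigma_finite_measure set (measurableTypeR R) -> \bar R}) :
  {ae mu n, forall z, B z -> {ae mu n, forall e, K (z + e) ->
     {ae m, forall t : R, 0 <= t <= 1 -> segment_ftc z e t}}}.
Proof.
pose Dom : set W := [set w | [/\ B w.1, K (w.1 + w.2.1) & 0 <= w.2.2 <= 1]].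
pose Good : set W := [set w | (A w < +oo)%E] `&` [set w | L w = Q w].
have mGood : measurable Good.
  apply: measurableI.
    rewrite -[X in measurable X]setTI; exact: emeasurable_fun_infty_o.
  rewrite (_ : [set w | L w = Q w] = ~` ((setT `&` [set w | L w < Q w]%E) `|` (setT `&` [set w | Q w < L w]%E))).
    by apply: measurableC; apply: measurableU; exact: measurable_lte.
  apply/seteqP; split => w /=.
    by move=> ->; rewrite ltxx => -[] [].
  move=> h; apply/eqP; rewrite eq_le; apply/andP; split; rewrite leNgt; apply/negP => hh.
    by apply: h; right; split.
  by apply: h; left; split.
have mDom : measurable Dom.
  have mz : measurable_fun setT (fun w : W => w.1 + w.2.1).
    apply: measurable_fun_rowP => i; under eq_fun do rewrite !mxE.
    apply: measurable_funD.
      exact: (measurableT_comp (measurable_row_coord i) measurable_fst).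
    exact: (measurableT_comp (measurable_row_coord i)
      (measurableT_comp measurable_fst measurable_snd)).
  have mt : measurable_fun setT (fun w : W => w.2.2).
    exact: (measurableT_comp measurable_snd measurable_snd).
  rewrite (_ : Dom = (fst @^-1` B) `&` ((fun w : W => w.1 + w.2.1) @^-1` K)
     `&` ((fun w : W => w.2.2) @^-1` `[0, 1]%classic)).
    apply: measurableI; first apply: measurableI.
    - rewrite -[X in measurable X]setTI; apply: measurable_fst => //.
      exact: open_row_measurable.
    - rewrite -[X in measurable X]setTI; apply: mz => //.
      exact: open_row_measurable.
    - rewrite -[X in measurable X]setTI; apply: mt => //.
  apply/seteqP; split => w /=; rewrite in_itv/=; first by case.
  by move=> [[]].
have key (y : Y) : {ae mu n, forall z, ~ (Dom `&` ~` Good) (z, y)}.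
  case: y => e t.
  have [t01|t01] := boolP (0 <= t <= 1); last first.
    by apply: aeW => z [[_ _ /= h]] _; rewrite h in t01.
  pose Wo := B `&` [set z | K (z + e)].
  have oW : open Wo.
    apply: openI => //; apply: open_comp oK => x _.
    by apply: differentiable_continuous; exact: differentiableD.
  have WK x (s : R) : Wo x -> 0 <= s <= 1 -> K (x + s *: e).
    move=> [Bx Kx] /andP[s0 s1].
    have -> : x + s *: e = (1 - (1 - s)) *: (x + e) + (1 - s) *: x.
      by rewrite subKr scalerDr addrAC -scalerDl subrKC scale1r.
    by apply: starK => //; rewrite subr_ge0 s1/= lerBlDr lerDl.
  have := line_identity fi gi fg oW WK t01.
  apply: filterS => z Hz [[/= Bz Kz _] nG]; apply: nG.
  have [iI E] := Hz (conj Bz Kz); split => /=.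
    rewrite /A; case/integrableP: iI => _.
    by under eq_integral do rewrite -FE.
  rewrite /L /Q /= E.
  by under eq_integral do rewrite -FE.
pose Bad : set W := Dom `&` ~` Good.
have mBad : measurable Bad := measurableI _ _ mDom (measurableC mGood).
pose re (p : ('rV[R]_n * 'rV[R]_n) * measurableTypeR R) : W := (p.1.1, (p.1.2, p.2)).
have mre : measurable_fun setT re.
  apply/measurable_fun_pairP; split; first exact: (measurableT_comp measurable_fst measurable_fst).
  apply/measurable_fun_pairP; split; last exact: measurable_snd.
  exact: (measurableT_comp measurable_snd measurable_fst).
have mBadr : measurable (re @^-1` Bad) by rewrite -[X in measurable X]setTI; exact: mre.
have mx := measurable_fun_xsection m mBadr.
(* the pairs (z, e) whose bad parameters t have positive measure *)
pose E2 := setT `&` [set p | m (xsection (re @^-1` Bad) p) != 0%E].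
have mE2 : measurable E2 by exact: emeasurable_neq.
have key2 (e : 'rV[R]_n) : {ae mu n, forall z, ~ E2 (z, e)}.
  pose in_e (q : 'rV[R]_n * measurableTypeR R) : W := (q.1, (e, q.2)).
  have min_e : measurable_fun setT in_e.
    apply/measurable_fun_pairP; split; first exact: measurable_fst.
    apply/measurable_fun_pairP; split; [exact: measurable_cst|exact: measurable_snd].
  have mBe : measurable (in_e @^-1` Bad) by rewrite -[X in measurable X]setTI; exact: min_e.
  have := @ae_of_sections _ _ _ _ _ (mu n) m _ mBe (fun t => key (e, t)).
  move=> /ae_section; apply: filterS => z [N [mN N0 sub]] [_ /=]; apply/negP; rewrite negbK.
  apply/eqP; apply: (@subset_measure0 _ _ _ m _ N) => //; first exact: measurable_xsection.
  by move=> t; rewrite xsectionE => Bt; apply: sub => /= nB; exact: nB.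
have := ae_section (@ae_of_sections _ _ _ _ _ (mu n) (mu n) _ mE2 key2).
apply: filterS => z Hz Bz; apply: filterS Hz => e He Kze.
have {}He : m (xsection (re @^-1` Bad) (z, e)) = 0%E.
  by apply/eqP/negPn/negP => h; apply: He.
exists (xsection (re @^-1` Bad) (z, e)); split => //; first exact: measurable_xsection.
move=> t nt; rewrite xsectionE; apply: contrapT => nBad; apply: nt => t01.
have [A1 LQ] : Good (z, (e, t)) by apply: contrapT => nG; apply: nBad.
have Eint : (fun s => F ((z, (e, t)), s)) = (fun s => (\1_(`[0, t]%classic) s * \sum_i e ord0 i * g i (z + s *: e))%:E).
  by apply/funext => s; exact: FE.
split.
  rewrite -Eint; apply/integrableP; split => //.
  exact: (measurableT_comp mF (pair1_measurable _)).
by rewrite -Eint; exact: LQ.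
Qed.

End star_line.

(** * Complex-valued square-integrable functions *)

Section parts.
Context {R : realType}.
Local Notation normc := (@ComplexField.Normc.normc R).

(** Real-valued analysis applies to the real and imaginary parts, uniformly in
    b. *)
Definition part (b : bool) (w : R[i]) : R := if b then complex.Re w else complex.Im w.

(** The sign in front of the imaginary part of w in the real and imaginary parts
    of w z, see [partM]. *)
Definition im_sign (b : bool) : R := if b then -1 else 1.

Lemma partD b (w z : R[i]) : part b (w + z) = part b w + part b z.
Proof. by case: w z b => [? ?] [? ?] []. Qed.

Lemma part0 b : part b 0 = 0.
Proof. by case: b. Qed.

Lemma partM b (w z : R[i]) :
  part b (w * z) = part true w * part b z + im_sign b * part false w * part (~~ b) z.
Proof. by case: w z b => [a1 a2] [b1 b2] [] /=; rewrite /part /im_sign /=; ring. Qed.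

Lemma part_sum b (I : Type) (s : seq I) (P : pred I) (F : I -> R[i]) :
  part b (\sum_(i <- s | P i) F i) = \sum_(i <- s | P i) part b (F i).
Proof.
by apply: (big_morph (part b)); [move=> w z; exact: partD|exact: part0].
Qed.

Lemma normc_ge0 (w : R[i]) : 0 <= normc w.
Proof. by case: w => a b; exact: sqrtr_ge0. Qed.

Lemma normc_sqr (w : R[i]) : normc w ^+ 2 = part true w ^+ 2 + part false w ^+ 2.
Proof. by case: w => a b /=; rewrite sqr_sqrtr// addr_ge0 ?sqr_ge0. Qed.

Lemma part_le b (w : R[i]) : `|part b w| <= normc w.
Proof.
rewrite -(@ler_pXn2r _ 2)// ?nnegrE// ?normc_ge0// real_normK ?num_real//.
by rewrite normc_sqr; case: b; [rewrite lerDl|rewrite lerDr]; exact: sqr_ge0.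
Qed.

Lemma normcDE (w z : R[i]) : normc (w + z) <= normc w + normc z.
Proof. exact: le_normcD. Qed.

Lemma normc_sum (I : Type) (s : seq I) (F : I -> R[i]) :
  normc (\sum_(i <- s) F i) <= \sum_(i <- s) normc (F i).
Proof.
elim: s => [|i s IH]; first by rewrite !big_nil ComplexField.Normc.normc0.
by rewrite !big_cons (le_trans (normcDE _ _))// lerD2l.
Qed.

Lemma part_ext (w z : R[i]) : (forall b, part b w = part b z) -> w = z.
Proof.
by case: w z => [a b] [c d] H; congr Complex; [exact: (H true)|exact: (H false)].
Qed.

End parts.

Section L2.
Context {R : realType}.
Local Notation mu := (@lebesgue_row R).
Local Notation normc := (@ComplexField.Normc.normc R).
Variables (n : nat) (K : set 'rV[R]_n).
Hypothesis mK : measurable K.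
Implicit Types f g : 'rV[R]_n -> R[i].

Definition sqL2 f : \bar R := (\int[mu n]_(x in K) (normc (f x) ^+ 2)%:E)%E.

Lemma sqL2_ge0 f : (0 <= sqL2 f)%E.
Proof. by apply: integral_ge0 => x _; rewrite lee_fin sqr_ge0. Qed.

Lemma L2normE f : L2norm K f = (sqL2 f `^ 2^-1)%E.
Proof.
rewrite /L2norm unlock /Lnorm /sqL2 [in RHS]integral_mkcond; congr (_ `^ _)%E.
apply: eq_integral => x _; rewrite /patch; case: ifP => _.
  by rewrite /= ger0_norm ?normc_ge0// powR_mulrn ?normc_ge0.
by rewrite abse0 poweR0r.
Qed.

Lemma L2norm_sqr f : (L2norm K f `^ 2 = sqL2 f)%E.
Proof. by rewrite L2normE -poweRrM mulVf// poweRe1// sqL2_ge0. Qed.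

Definition measurable_parts f := forall b, measurable_fun K (part b \o f).

Lemma in_L2P f : in_L2 K f <-> measurable_parts f /\ (sqL2 f < +oo)%E.
Proof.
split.
  move=> [m1 m2]; rewrite L2normE => H; split; first by case.
  by apply: lty_poweRy H.
move=> [m H]; split; [exact: (m true)|exact: (m false)|].
by rewrite L2normE; exact: poweR_lty.
Qed.

Lemma mparts_normc f : measurable_parts f -> measurable_fun K (fun x => normc (f x)).
Proof.
move=> m.
rewrite (_ : (fun x => _) = Num.sqrt \o (fun x => part true (f x) ^+ 2 + part false (f x) ^+ 2)).
  apply: measurableT_comp; first by apply: continuous_measurable_fun; exact: sqrt_continuous.
  by apply: measurable_funD; apply: measurable_funX; exact: m.
by apply/funext => x /=; rewrite -normc_sqr sqrtr_sqr ger0_norm// normc_ge0.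
Qed.

Lemma mparts_sqr f : measurable_parts f -> measurable_fun K (fun x => (normc (f x) ^+ 2)%:E).
Proof.
by move=> m; apply/measurable_EFinP; apply: measurable_funX; exact: mparts_normc.
Qed.

Lemma mpartsD f g (c : R[i]) : measurable_parts f -> measurable_parts g -> measurable_parts (fun x => f x + c * g x).
Proof.
move=> mf mg b; rewrite (_ : _ \o _ = (fun x => part b (f x) +
    (part true c * part b (g x) + im_sign b * part false c * part (~~ b) (g x)))); last first.
  by apply/funext => x /=; rewrite partD partM.
apply: measurable_funD; first exact: mf.
by apply: measurable_funD; apply: measurable_funM => //; exact: mg.
Qed.

Lemma in_L2D f g (c : R[i]) : in_L2 K f -> in_L2 K g -> in_L2 K (fun x => f x + c * g x).
Proof.
move=> /in_L2P[mf ff] /in_L2P[mg fg]; apply/in_L2P; split; first exact: mpartsD.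
have mf2 := mparts_sqr mf; have mg2 := mparts_sqr mg.
pose C : R := normc c ^+ 2.
have C0 : 0 <= C by exact: sqr_ge0.
apply: (@le_lt_trans _ _ (2%:E * sqL2 f + (2 * C)%:E * sqL2 g)%E); last first.
  apply: lte_add_pinfty.
    apply: lte_mul_pinfty => //.
  apply: lte_mul_pinfty => //.
  by rewrite lee_fin mulr_ge0.
rewrite /sqL2 -!ge0_integralZl//; try by move=> x _; rewrite lee_fin ?sqr_ge0.
all: try by rewrite lee_fin mulr_ge0.
rewrite -ge0_integralD//; first last.
- by apply: measurable_funeM.
- by move=> x _; rewrite -EFinM lee_fin; apply: mulr_ge0; [exact: mulr_ge0|exact: sqr_ge0].
- by apply: measurable_funeM.
- by move=> x _; rewrite -EFinM lee_fin; apply: mulr_ge0 => //; exact: sqr_ge0.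
apply: ge0_le_integral => //.
- by move=> x _; rewrite lee_fin sqr_ge0.
- by apply: (@mparts_sqr (fun x => f x + c * g x)); exact: mpartsD.
- by apply: emeasurable_funD; exact: measurable_funeM.
move=> x _; rewrite -!EFinM -EFinD lee_fin /C.
have h1 := normcDE (f x) (c * g x); rewrite ComplexField.Normc.normcM in h1.
have := normc_ge0 (f x + c * g x); have := normc_ge0 (f x).
have := normc_ge0 (g x); have := normc_ge0 c.
move: (normc _) (normc (f x)) (normc (g x)) (normc c) h1 => u v w y h1 y0 w0 v0 u0.
apply: (@le_trans _ _ ((v + y * w) ^+ 2)).
  by rewrite ler_pXn2r// nnegrE addr_ge0// mulr_ge0.
have := sqr_ge0 (v - y * w); rewrite !expr2; lra.
Qed.

Hypothesis fK : (mu n K < +oo)%E.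

(** K has finite measure, and a component of f is at most 1 + |f|^2. *)
Lemma in_L2_integrable f b : in_L2 K f -> (mu n).-integrable K (EFin \o (part b \o f)).
Proof.
move=> /in_L2P[mf ff].
apply: (@le_integrable _ _ _ _ _ mK _ (fun x => (1 + normc (f x) ^+ 2)%:E)).
- by apply/measurable_EFinP; exact: mf.
- move=> x _; rewrite /= !lee_fin [leRHS]ger0_norm ?addr_ge0 ?sqr_ge0//.
  apply: le_trans (part_le _ _) _; have := sqr_ge0 (normc (f x) - 2^-1).
  have := normc_ge0 (f x); rewrite !expr2; move: (normc _) => u u0; lra.
apply/integrableP; split.
  apply/measurable_EFinP; apply: measurable_funD => //.
  by apply: measurable_funX; exact: mparts_normc.
under eq_integral do rewrite gee0_abs ?lee_fin ?addr_ge0 ?sqr_ge0// EFinD.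
rewrite ge0_integralD//; first last.
- exact: mparts_sqr.
- by move=> x _; rewrite lee_fin sqr_ge0.
by rewrite integral_cst// mul1e lte_add_pinfty.
Qed.

End L2.

(** * Weak derivatives *)

Section weak.
Context {R : realType}.
Local Notation mu := (@lebesgue_row R).
Local Notation normc := (@ComplexField.Normc.normc R).
Variables (n : nat) (K : set 'rV[R]_n).
Hypothesis oK : open K.
Hypothesis bK : bounded_set K.
Implicit Types (f g : 'rV[R]_n -> R[i]) (v : 'rV[R]_n -> R).

Lemma fin_num_lin3 (s c1 c2 : R) (x y z : \bar R) :
  x \is a fin_num -> y \is a fin_num -> z \is a fin_num ->
  (s%:E * x + c1%:E * (s%:E * y) + c2%:E * (s%:E * z) =
   s%:E * (x + c1%:E * y + c2%:E * z))%E.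
Proof.
move: x y z => [x| |] [y| |] [z| |] // _ _ _.
by rewrite !(=^~ EFinM, =^~ EFinD); congr (_%:E); ring.
Qed.

Let mK : measurable K.
Proof. exact: open_row_measurable. Qed.

Let fK : (mu n K < +oo)%E.
Proof. exact: bounded_lebesgue_row_fin. Qed.

Lemma test_integrable_mul (f v : 'rV[R]_n -> R) : (mu n).-integrable K (EFin \o f) ->
  test_function K v -> (mu n).-integrable K (fun x => (f x * v x)%:E).
Proof.
move=> fi tv; have cv := test_function_continuous tv.
have [_ cpt _] := tv; have [M HM] := compact_support_bounded cv cpt.
apply: (@integrable_mul_bounded_on _ _ _ _ _ M) => //.
by apply: measurable_funTS; exact: continuous_row_measurable.
Qed.

Lemma test_function_mpartial j v : test_function K v -> test_function K (mpartial j v).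
Proof.
have [s [_ ->]] := @mpartialE R n j.
by elim: s => //= i s IH tv; apply: test_function_partial; exact: IH.
Qed.

(** One real component of [ibp], with extended-real integrals, to which the
    lemmas on integration apply directly. *)
Definition weak_ibp (k : nat) (f g w v : 'rV[R]_n -> R) :=
  (\int[mu n]_(x in K) (f x * w x)%:E =
   ((-1) ^+ k : R)%:E * \int[mu n]_(x in K) (g x * v x)%:E)%E.

Lemma ibpP j f g v : in_L2 K f -> in_L2 K g -> test_function K v ->
  ibp K j f g v <->
  forall b, weak_ibp (mi_order j) (part b \o f) (part b \o g) (mpartial j v) v.
Proof.
move=> Lf Lg tv; have tjv := test_function_mpartial j tv.
have If b := test_integrable_mul (in_L2_integrable mK fK b Lf) tjv.
have Ig b := test_integrable_mul (in_L2_integrable mK fK b Lg) tv.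
have E b (h : 'rV[R]_n -> R[i]) (w : 'rV[R]_n -> R) :
    (mu n).-integrable K (fun x => (part b (h x) * w x)%:E) ->
    (\int[mu n]_(x in K) (part b (h x) * w x)%:E)%E =
    (part b (cintegral K (fun x => h x * (w x)%:C%C)))%:E.
  move=> hi; rewrite -[LHS]fineK; last exact: integrable_fin_num.
  congr (_%:E); case: b hi => hi; rewrite /cintegral /=; congr fine.
    by apply: eq_integral => x _ /=; congr (_%:E); case: (h x) => a b /=; rewrite mulr0 subr0.
  by apply: eq_integral => x _ /=; congr (_%:E); case: (h x) => a b /=; rewrite mulr0 add0r.
rewrite /ibp /weak_ibp; split.
  move=> H b; rewrite (E b _ _ (If b)) (E b _ _ (Ig b)) H -EFinM; congr (_%:E).
  rewrite (_ : (-1) ^+ mi_order j = ((-1) ^+ mi_order j)%:C%C :> R[i]); last first.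
    by rewrite rmorphXn rmorphN rmorph1.
  by rewrite partM /= mulr0 mul0r addr0.
move=> H; apply: part_ext => b; apply: EFin_inj.
apply: etrans (esym (E b f (mpartial j v) (If b))) _; apply: etrans (H b) _.
rewrite (E b _ _ (Ig b)) -EFinM; congr (_%:E).
rewrite (_ : (-1) ^+ mi_order j = ((-1) ^+ mi_order j)%:C%C :> R[i]); last first.
  by rewrite rmorphXn rmorphN rmorph1.
by rewrite partM /= mulr0 mul0r addr0.
Qed.

Lemma is_wderivP j f g : in_L2 K f -> is_wderiv K j f g <-> in_L2 K g /\
  forall v, test_function K v -> forall b,
    weak_ibp (mi_order j) (part b \o f) (part b \o g) (mpartial j v) v.
Proof.
move=> Lf; split => -[Lg H]; split=> // v tv; have := H v tv; rewrite ibpP//.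
Qed.

(** D^j f has the weak i-th partial derivative D^(j + e_i) f: compare the
    definition of the latter for v with that of D^j f for the test function d_i
    v. *)
Lemma is_wderiv_step j i f g g' v b : in_L2 K f ->
  is_wderiv K j f g -> is_wderiv K (mi_add j i) f g' -> test_function K v ->
  (\int[mu n]_(x in K) (part b (g x) * partial i v x)%:E =
   - \int[mu n]_(x in K) (part b (g' x) * v x)%:E)%E.
Proof.
move=> Lf /(is_wderivP _ _ Lf)[Lg H] /(is_wderivP _ _ Lf)[Lg' H'] tv.
have /test_functionP[vS _ _] := tv.
have tiv := test_function_partial i tv.
have := H _ tiv b; have := H' _ tv b.
rewrite /weak_ibp mpartial_partial// mi_order_add => -> /=.
set A := (\int[_]_(_ in _) _)%E; set B := (\int[_]_(_ in _) _)%E => E.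
have sg2 : (((-1) ^+ mi_order j) * ((-1) ^+ mi_order j) = 1 :> R) by rewrite -expr2 sqrr_sign.
rewrite -[LHS]mul1e -sg2 EFinM -muleA -E exprS mulN1r EFinN muleA muleN -EFinM sg2.
by rewrite mulN1e.
Qed.

Lemma is_wderiv_unique j f g g' : in_L2 K f ->
  is_wderiv K j f g -> is_wderiv K j f g' ->
  {ae mu n, forall x, K x -> g x = g' x}.
Proof.
move=> Lf /(is_wderivP _ _ Lf)[Lg H] /(is_wderivP _ _ Lf)[Lg' H'].
have key b : {ae mu n, forall x, K x -> part b (g x) - part b (g' x) = 0}.
  have Ig := in_L2_integrable mK fK b Lg; have Ig' := in_L2_integrable mK fK b Lg'.
  apply: fundamental_lemma => //.
    by have := integrableB mK Ig Ig'; apply: eq_integrable.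
  move=> v tv; under eq_integral do rewrite mulrBl EFinB.
  rewrite integralB//; [|exact: test_integrable_mul..].
  have := H v tv b; have := H' v tv b; rewrite /weak_ibp => ->.
  set A := (\int[_]_(_ in _) _)%E; set B := (\int[_]_(_ in _) _)%E => E.
  have sg2 : (((-1) ^+ mi_order j) * ((-1) ^+ mi_order j) = 1 :> R) by rewrite -expr2 sqrr_sign.
  have AB : A = B by rewrite -[LHS]mul1e -[RHS]mul1e -sg2 !EFinM -!muleA E.
  have fA : A \is a fin_num by apply: integrable_fin_num => //; exact: test_integrable_mul.
  by rewrite -AB subee.
apply: filterS2 (key true) (key false) => x h1 h2 Kx.
by apply: part_ext => -[]; apply/eqP; rewrite -subr_eq0; apply/eqP; [exact: h1|exact: h2].
Qed.

Lemma wderivP j f g : is_wderiv K j f g -> is_wderiv K j f (wderiv K j f).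
Proof. by move=> H; rewrite /wderiv; apply: (@xgetPex _ (fun=> 0) [set g | is_wderiv K j f g]); exists g. Qed.

(** [wderiv] picks an arbitrary weak derivative; by uniqueness its norm is that
    of any other one. *)
Lemma sqL2_wderiv j f g : in_L2 K f -> is_wderiv K j f g ->
  sqL2 K (wderiv K j f) = sqL2 K g.
Proof.
move=> Lf Hg; have Hw := wderivP Hg.
have [/in_L2P[mg _] _] := Hg; have [/in_L2P[mw _] _] := Hw.
apply: ge0_ae_eq_integral => //.
- exact: mparts_sqr.
- exact: mparts_sqr.
- by move=> x _; rewrite lee_fin sqr_ge0.
- by move=> x _; rewrite lee_fin sqr_ge0.
by have := is_wderiv_unique Lf Hw Hg; apply: filterS => x H Kx; rewrite H.
Qed.

Lemma is_wderivD j f g f' g' (c : R[i]) : in_L2 K f -> in_L2 K g ->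
  is_wderiv K j f f' -> is_wderiv K j g g' ->
  is_wderiv K j (fun x => f x + c * g x) (fun x => f' x + c * g' x).
Proof.
move=> Lf Lg /(is_wderivP _ _ Lf)[Lf' Hf] /(is_wderivP _ _ Lg)[Lg' Hg].
have Lfg := in_L2D mK c Lf Lg.
apply/(is_wderivP _ _ Lfg); split; first exact: in_L2D.
move=> v tv b; have tjv := test_function_mpartial j tv.
have X (h k : 'rV[R]_n -> R[i]) (w : 'rV[R]_n -> R) : in_L2 K h -> in_L2 K k -> test_function K w ->
  (\int[mu n]_(x in K) (part b (h x + c * k x)%R * w x)%:E =
   \int[mu n]_(x in K) (part b (h x) * w x)%:E +
   (part true c)%:E * \int[mu n]_(x in K) (part b (k x) * w x)%:E +
   (im_sign b * part false c)%:E * \int[mu n]_(x in K) (part (~~ b) (k x) * w x)%:E)%E.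
  move=> Lh Lk tw.
  have Ih : (mu n).-integrable K (fun x => (part b (h x) * w x)%:E) :=
    test_integrable_mul (in_L2_integrable mK fK b Lh) tw.
  have Ik b' : (mu n).-integrable K (fun x => (part b' (k x) * w x)%:E) :=
    test_integrable_mul (in_L2_integrable mK fK b' Lk) tw.
  rewrite -!integralZl//.
  rewrite -(integralD mK Ih); last exact: integrableZl.
  rewrite -integralD//; [|apply: integrableD => //; exact: integrableZl|exact: integrableZl].
  by apply: eq_integral => x _; rewrite partD partM -!EFinM -!EFinD; congr (_%:E); ring.
have Fin (h : 'rV[R]_n -> R[i]) b' (w : 'rV[R]_n -> R) : in_L2 K h -> test_function K w ->
    (\int[mu n]_(x in K) (part b' (h x) * w x)%:E)%E \is a fin_num.
  move=> Lh tw; apply: integrable_fin_num => //.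
  exact: test_integrable_mul (in_L2_integrable mK fK b' Lh) tw.
rewrite /weak_ibp /= X// X//.
have := Hf v tv b; have := Hg v tv b; have := Hg v tv (~~ b); rewrite /weak_ibp /= => -> -> ->.
move: (Fin f' b v Lf' tv) (Fin g' b v Lg' tv) (Fin g' (~~ b) v Lg' tv).
exact: fin_num_lin3.
Qed.

Lemma in_L2_sum N (c : 'I_N -> R[i]) (g : 'I_N -> 'rV[R]_n -> R[i]) f :
  in_L2 K f -> (forall l, in_L2 K (g l)) ->
  in_L2 K (fun x => f x - \sum_l c l * g l x).
Proof.
move=> Lf Lg.
have : in_L2 K (fun x => f x + \sum_(l <- index_enum 'I_N) - c l * g l x).
  elim: (index_enum _) => [|l s IH].
    by under [X in in_L2 K X]eq_fun do rewrite big_nil addr0.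
  under [X in in_L2 K X]eq_fun do rewrite big_cons addrCA addrC.
  exact: in_L2D.
congr in_L2; apply/funext => x; congr (_ + _); rewrite -sumrN.
by apply: eq_bigr => l _; rewrite mulNr.
Qed.

Lemma is_wderiv_sum N j (c : 'I_N -> R[i]) (g g' : 'I_N -> 'rV[R]_n -> R[i]) f f' :
  in_L2 K f -> (forall l, in_L2 K (g l)) ->
  is_wderiv K j f f' -> (forall l, is_wderiv K j (g l) (g' l)) ->
  is_wderiv K j (fun x => f x - \sum_l c l * g l x) (fun x => f' x - \sum_l c l * g' l x).
Proof.
move=> Lf Lg Wf Wg.
have : in_L2 K (fun x => f x + \sum_(l <- index_enum 'I_N) - c l * g l x) /\
  is_wderiv K j (fun x => f x + \sum_(l <- index_enum 'I_N) - c l * g l x)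
   (fun x => f' x + \sum_(l <- index_enum 'I_N) - c l * g' l x).
  elim: (index_enum _) => [|l s [IH1 IH2]].
    by split; [under [X in in_L2 K X]eq_fun do rewrite big_nil addr0|
      under [X in is_wderiv K j X]eq_fun do rewrite big_nil addr0;
      under [X in is_wderiv K j _ X]eq_fun do rewrite big_nil addr0].
  split.
    under [X in in_L2 K X]eq_fun do rewrite big_cons addrCA addrC.
    exact: in_L2D.
  under [X in is_wderiv K j X]eq_fun do rewrite big_cons addrCA addrC.
  under [X in is_wderiv K j _ X]eq_fun do rewrite big_cons addrCA addrC.
  exact: is_wderivD.
move=> [_]; congr is_wderiv; apply/funext => x; congr (_ + _); rewrite -sumrN.
  by apply: eq_bigr => l _; rewrite mulNr.
by apply: eq_bigr => l _; rewrite mulNr.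
Qed.

Lemma smooth_bounded (f : 'rV[R]_n -> R) s : smooth_closure K f ->
  exists2 M, 0 <= M & forall x, K x -> `|partials s f x| <= M.
Proof.
move=> /(_ s)[_ [h [ch hE]]].
have cK : compact (closure K).
  have [M M0 KM] := bounded_sub_obox bK.
  have sub : closure K `<=` cbox (const_mx (- M)) (const_mx M).
    rewrite [X in _ `<=` X](closure_id _).1; last exact: closed_cbox.
    by apply: closure_subset => x /KM; exact: obox_cbox.
  apply: subclosed_compact sub; [exact: closed_closure|exact: compact_cbox].
have : compact (h @` closure K) by exact: continuous_compact.
move=> /compact_bounded[M0 [_ HM]]; exists (`|M0| + 1); first by rewrite addr_ge0.
move=> x Kx; rewrite -hE//; apply: HM.
  by rewrite (le_lt_trans (ler_norm _))// ltrDl.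
by exists x => //; exact: subset_closure.
Qed.

Lemma smooth_continuous (f : 'rV[R]_n -> R) s x : smooth_closure K f -> K x ->
  {for x, continuous (partials s f)}.
Proof. by move=> /(_ s)[H _] Kx; apply: differentiable_continuous; exact: H. Qed.

Lemma smooth_measurable (f : 'rV[R]_n -> R) s : smooth_closure K f ->
  measurable_fun K (partials s f).
Proof.
move=> sf; apply: row_continuous_measurable => // x; rewrite inE => Kx.
exact: smooth_continuous.
Qed.

(** Each integration by parts turns the outermost derivative of v into the
    innermost one of f, which reverses the list. *)
Lemma smooth_ibp (f v : 'rV[R]_n -> R) s : smooth_closure K f -> test_function K v ->
  weak_ibp (size s) f (partials (rev s) f) (partials s v) v.
Proof.
move=> sf; rewrite /weak_ibp; elim: s f sf v => [|i s IH] f sf v tv /=.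
  by rewrite mul1e.
have sfi : smooth_closure K (partial i f).
  move=> t; have := sf (rcons t i).
  by rewrite /partials foldr_rcons.
have tsv : test_function K (partials s v).
  by elim: s {IH} => //= k s IH; exact: test_function_partial.
rewrite ibp_partial//; first last.
- by move=> x Kx; exact: (@smooth_continuous f [:: i] x sf Kx).
- by move=> x Kx; exact: (sf [::]).1.
rewrite (IH _ sfi v tv) rev_cons /partials foldr_rcons exprS mulN1r EFinN mulNe.
by [].
Qed.

Lemma csmooth_parts (f : 'rV[R]_n -> R[i]) b : csmooth_closure K f ->
  smooth_closure K (part b \o f).
Proof. by case: b => -[]. Qed.

Lemma part_cmpartial b j f x : part b (cmpartial j f x) = mpartial j (part b \o f) x.
Proof. by case: b. Qed.

Lemma csmooth_bounded f j : csmooth_closure K f ->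
  exists2 M, 0 <= M & forall x, K x -> normc (cmpartial j f x) <= M.
Proof.
move=> sf; have [s [_ Es]] := @mpartialE R n j.
have [M1 M10 H1] := smooth_bounded s (csmooth_parts true sf).
have [M2 M20 H2] := smooth_bounded s (csmooth_parts false sf).
exists (M1 + M2); first exact: addr_ge0.
move=> x Kx; rewrite -(@ler_pXn2r _ 2)// ?nnegrE ?normc_ge0 ?addr_ge0//.
rewrite normc_sqr !part_cmpartial !Es.
have := H1 x Kx; have := H2 x Kx.
move: (partials _ _ x) (partials _ _ x) => u w; rewrite !ler_norml => /andP[a1 a2] /andP[b1 b2].
rewrite !expr2; nra.
Qed.

Lemma csmooth_in_L2 f j : csmooth_closure K f -> in_L2 K (cmpartial j f).
Proof.
move=> sf; apply/in_L2P; split.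
  move=> b; rewrite (_ : _ \o _ = mpartial j (part b \o f)); last first.
    by apply/funext => x; rewrite /= part_cmpartial.
  have [s [_ Es]] := @mpartialE R n j; rewrite Es.
  by apply: smooth_measurable; exact: csmooth_parts.
have [M M0 HM] := csmooth_bounded j sf.
apply: (@le_lt_trans _ _ (\int[mu n]_(x in K) (M ^+ 2)%:E)%E).
  have mg : measurable_fun K (fun x : 'rV[R]_n => (M ^+ 2)%:E) by exact: measurable_cst.
  apply: ge0_le_integral => //.
  - by move=> x _; rewrite lee_fin sqr_ge0.
  - apply: mparts_sqr => b; rewrite (_ : _ \o _ = mpartial j (part b \o f)); last first.
      by apply/funext => x; rewrite /= part_cmpartial.
    have [s [_ Es]] := @mpartialE R n j; rewrite Es.
    by apply: smooth_measurable; exact: csmooth_parts.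
  - by move=> x Kx; rewrite lee_fin ler_pXn2r ?nnegrE ?normc_ge0 ?HM.
by rewrite integral_cst// lte_mul_pinfty// lee_fin sqr_ge0.
Qed.

Lemma mi0_cmpartial f : cmpartial (fun=> 0%N) f = f.
Proof.
apply/funext => x; apply: part_ext => b; rewrite part_cmpartial /mpartial.
by have -> : flatten [seq nseq 0 i | i <- enum 'I_n] = [::] by elim: (enum _).
Qed.

(** The reversed order of differentiation left by [smooth_ibp] is restored on
    the test function, which is smooth on the whole space, so that Schwarz'
    theorem applies. *)
Lemma csmooth_is_wderiv f j : csmooth_closure K f -> is_wderiv K j f (cmpartial j f).
Proof.
move=> sf; have Lf : in_L2 K f by rewrite -[f]mi0_cmpartial; exact: csmooth_in_L2.
apply/(is_wderivP _ _ Lf); split; first exact: csmooth_in_L2.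
move=> v tv b; have /test_functionP[vS _ _] := tv.
rewrite (_ : _ \o cmpartial j f = mpartial j (part b \o f)); last first.
  by apply/funext => x; rewrite /= part_cmpartial.
have [s [sz Es]] := @mpartialE R n j.
have := smooth_ibp (rev s) (csmooth_parts b sf) tv.
rewrite revK size_rev sz !Es (partials_perm vS (_ : perm_eq (rev s) s))//.
by rewrite perm_rev.
Qed.

(** Extension by 0 turns square-integrable functions on K into integrable
    functions on R^n, which can be translated. *)
Definition ext0 f : 'rV[R]_n -> R[i] := fun x => if x \in K then f x else 0.

Lemma part_ext0 b f : part b \o ext0 f = (part b \o f) \_ K.
Proof.
apply/funext => x; rewrite /ext0 /= /patch; case: ifP => // _; exact: part0.
Qed.

Lemma ext0_integrable_part b f : in_L2 K f -> (mu n).-integrable setT (EFin \o (part b \o ext0 f)).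
Proof.
move=> Lf; rewrite part_ext0 -restrict_EFin; apply/(integrable_mkcond _ mK).
exact: in_L2_integrable.
Qed.

Lemma ext0_step j i f g g' v b : in_L2 K f ->
  is_wderiv K j f g -> is_wderiv K (mi_add j i) f g' -> test_function K v ->
  (\int[mu n]_x ((part b \o ext0 g) x * partial i v x)%:E =
   - \int[mu n]_x ((part b \o ext0 g') x * v x)%:E)%E.
Proof.
have E h w : (\int[mu n]_x ((part b \o ext0 h) x * w x)%:E =
    \int[mu n]_(x in K) (part b (h x) * w x)%:E)%E.
  rewrite [RHS]integral_mkcond; apply: eq_integral => x _.
  by rewrite part_ext0 /patch; case: ifP => // _; rewrite mul0r.
by move=> Lf H1 H2 tv; rewrite !E; exact: is_wderiv_step Lf H1 H2 tv.
Qed.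

End weak.

(** * Averages over segments and over balls *)

Lemma indic_itv01E (R : realType) (s : R) : \1_(`[0, 1]%classic) s = (0 <= s <= 1)%R%:R :> R.
Proof.
rewrite indicE; congr ((nat_of_bool _)%:R).
by apply/idP/idP => h; [rewrite inE/= in_itv in h|rewrite inE/= in_itv].
Qed.

Lemma lebesgue_itv01 (R : realType) : @lebesgue_measure R (`[0%R, 1%R]%classic : set R) = 1%E.
Proof. by rewrite lebesgue_measure_itv/= lte01 oppr0 adde0. Qed.

Section star_average.
Context {R : realType}.
Local Notation mu := (@lebesgue_row R).
Local Notation lambda := (@lebesgue_measure R).
Variables (n : nat) (T : 'rV[R]_n -> \bar R).
Hypothesis mT : measurable_fun setT T.
Hypothesis T0 : forall x, (0 <= T x)%E.

Definition path_int (z y : 'rV[R]_n) : \bar R :=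
  (\int[lambda]_s ((\1_(`[0, 1]%classic) s)%:E * T (z + s *: (y - z))))%E.

Lemma path_int_ge0 z y : (0 <= path_int z y)%E.
Proof. by apply: integral_ge0 => s _; rewrite mule_ge0. Qed.

Let U := (('rV[R]_n * measurableTypeR R) * 'rV[R]_n)%type.

Let mpt : measurable_fun setT (fun p : U => p.1.1 + p.1.2 *: (p.2 - p.1.1)).
Proof.
apply: measurable_fun_rowP => i; under eq_fun do rewrite !mxE.
have m1 : measurable_fun setT (fun p : U => p.1.1 ord0 i).
  exact: (measurableT_comp (measurable_row_coord i) (measurableT_comp measurable_fst measurable_fst)).
have m2 : measurable_fun setT (fun p : U => p.2 ord0 i).
  exact: (measurableT_comp (measurable_row_coord i) measurable_snd).
apply: measurable_funD => //; apply: measurable_funM.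
  exact: (measurableT_comp measurable_snd measurable_fst).
exact: measurable_funB.
Qed.

Let m01 : measurable_fun setT (fun s : measurableTypeR R => (\1_(`[0, 1]%classic) s)%:E : \bar R).
Proof. by apply/measurable_EFinP; apply: measurable_indic; exact: measurable_itv. Qed.

Lemma measurable_path_int :
  measurable_fun setT (fun p : 'rV[R]_n * 'rV[R]_n => path_int p.1 p.2).
Proof.
pose W := (('rV[R]_n * 'rV[R]_n) * measurableTypeR R)%type.
have mF : measurable_fun setT (fun p : W => ((\1_(`[0, 1]%classic) p.2)%:E * T (p.1.1 + p.2 *: (p.1.2 - p.1.1)))%E).
  apply: emeasurable_funM; first exact: (measurableT_comp m01 measurable_snd).
  have mr : measurable_fun setT (fun p : W => ((p.1.1, p.2), p.1.2) : U).
    apply/measurable_fun_pairP; split.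
      apply/measurable_fun_pairP; split; last exact: measurable_snd.
      exact: (measurableT_comp measurable_fst measurable_fst).
    exact: (measurableT_comp measurable_snd measurable_fst).
  exact: (measurableT_comp mT (measurableT_comp mpt mr)).
apply: (@measurable_fun_fubini_tonelli_F _ _ _ _ R lambda _ mF) => p.
by rewrite mule_ge0.
Qed.

(** For s >= 1/2 the change of variable y |-> z + s (y - z) costs a factor
    s^(-n) <= 2^n. *)
Lemma star_average_half (A K : set 'rV[R]_n) (s : R) : measurable A -> measurable K -> 2^-1 <= s ->
  (\int[mu n]_z \int[mu n]_y ((\1_A z * \1_K y)%:E * T (z + s *: (y - z))) <=
   (2 ^+ n)%:E * mu n A * \int[mu n]_x T x)%E.
Proof.
move=> mA mK s2; have s0 : 0 < s by apply: lt_le_trans s2; rewrite invr_gt0.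
pose c : \bar R := ((2 ^+ n)%:E * \int[mu n]_x T x)%E.
have c0 : (0 <= c)%E by rewrite mule_ge0 ?lee_fin ?exprn_ge0// integral_ge0.
have b z : (\int[mu n]_y ((\1_A z * \1_K y)%:E * T (z + s *: (y - z))) <= (\1_A z)%:E * c)%E.
  have mTs : measurable_fun setT (fun y : 'rV[R]_n => T (s *: y + (1 - s) *: z)).
    exact: measurableT_comp mT (measurable_row_affine _ _).
  have E (y : 'rV[R]_n) : z + s *: (y - z) = s *: y + (1 - s) *: z.
    by rewrite scalerBr scalerBl scale1r [RHS]addrC -addrA [- _ + _]addrC.
  apply: (@le_trans _ _ (\int[mu n]_y ((\1_A z)%:E * T (s *: y + (1 - s) *: z)))%E).
    apply: ge0_le_integral => //.
    - by move=> y _; rewrite mule_ge0// lee_fin mulr_ge0.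
    - apply: emeasurable_funM.
        by apply/measurable_EFinP; apply: measurable_funM => //; exact: measurable_indic.
      by under eq_fun do rewrite E.
    - exact: measurable_funeM.
    - move=> y _; rewrite E; apply: lee_wpmul2r => //; rewrite lee_fin.
      rewrite -[leRHS]mulr1; apply: ler_wpM2l => //.
  rewrite ge0_integralZl//.
  apply: lee_wpmul2l; first by rewrite lee_fin.
  rewrite ge0_integral_lebesgue_row_affine//; apply: lee_wpmul2r; first exact: integral_ge0.
  rewrite lee_fin; apply: lerXn2r; rewrite ?nnegrE ?invr_ge0 ?(ltW s0)//.
  by rewrite -[leRHS]invrK lef_pV2// posrE invr_gt0.
have mG : measurable_fun setT (fun z : 'rV[R]_n =>
    \int[mu n]_y ((\1_A z * \1_K y)%:E * T (z + s *: (y - z))))%E.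
  pose W := ('rV[R]_n * 'rV[R]_n)%type.
  have mF : measurable_fun setT (fun p : W => ((\1_A p.1 * \1_K p.2)%:E * T (p.1 + s *: (p.2 - p.1)))%E).
    apply: emeasurable_funM.
      apply/measurable_EFinP; apply: measurable_funM.
        have mA1 : measurable_fun setT (\1_A : 'rV[R]_n -> R) by exact: measurable_indic.
        exact: (measurableT_comp mA1 measurable_fst).
      have mK1 : measurable_fun setT (\1_K : 'rV[R]_n -> R) by exact: measurable_indic.
      exact: (measurableT_comp mK1 measurable_snd).
    have mr : measurable_fun setT (fun p : W => ((p.1, s), p.2) : U).
      apply/measurable_fun_pairP; split; last exact: measurable_snd.
      apply/measurable_fun_pairP; split; [exact: measurable_fst|exact: measurable_cst].
    exact: (measurableT_comp mT (measurableT_comp mpt mr)).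
  apply: (@measurable_fun_fubini_tonelli_F _ _ _ _ R (mu n) _ mF) => p.
  by rewrite mule_ge0// lee_fin mulr_ge0.
apply: (@le_trans _ _ (\int[mu n]_z ((\1_A z)%:E * c))%E).
  apply: ge0_le_integral => //.
  - by move=> z _; apply: integral_ge0 => y _; rewrite mule_ge0// lee_fin mulr_ge0.
  - apply: emeasurable_funM => //; apply/measurable_EFinP; exact: measurable_indic.
rewrite ge0_integralZr//; first last.
- by apply/measurable_EFinP; exact: measurable_indic.
by rewrite integral_indic// setIT /c muleCA muleA.
Qed.

(** It suffices to bound the integral over A x K at each s. For s < 1/2 exchange
    the roles of z and y, since z + s (y - z) = y + (1 - s) (z - y). *)
Lemma star_average (A K : set 'rV[R]_n) : measurable A -> measurable K ->
  (\int[mu n]_(z in A) \int[mu n]_(y in K) path_int z y <=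
   (2 ^+ n)%:E * (mu n A + mu n K) * \int[mu n]_x T x)%E.
Proof.
move=> mA mK.
pose c : \bar R := ((2 ^+ n)%:E * (mu n A + mu n K) * \int[mu n]_x T x)%E.
have c0 : (0 <= c)%E.
  apply: mule_ge0; last exact: integral_ge0.
  by apply: mule_ge0; rewrite ?lee_fin ?exprn_ge0 ?adde_ge0.
pose F (p : U) : \bar R := ((\1_A p.1.1 * \1_K p.2)%:E * ((\1_(`[0, 1]%classic) p.1.2)%:E * T (p.1.1 + p.1.2 *: (p.2 - p.1.1))))%E.
have F0 p : (0 <= F p)%E by rewrite !mule_ge0// lee_fin mulr_ge0.
have mF : measurable_fun setT F.
  apply: emeasurable_funM.
    apply/measurable_EFinP; apply: measurable_funM.
      have m11 : measurable_fun setT (fun p : U => p.1.1) := measurableT_comp measurable_fst measurable_fst.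
      have mA1 : measurable_fun setT (\1_A : 'rV[R]_n -> R) by exact: measurable_indic.
      exact: (measurableT_comp mA1 m11).
    have mK1 : measurable_fun setT (\1_K : 'rV[R]_n -> R) by exact: measurable_indic.
    exact: (measurableT_comp mK1 measurable_snd).
  apply: emeasurable_funM; last exact: (measurableT_comp mT mpt).
  exact: (measurableT_comp m01 (measurableT_comp measurable_snd measurable_fst)).
have -> : (\int[mu n]_(z in A) \int[mu n]_(y in K) path_int z y =
    \int[mu n]_z \int[mu n]_y \int[lambda]_s F ((z, s), y))%E.
  have E z y : (\int[lambda]_s F ((z, s), y) = (\1_A z * \1_K y)%:E * path_int z y)%E.
    rewrite /F /= ge0_integralZl//; first last.
    - by move=> s _; rewrite mule_ge0.
    - apply: emeasurable_funM => //.
      have mr : measurable_fun setT (fun s : measurableTypeR R => ((z, s), y) : U).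
        apply/measurable_fun_pairP; split; last exact: measurable_cst.
        by apply/measurable_fun_pairP; split; [exact: measurable_cst|exact: measurable_id].
      exact: (measurableT_comp mT (measurableT_comp mpt mr)).
  rewrite integral_mkcond; apply: eq_integral => z _.
  under [RHS]eq_integral do rewrite E.
  rewrite /patch; case: ifP => zA.
    rewrite [LHS]integral_mkcond; apply: eq_integral => y _.
    by rewrite /patch !indicE zA mul1r; case: ifP; rewrite ?mul1e ?mul0e.
  by rewrite integral0_eq// => y _; rewrite indicE zA mul0r mul0e.
have mG : measurable_fun setT (fun p : 'rV[R]_n * measurableTypeR R => \int[mu n]_y F (p, y))%E.
  exact: (@measurable_fun_fubini_tonelli_F _ _ _ _ R (mu n) _ mF).
have -> : (\int[mu n]_z \int[mu n]_y \int[lambda]_s F ((z, s), y) =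
    \int[lambda]_s \int[mu n]_z \int[mu n]_y F ((z, s), y))%E.
  rewrite -(@fubini_tonelli _ _ _ _ R (mu n) lambda (fun p => \int[mu n]_y F (p, y))%E mG); last first.
    by move=> p; exact: integral_ge0.
  apply: eq_integral => z _.
  have mFz : measurable_fun setT (fun p : 'rV[R]_n * measurableTypeR R => F ((z, p.2), p.1)).
    apply: (measurableT_comp mF).
    apply/measurable_fun_pairP; split; last exact: measurable_fst.
    by apply/measurable_fun_pairP; split; [exact: measurable_cst|exact: measurable_snd].
  by rewrite (@fubini_tonelli _ _ _ _ R (mu n) lambda _ mFz).
have bs s : (\int[mu n]_z \int[mu n]_y F ((z, s), y) <= (\1_(`[0, 1]%classic) s)%:E * c)%E.
  have [s01|s01] := boolP (0 <= s <= 1); last first.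
    have z0 : \1_(`[0, 1]%classic) s = 0 :> R.
      by rewrite indic_itv01E (negbTE s01).
    rewrite z0 mul0e integral0_eq// => z _; rewrite integral0_eq// => y _.
    by rewrite /F /= z0 mul0e mule0.
  have z1 : \1_(`[0, 1]%classic) s = 1 :> R.
    by rewrite indic_itv01E s01.
  rewrite z1 mul1e /F /=.
  under eq_integral do under eq_integral do rewrite z1 mul1e.
  have [s2|s2] := leP 2^-1 s.
    apply: le_trans (star_average_half mA mK s2) _; apply: lee_wpmul2r; first exact: integral_ge0.
    by apply: lee_wpmul2l; rewrite ?lee_fin ?exprn_ge0// leeDl.
  have mFs : measurable_fun setT (fun p : 'rV[R]_n * 'rV[R]_n =>
      ((\1_A p.1 * \1_K p.2)%:E * T (p.1 + s *: (p.2 - p.1)))%E).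
    rewrite (_ : (fun p => _) = F \o (fun p : 'rV[R]_n * 'rV[R]_n => ((p.1, s), p.2) : U)); last first.
      by apply/funext => p; rewrite /F /= z1 mul1e.
    apply: (measurableT_comp mF).
    apply/measurable_fun_pairP; split; last exact: measurable_snd.
    by apply/measurable_fun_pairP; split; [exact: measurable_fst|exact: measurable_cst].
  rewrite (@fubini_tonelli _ _ _ _ R (mu n) (mu n) _ mFs); last first.
    by move=> p; rewrite mule_ge0// lee_fin mulr_ge0.
  have s2' : 2^-1 <= 1 - s by move: s2 => /ltW; lra.
  have := star_average_half mK mA s2'.
  under eq_integral do under eq_integral do rewrite mulrC.
  have E (z y : 'rV[R]_n) : y + (1 - s) *: (z - y) = z + s *: (y - z).
    by rewrite scalerBl scale1r addrA subrKC -scalerN opprB.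
  under eq_integral do under eq_integral do rewrite E.
  move=> H; apply: le_trans H _; apply: lee_wpmul2r; first exact: integral_ge0.
  by apply: lee_wpmul2l; rewrite ?lee_fin ?exprn_ge0// leeDr.
apply: (@le_trans _ _ (\int[lambda]_s ((\1_(`[0, 1]%classic) s)%:E * c))%E).
  apply: ge0_le_integral => //.
  - by move=> s _; apply: integral_ge0 => z _; exact: integral_ge0.
  - apply: (@measurable_fun_fubini_tonelli_G _ _ _ _ R (mu n) _ mG) => p; exact: integral_ge0.
  - exact: emeasurable_funM.
rewrite ge0_integralZr// integral_indic// setIT.
by rewrite [X in (X * _)%E](lebesgue_itv01 R) mul1e.
Qed.
End star_average.

Section estimates.
Context {R : realType}.
Local Notation mu := (@lebesgue_row R).
Local Notation lambda := (@lebesgue_measure R).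

(** Cauchy-Schwarz on [0, 1], from 2 a g <= g^2 + a^2. The choice a = 1 shows
    that the integral of g is finite if that of g^2 is; then a is taken to be
    the integral of g. *)
Lemma ge0_integral_itv01_sqr (g : R -> R) : measurable_fun setT g -> (forall s, 0 <= g s) ->
  ((\int[lambda]_s (\1_(`[0, 1]%classic) s * g s)%:E) *
   (\int[lambda]_s (\1_(`[0, 1]%classic) s * g s)%:E) <=
   \int[lambda]_s (\1_(`[0, 1]%classic) s * g s ^+ 2)%:E)%E.
Proof.
move=> mg g0; set I := (\int[lambda]_s (_ * g s)%:E)%E; set J := (\int[lambda]_s _)%E.
pose i01 (s : R) : R := \1_(`[0, 1]%classic) s.
have i0 s : 0 <= i01 s by [].
have mi : measurable_fun setT i01 by apply: measurable_indic; exact: measurable_itv.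
have I0 : (0 <= I)%E by apply: integral_ge0 => s _; rewrite lee_fin mulr_ge0.
have J0 : (0 <= J)%E by apply: integral_ge0 => s _; rewrite lee_fin mulr_ge0// sqr_ge0.
have mI : measurable_fun setT (fun s => (i01 s * g s)%:E).
  by apply/measurable_EFinP; exact: measurable_funM.
have mJ : measurable_fun setT (fun s => (i01 s * g s ^+ 2)%:E).
  by apply/measurable_EFinP; apply: measurable_funM => //; exact: measurable_funX.
have int1 (a : R) : (\int[lambda]_s (i01 s * a)%:E = a%:E)%E.
  transitivity (\int[lambda]_(s in (`[0%R, 1%R]%classic : set R)) (a%:E : \bar R))%E.
    rewrite [RHS]integral_mkcond; apply: eq_integral => s _.
    by rewrite /patch /i01 indicE; case: ifP => _; rewrite ?mul1r ?mul0r.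
  rewrite integral_cst//.
  by rewrite [X in (_ * X)%E](lebesgue_itv01 R) mule1.
have key a : 0 <= a -> ((2 * a)%:E * I <= J + (a ^+ 2)%:E)%E.
  move=> a0; rewrite -(int1 (a ^+ 2)) -ge0_integralD//; first last.
  - by apply/measurable_EFinP; exact: measurable_funM.
  - by move=> s _; rewrite lee_fin mulr_ge0// sqr_ge0.
  - by move=> s _; rewrite lee_fin mulr_ge0// sqr_ge0.
  rewrite -ge0_integralZl//; first last.
  - by rewrite lee_fin mulr_ge0.
  - by move=> s _; rewrite lee_fin mulr_ge0.
  apply: ge0_le_integral => //.
  - by move=> s _; rewrite -EFinM lee_fin mulr_ge0// mulr_ge0.
  - exact: measurable_funeM.
  - by apply: emeasurable_funD => //; apply/measurable_EFinP; exact: measurable_funM.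
  move=> s _; rewrite -EFinM -EFinD lee_fin -mulrDr mulrCA; apply: ler_wpM2l => //.
  by have := sqr_ge0 (g s - a); rewrite !expr2; lra.
have [Joo|Jfin] := eqVneq J +oo%E; first by rewrite Joo leey.
have fJ : J \is a fin_num by rewrite ge0_fin_numE// lt_neqAle Jfin leey.
have fI : I \is a fin_num.
  rewrite ge0_fin_numE//; have := key 1 ler01.
  move: fJ => /fineK <-; rewrite -EFinD => H.
  rewrite ltey; apply/eqP => Ioo; move: H; rewrite Ioo.
  by rewrite gt0_muley// lte_fin mulr_gt0.
have := key (fine I) (fine_ge0 I0).
move: fI fJ => /fineK <- /fineK <- /=; rewrite -!EFinM -EFinD !lee_fin expr2; lra.
Qed.

(** Markov's inequality without division: when f has integral 0, the exceptional
    set is contained in the null set where f does not vanish. *)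
Lemma markov_third d (X : measurableType d) (m : {measure set X -> \bar R})
    (B : set X) (f : X -> \bar R) : measurable B -> (m B < +oo)%E ->
  measurable_fun B f -> (forall x, B x -> 0 <= f x)%E ->
  (3%:E * m (B `&` [set x | 3%:E * \int[m]_(y in B) f y < m B * f x]) <= m B)%E.
Proof.
move=> mB fB mf f0; set q := (\int[m]_(y in B) f y)%E; set S := _ `&` _.
have q0 : (0 <= q)%E by exact: integral_ge0.
have mS : measurable S by apply: measurable_lte => //; exact: measurable_funeM.
have [q00|qn0] := eqVneq q 0%E.
  have := (ae_eq_integral_abs m mB mf).1 _; case.
    by rewrite -[RHS]q00; apply: eq_integral => x /set_mem Bx; rewrite gee0_abs ?f0.
  move=> N [mN N0 sub].
  rewrite (_ : m S = 0%E) ?mule0//; apply: (@subset_measure0 _ _ _ m _ N) => //.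
  move=> x [Bx]; rewrite q00 mule0 => fx; apply: sub => /= /(_ Bx) /= fx0.
  by move: fx => /=; rewrite fx0 mule0 ltxx.
have q1 : (0 < q)%E by rewrite lt_neqAle eq_sym qn0.
have [qoo|qfin] := eqVneq q +oo%E.
  rewrite (_ : S = set0) ?measure0 ?mule0//.
  by apply/seteqP; split => // x [_ /=]; rewrite qoo gt0_muley ?lte_fin// ltNge leey.
have fq : q \is a fin_num by rewrite ge0_fin_numE// lt_neqAle qfin leey.
rewrite -(lee_pmul2l fq q1).
have fBq : m B \is a fin_num by rewrite ge0_fin_numE.
have mfS : measurable_fun S f by apply: measurable_funS mf => // x [].
apply: (@le_trans _ _ (\int[m]_(x in S) (m B * f x))%E).
  rewrite muleA (muleC q) -integral_cst//.
  apply: ge0_le_integral => //.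
  - by move=> x _; rewrite mule_ge0.
  - exact: measurable_funeM.
  - by move=> x [_ /=] /ltW.
rewrite ge0_integralZl//; last by move=> x [/f0].
rewrite muleC; apply: lee_wpmul2r => //.
by apply: ge0_subset_integral => // x [].
Qed.

Lemma ae_shift n (P : 'rV[R]_n -> Prop) (b : 'rV[R]_n) :
  {ae mu n, forall x, P x} -> {ae mu n, forall x, P (x + b)}.
Proof.
move=> [N [mN N0 sub]].
have ms : measurable_fun setT (fun x : 'rV[R]_n => x + b).
  rewrite (_ : (fun x => _) = (fun x : 'rV[R]_n => 1 *: x + b)); first exact: measurable_row_affine.
  by apply/funext => x; rewrite scale1r.
have mNb : measurable ((fun x : 'rV[R]_n => x + b) @^-1` N).
  by rewrite -[X in measurable X]setTI; exact: ms.
exists ((fun x : 'rV[R]_n => x + b) @^-1` N); split => //.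
  have mI : measurable_fun setT (fun x : 'rV[R]_n => (\1_N x)%:E : \bar R).
    by apply/measurable_EFinP; exact: measurable_indic.
  have E := integral_lebesgue_row_shift b mI.
  have E2 : (\int[mu n]_x (\1_N x)%:E = 0)%E by rewrite integral_indic// setIT.
  rewrite -E2 -E.
  have -> : (fun x : 'rV[R]_n => (\1_N (x + b))%:E) = (fun x => (\1_((fun x : 'rV[R]_n => x + b) @^-1` N) x)%:E : \bar R).
    by apply/funext => x; rewrite !indicE; congr ((nat_of_bool _)%:R%:E); apply/idP/idP; rewrite !inE.
  by rewrite integral_indic// setIT.
by move=> x /= nP; exact: sub.
Qed.

End estimates.

(** * Geometry of star-shaped elements *)

Section geometry_facts.
Context {R : realType}.
Local Notation mu := (@lebesgue_row R).

Lemma bounded_sub_cbox n (A : set 'rV[R]_n) a b : A `<=` cbox a b -> bounded_set A.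
Proof.
move=> Aab; have [M [Mr HM]] := bounded_cbox a b.
by exists M; split => // N MN x /Aab; exact: HM.
Qed.

Lemma open_polytopeP d (K : set 'rV[R]_d) : open_polytope K ->
  [/\ open K, bounded_set K & K !=set0].
Proof.
move=> [K0 [m [P [cP KE]]]]; split => //; first by rewrite KE; exact: open_interior.
have /choice[M HM] : forall i, exists M : R, 0 < M /\ P i `<=` obox (const_mx (- M)) (const_mx M).
  by move=> i; have [bP _] := cP i; have [M M0 PM] := bounded_sub_obox bP; exists M.
pose N := \sum_i M i.
have MN i : M i <= N.
  by rewrite /N (bigD1 i)//= lerDl sumr_ge0// => k _; exact: ltW (HM k).1.
apply: (@bounded_sub_cbox _ _ (const_mx (- N)) (const_mx N)) => x.
rewrite KE => /interior_subset[i _ Px] k; have := (HM i).2 x Px k.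
by have := MN i; rewrite !mxE => h /andP[h1 h2]; apply/andP; split; lra.
Qed.

Lemma coord_le_enorm n (x : 'rV[R]_n) i : `|x ord0 i| <= enorm x.
Proof.
rewrite -sqrtr_sqr /enorm ler_wsqrtr// (bigD1 i)//= lerDl sumr_ge0// => k _.
exact: sqr_ge0.
Qed.

Lemma enorm_le n (x : 'rV[R]_n) (r : R) : 0 <= r -> (forall i, `|x ord0 i| <= r) ->
  enorm x <= n%:R * r.
Proof.
move=> r0 H; rewrite -[leRHS]ger0_norm ?mulr_ge0// -sqrtr_sqr /enorm ler_wsqrtr//.
apply: (@le_trans _ _ (\sum_(i < n) r ^+ 2)).
  apply: ler_sum => i _; rewrite -real_normK ?num_real//.
  by rewrite ler_pXn2r// nnegrE.
rewrite sumr_const card_ord exprMn -[leLHS]mulr_natl ler_wpM2r ?sqr_ge0//.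
by rewrite -natrX ler_nat; case: (n) => // k; rewrite expnS expn1 leq_pmulr.
Qed.

Lemma le_diam n (A : set 'rV[R]_n) x y : bounded_set A -> A x -> A y ->
  enorm (x - y) <= diam A.
Proof.
move=> bA Ax Ay; apply: ub_le_sup; last by exists x, y.
have [M M0 AM] := bounded_sub_obox bA.
exists (n%:R * (2 * M)) => _ [u [v [Au Av ->]]]; apply: enorm_le.
  by rewrite mulr_ge0// ltW.
move=> i; have := AM u Au i; have := AM v Av i; rewrite !mxE => /andP[? ?] /andP[? ?].
by rewrite ler_norml; apply/andP; split; lra.
Qed.

Lemma diam_gt0 n (A : set 'rV[R]_n) : (0 < n)%N -> open A -> bounded_set A -> A !=set0 ->
  0 < diam A.
Proof.
move=> n0 oA bA [x Ax]; have [e e0 eA] := row_nbhs_ball oA Ax.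
pose i := Ordinal n0; pose y := x + (e / 2) *: delta_mx ord0 i.
have yi k : (x - y) ord0 k = - (e / 2 * (k == i)%:R).
  by rewrite /y !mxE eqxx /=; lra.
have Ay : A y.
  apply: eA; apply: (@le_lt_trans _ _ (e / 2)); last lra.
  apply: row_norm_le; first lra.
  move=> k; rewrite yi normrN; case: (k == i); rewrite ?mulr1 ?mulr0 ?normr0 ?ger0_norm//; lra.
apply: lt_le_trans (le_diam bA Ax Ay).
apply: lt_le_trans (coord_le_enorm _ i).
by rewrite yi normrN eqxx mulr1 gtr0_norm; lra.
Qed.

Lemma eball_open n (c : 'rV[R]_n) r : open (eball c r).
Proof.
pose q (x : 'rV[R]_n) := enorm (x - c).
have cq : continuous q.
  move=> x; apply: (@continuous_comp _ _ _ (fun x : 'rV[R]_n => \sum_i (x - c) ord0 i ^+ 2) Num.sqrt).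
    have H (i : 'I_n) : continuous (fun x : 'rV[R]_n => (x - c) ord0 i ^+ 2).
      move=> y; rewrite (_ : (fun x : 'rV[R]_n => _) =
          (fun t : R => (t - c ord0 i) ^+ 2) \o (fun x : 'rV[R]_n => x ord0 i)); last first.
        by apply/funext => z; rewrite /= !mxE.
      apply: continuous_comp; first exact: coord_continuous.
      apply: (@continuous_comp _ _ _ (fun t : R => t - c ord0 i) (fun t : R => t ^+ 2)).
        by apply: cvgB; [exact: cvg_id|exact: cvg_cst].
      exact: exprn_continuous.
    have := @continuous_row_sum R n n (fun i x => (x - c) ord0 i ^+ 2) (fun=> 1).
    under eq_fun do under eq_bigr do rewrite mul1r.
    by move=> /(_ H); exact.
  exact: sqrt_continuous.
rewrite (_ : eball c r = q @^-1` [set x | x < r])//.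
by apply: open_comp => // ; exact: open_lt.
Qed.

(** The ball contains the cube of half-side rho h / (2 n) about c, and K lies in
    the cube of half-side 2 h about c because c is in K. *)
Lemma eball_ratio n (K : set 'rV[R]_n) c (rho : R) : (0 < n)%N -> open K -> bounded_set K ->
  0 < rho -> 0 < diam K -> eball c (rho * diam K) `<=` K ->
  (0 < mu n (eball c (rho * diam K)))%E /\
  (mu n K <= ((4 * n%:R / rho) ^+ n)%:E * mu n (eball c (rho * diam K)))%E.
Proof.
move=> n0 oK bK rho0; set h := diam K => h0 BK.
have rh0 : 0 < rho * h by exact: mulr_gt0.
have nR : 0 < n%:R :> R by rewrite ltr0n.
pose del := rho * h / n%:R / 2.
have del0 : 0 < del by rewrite !divr_gt0.
have Kc : K c.
  apply: BK; rewrite /eball /= subrr /enorm big1 ?sqrtr0// => i _.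
  by rewrite mxE expr0n.
have obB : obox (c - const_mx del) (c + const_mx del) `<=` eball c (rho * h).
  move=> x Hx; rewrite /eball /=; apply: (@le_lt_trans _ _ (n%:R * del)).
    apply: enorm_le; first exact: ltW.
    move=> i; have := Hx i; rewrite !mxE => /andP[h1 h2].
    by rewrite ler_norml; apply/andP; split; lra.
  rewrite /del (_ : _ * _ = rho * h / 2); last by field; rewrite gt_eqF.
  lra.
have Kob : K `<=` obox (c - const_mx (2 * h)) (c + const_mx (2 * h)).
  move=> x Kx i; have := le_trans (coord_le_enorm (x - c) i) (le_diam bK Kx Kc).
  rewrite -/h !mxE ler_norml => /andP[? ?]; apply/andP; split; lra.
have mB : measurable (eball c (rho * h)) by apply: open_row_measurable; exact: eball_open.
have muob (r : R) : 0 < r -> mu n (obox (c - const_mx r) (c + const_mx r)) = ((2 * r) ^+ n)%:E.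
  move=> r0; rewrite lebesgue_row_obox; last by move=> i; rewrite !mxE; lra.
  congr (_%:E); rewrite (eq_bigr (fun=> 2 * r)); first by rewrite prodr_const card_ord.
  by move=> i _; rewrite !mxE; lra.
have B1 : (((2 * del) ^+ n)%:E <= mu n (eball c (rho * h)))%E.
  by rewrite -muob//; apply: le_measure => //; rewrite inE//; exact: measurable_obox.
split.
  by apply: lt_le_trans B1; rewrite lte_fin exprn_gt0// mulr_gt0.
apply: (@le_trans _ _ ((2 * (2 * h)) ^+ n)%:E).
  rewrite -muob ?mulr_gt0//; apply: le_measure => //; rewrite inE.
    exact: open_row_measurable.
  exact: measurable_obox.
apply: (@le_trans _ _ (((4 * n%:R / rho) ^+ n)%:E * ((2 * del) ^+ n)%:E)%E).
  rewrite -EFinM lee_fin -exprMn (_ : 4 * n%:R / rho * (2 * del) = 2 * (2 * h))//.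
  by rewrite /del; field; rewrite !gt_eqF.
by apply: lee_wpmul2l => //; rewrite lee_fin exprn_ge0// divr_ge0 ?mulr_ge0// ltW.
Qed.

Section cyl.
Variables (d : nat) (Kx : set 'rV[R]_d) (a b : R).
Hypothesis oK : open Kx.
Hypothesis bK : bounded_set Kx.
Hypothesis nK : Kx !=set0.
Hypothesis ab : a < b.
Local Notation K := (cylinder Kx (time_interval a b)).

Lemma cylinder_open : open K.
Proof.
rewrite openE => z [/= Kz Iz]; have [e e0 eK] := row_nbhs_ball oK Kz.
have [f f0 fI] : exists2 f : R, 0 < f & forall s : R, `|rsubmx z ord0 ord0 - s| < f -> a < s < b.
  move: Iz; rewrite /time_interval /= => /andP[az zb].
  exists (Num.min (rsubmx z ord0 ord0 - a) (b - rsubmx z ord0 ord0)).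
    by rewrite lt_min !subr_gt0 az.
  by move=> s; rewrite lt_min !ltr_norml => /andP[/andP[? ?] /andP[? ?]]; apply/andP; split; lra.
apply/nbhs_ballP; exists (Num.min e f); first by rewrite /= lt_min e0.
move=> y; rewrite mx_norm_ball /ball_ /= lt_min => /andP[ye yf]; split.
  apply: eK; apply: le_lt_trans ye; apply: row_norm_le => // i.
  by have := row_coord_le_norm (z - y) (lshift 1 i); rewrite !mxE.
rewrite /time_interval /=; apply: fI; apply: le_lt_trans yf.
by have := row_coord_le_norm (z - y) (rshift d ord0); rewrite !mxE.
Qed.

Lemma cylinder_bounded : bounded_set K.
Proof.
have [M M0 KM] := bounded_sub_obox bK.
pose N := M + `|a| + `|b|.
apply: (@bounded_sub_cbox _ _ (const_mx (- N)) (const_mx N)) => z [Kz Iz] i.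
rewrite !mxE; have [k ->|k ->] := split_ordP i.
  have := KM _ Kz k; rewrite !mxE /N => /andP[? ?].
  by have := normr_ge0 a; have := normr_ge0 b => ? ?; apply/andP; split; lra.
move: Iz; rewrite /time_interval /= mxE (ord1 k) => /andP[? ?].
have := ler_norm (- a); have := ler_norm b; rewrite normrN /N.
have := normr_ge0 a; have := normr_ge0 b => ? ? ? ?; apply/andP; split; lra.
Qed.

Lemma cylinder_nonempty : K !=set0.
Proof.
have [x Kx0] := nK; exists (row_mx x (const_mx ((a + b) / 2))).
rewrite /cylinder /= row_mxKl row_mxKr; split=> //; rewrite /time_interval /= mxE.
by move: ab => h; apply/andP; split; lra.
Qed.

End cyl.
End geometry_facts.

(** * Iterated integration along a segment *)

Section line_bound.
Context {R : realType}.
Local Notation lambda := (@lebesgue_measure R).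
Variable n : nat.

Lemma segment_ftc_lin (f f' : 'rV[R]_n -> R) (g g' : 'I_n -> 'rV[R]_n -> R) (c : R) z e t :
  segment_ftc f g z e t -> segment_ftc f' g' z e t ->
  segment_ftc (fun x => f x + c * f' x) (fun i x => g i x + c * g' i x) z e t.
Proof.
move=> [i1 e1] [i2 e2].
pose F1 s := (\1_(`[0, t]%classic) s * \sum_i e ord0 i * g i (z + s *: e))%:E.
pose F2 s := (\1_(`[0, t]%classic) s * \sum_i e ord0 i * g' i (z + s *: e))%:E.
have E : (fun s : R => (\1_(`[0, t]%classic) s *
    \sum_i e ord0 i * (g i (z + s *: e) + c * g' i (z + s *: e)))%:E) =
    (fun s => F1 s + c%:E * F2 s)%E.
  apply/funext => s; rewrite /F1 /F2 -EFinM -EFinD; congr (_%:E).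
  rewrite [X in _ = _ + X]mulrCA -mulrDr; congr (_ * _).
  rewrite [X in _ = _ + X]mulr_sumr -big_split/=.
  by apply: eq_bigr => i _; rewrite mulrDr; congr (_ + _); ring.
have ci2 : lambda.-integrable setT (fun s => c%:E * F2 s)%E by exact: integrableZl.
split; first by rewrite E; exact: integrableD.
rewrite E integralD// integralZl// -e1 -e2 -EFinM -EFinD; congr (_%:E); ring.
Qed.

Variables (u : ('I_n -> nat) -> 'rV[R]_n -> R) (z e : 'rV[R]_n) (H : R).
Hypothesis H0 : 0 < H.
Hypothesis eH : \sum_i `|e ord0 i| <= H.

(** The factor H is positive because g may be infinite, as the bound of a
    previous step can be. *)
Lemma line_step_bound (g : R -> \bar R) j t : 0 <= t <= 1 ->
  segment_ftc (u j) (fun i => u (mi_add j i)) z e t -> u j z = 0 ->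
  measurable_fun setT g -> (forall s, 0 <= g s)%E ->
  {ae lambda, forall s : R, 0 <= s <= 1 -> forall i, (`|u (mi_add j i) (z + s *: e)|%:E <= g s)%E} ->
  (`|u j (z + t *: e)|%:E <= H%:E * \int[lambda]_s ((\1_(`[0, 1]%classic) s)%:E * g s))%E.
Proof.
move=> /andP[t0 t1] [iF EF] uz mg g0 ug.
have mi : measurable_fun setT (fun s : R => (\1_(`[0, 1]%classic) s)%:E : \bar R).
  by apply/measurable_EFinP; apply: measurable_indic; exact: measurable_itv.
have mig : measurable_fun setT (fun s : R => (\1_(`[0, 1]%classic) s)%:E * g s)%E.
  exact: emeasurable_funM.
have ig0 (s : R) : (0 <= (\1_(`[0, 1]%classic) s)%:E * g s)%E by rewrite mule_ge0.
have -> : `|u j (z + t *: e)|%:E = `|(u j (z + t *: e) - u j z)%:E|%E by rewrite uz subr0.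
rewrite EF; apply: le_trans (le_abse_integral _ _ _) _ => //.
  exact: measurable_int iF.
rewrite -ge0_integralZl//; last by rewrite lee_fin ltW.
apply: ae_ge0_le_integral => //.
- by apply: measurableT_comp => //; exact: measurable_int iF.
- by move=> s _; rewrite mule_ge0// lee_fin ltW.
- exact: measurable_funeM.
case: ug => N [mN N0 sub]; exists N; split => //.
apply: subset_trans sub; apply: subsetC => s us _.
have [st|st] := boolP (0 <= s <= t); last first.
  rewrite (_ : \1_(`[0, t]%classic) s = 0 :> R); last first.
    by rewrite indicE memNset// => /=; rewrite in_itv; exact/negP.
  by rewrite mul0r abse0 mule_ge0// lee_fin ltW.
have /andP[s0 s1'] := st; have s1 : s <= 1 by exact: le_trans s1' t1.
have {}us := us (introT andP (conj s0 s1)).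
rewrite (_ : \1_(`[0, t]%classic) s = 1 :> R); last first.
  by rewrite indicE mem_set// /=; rewrite in_itv.
rewrite indic_itv01E s0 s1 mul1e mul1r abse_EFin.
have [goo|gfin] := eqVneq (g s) +oo%E.
  by rewrite goo gt0_muley ?leey// lte_fin.
have gf : g s \is a fin_num by rewrite ge0_fin_numE// lt_neqAle gfin leey.
move: us gf (g0 s); case: (g s) => // r us _; rewrite lee_fin => r0.
rewrite -EFinM lee_fin; apply: le_trans (ler_norm_sum _ _ _) _.
apply: (@le_trans _ _ (\sum_i `|e ord0 i| * r)).
  apply: ler_sum => i _; rewrite normrM ler_wpM2l//.
  by have := us i; rewrite lee_fin.
by rewrite -mulr_suml ler_wpM2r.
Qed.

Variables (p : nat) (G : R -> \bar R) (T : set R).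
Hypothesis mG : measurable_fun setT G.
Hypothesis G0 : forall s, (0 <= G s)%E.
Hypothesis aeT : {ae lambda, forall s : R, 0 <= s <= 1 -> T s}.
Hypothesis okT : forall j t, (mi_order j <= p)%N -> 0 <= t <= 1 -> T t ->
  segment_ftc (u j) (fun i => u (mi_add j i)) z e t.
Hypothesis uz : forall j, (mi_order j <= p)%N -> u j z = 0.
Hypothesis uG : forall j s, mi_order j = p.+1 -> 0 <= s <= 1 ->
  (`|u j (z + s *: e)|%:E <= G s)%E.

(** T is the set of end points for which the fundamental theorem of calculus
    holds. The induction uses it at t and, under the integral sign, at almost
    every s. *)
Lemma line_bound k j t : (mi_order j + k = p)%N -> 0 <= t <= 1 -> T t ->
  (`|u j (z + t *: e)|%:E <=
   (H ^+ k.+1)%:E * \int[lambda]_s ((\1_(`[0, 1]%classic) s)%:E * G s))%E.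
Proof.
set q := (\int[_]_s _)%E.
have q0 : (0 <= q)%E by apply: integral_ge0 => s _; rewrite mule_ge0.
elim: k j t => [|k IH] j t jk t01 Tt.
  have jp : (mi_order j <= p)%N by rewrite -jk leq_addr.
  rewrite expr1; apply: line_step_bound => //; first exact: okT.
  - exact: uz.
  - by apply: aeW => s s01 i; apply: uG => //; rewrite mi_order_add -jk addn0.
have jp : (mi_order j <= p)%N by rewrite -jk leq_addr.
(* the bound of the previous order is constant in s, and integrates to itself *)
pose c : \bar R := ((H ^+ k.+1)%:E * q)%E.
have c0 : (0 <= c)%E by rewrite mule_ge0// lee_fin exprn_ge0// ltW.
apply: le_trans (@line_step_bound (fun=> c) j t t01 (okT jp t01 Tt) (uz jp) _ _ _) _ => //.
  case: aeT => N [mN N0 sub]; exists N; split => //.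
  apply: subset_trans sub; apply: subsetC => s Ts s01 i; apply: IH => //; last exact: Ts.
  by rewrite mi_order_add addSnnS.
have -> : (\int[lambda]_s ((\1_(`[0, 1]%classic) s)%:E * c) = c)%E.
  rewrite ge0_integralZr// ; first last.
    by apply/measurable_EFinP; apply: measurable_indic; exact: measurable_itv.
  by rewrite integral_indic// setIT [X in (X * _)%E](lebesgue_itv01 R) mul1e.
by rewrite /c muleA -EFinM -exprS.
Qed.

End line_bound.

(** * Remainders that vanish to high order at a point *)

Section ae_combine.
Context d (T : measurableType d) (R : realType) (m : {measure set T -> \bar R}).

Lemma ae_imp (P Q : T -> Prop) : (forall x, P x -> Q x) ->
  {ae m, forall x, P x} -> {ae m, forall x, Q x}.
Proof. by move=> PQ; apply: filterS. Qed.

Lemma ae_forall_fin (I : finType) (P : I -> T -> Prop) :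
  (forall i, {ae m, forall x, P i x}) -> {ae m, forall x, forall i, P i x}.
Proof. exact: filter_forall. Qed.

End ae_combine.

Section segment_ftc_family.
Context {R : realType}.
Local Notation mu := (@lebesgue_row R).
Local Notation lambda := (@lebesgue_measure R).
Local Notation normc := (@ComplexField.Normc.normc R).

Lemma mi_of_ffun_exists n m (j : 'I_n -> nat) : (mi_order j <= m)%N ->
  exists f : {ffun 'I_n -> 'I_m.+1}, mi_of_ffun f = j.
Proof.
move=> jm; have H i : (j i < m.+1)%N.
  by rewrite ltnS (leq_trans _ jm)// /mi_order (bigD1 i)//= leq_addr.
by exists [ffun i => Ordinal (H i)]; apply/funext => i; rewrite /mi_of_ffun ffunE.
Qed.

Variables (n p : nat) (K B : set 'rV[R]_n).
Hypothesis oK : open K.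
Hypothesis bK : bounded_set K.
Hypothesis oB : open B.
Hypothesis starK : star_shaped K B.
Variables (I : finType) (F : I -> 'rV[R]_n -> R[i]) (D : I -> ('I_n -> nat) -> 'rV[R]_n -> R[i]).
Hypothesis FL2 : forall i, in_L2 K (F i).
Hypothesis FD : forall i j, (mi_order j <= p.+1)%N -> is_wderiv K j (F i) (D i j).

Definition family_segment_ftc (z e : 'rV[R]_n) (t : R) := forall i b j, (mi_order j <= p)%N ->
  segment_ftc (part b \o ext0 K (D i j)) (fun k => part b \o ext0 K (D i (mi_add j k))) z e t.

(** Finitely many i, b and j are concerned, so their null sets can be united. *)
Lemma ae_family_segment_ftc (m : {sigma_finite_measure set (measurableTypeR R) -> \bar R}) :
  {ae mu n, forall z, B z -> {ae mu n, forall e, K (z + e) ->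
     {ae m, forall t : R, 0 <= t <= 1 -> family_segment_ftc z e t}}}.
Proof.
pose J := (I * bool * {ffun 'I_n -> 'I_p.+1})%type.
pose ok (q : J) z e t := (mi_order (mi_of_ffun q.2) <= p)%N ->
  segment_ftc (part q.1.2 \o ext0 K (D q.1.1 (mi_of_ffun q.2)))
   (fun k => part q.1.2 \o ext0 K (D q.1.1 (mi_add (mi_of_ffun q.2) k))) z e t.
have H (q : J) : {ae mu n, forall z, B z -> {ae mu n, forall e, K (z + e) ->
     {ae m, forall t : R, 0 <= t <= 1 -> ok q z e t}}}.
  have [jp|jp] := boolP (mi_order (mi_of_ffun q.2) <= p)%N; last first.
    by apply: aeW => z _; apply: aeW => e _; apply: aeW => t _; rewrite /ok (negbTE jp).
  have W1 := FD q.1.1 (leq_trans jp (leqnSn p)).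
  have W2 k : is_wderiv K (mi_add (mi_of_ffun q.2) k) (F q.1.1) (D q.1.1 (mi_add (mi_of_ffun q.2) k)).
    by apply: FD; rewrite mi_order_add.
  have fi : (mu n).-integrable setT (EFin \o (part q.1.2 \o ext0 K (D q.1.1 (mi_of_ffun q.2)))).
    by apply: ext0_integrable_part => //; case: W1.
  have gi k : (mu n).-integrable setT (EFin \o (part q.1.2 \o ext0 K (D q.1.1 (mi_add (mi_of_ffun q.2) k)))).
    by apply: ext0_integrable_part => //; case: (W2 k).
  have fg k v : test_function K v -> _ := fun tv => ext0_step oK bK q.1.2 (FL2 q.1.1) W1 (W2 k) tv.
  have := ae_segment_ftc fi gi fg oK oB starK m.
  apply: filterS => z Hz Bz; apply: filterS (Hz Bz) => e He Ke.
  by apply: ae_imp (He Ke) => t Ht t01 _; exact: Ht.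
have {}H := ae_forall_fin H.
apply: filterS H => z Hz Bz.
have {}Hz := ae_forall_fin (fun q => Hz q Bz).
apply: filterS Hz => e He Ke.
have {}He := ae_forall_fin (fun q => He q Ke).
apply: ae_imp He => t Ht t01 i b j jp.
have [f fj] := mi_of_ffun_exists jp.
by have := Ht ((i, b), f) t01; rewrite /ok /= fj; apply.
Qed.

Variable cf : I -> R[i].
Definition comb (j : 'I_n -> nat) (x : 'rV[R]_n) : R[i] := \sum_i cf i * D i j x.

(** A component of a complex combination is a real combination of both
    components of its terms. *)
Lemma segment_ftc_comb z e t b j : family_segment_ftc z e t -> (mi_order j <= p)%N ->
  segment_ftc (part b \o ext0 K (comb j)) (fun k => part b \o ext0 K (comb (mi_add j k))) z e t.
Proof.
move=> ok jp.
have E j' : part b \o ext0 K (comb j') = (fun x => \sum_(i <- index_enum I)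
    (part true (cf i) * (part b \o ext0 K (D i j')) x) +
    1 * \sum_(i <- index_enum I) (im_sign b * part false (cf i) * (part (~~ b) \o ext0 K (D i j')) x)).
  apply/funext => x; rewrite mul1r -big_split/= /ext0; case: ifP => xK.
    by rewrite /comb part_sum; apply: eq_bigr => i _; rewrite partM.
  by rewrite part0 big1// => i _; rewrite !part0 !mulr0 addr0.
have S (c : I -> R) b' : segment_ftc (fun x => \sum_(i <- index_enum I) (c i * (part b' \o ext0 K (D i j)) x))
    (fun k x => \sum_(i <- index_enum I) (c i * (part b' \o ext0 K (D i (mi_add j k))) x)) z e t.
  elim: (index_enum I) => [|i s IH].
    rewrite /segment_ftc !big_nil subrr.
    have -> : (fun s : R => (\1_(`[0, t]%classic) s * \sum_i e ord0 i *
        \sum_(i0 <- [::]) c i0 * (part b' \o ext0 K (D i0 (mi_add j i))) (z + s *: e))%:E) = cst 0%E.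
      by apply/funext => s; rewrite big1 ?mulr0// => k _; rewrite big_nil mulr0.
    by split; [exact: integrable0|rewrite integral0].
  have := segment_ftc_lin (c i) IH (ok i b' j jp).
  congr segment_ftc; [apply/funext => x|apply/funext => k; apply/funext => x];
    by rewrite big_cons addrC.
have := segment_ftc_lin 1 (S (fun i => part true (cf i)) b)
  (S (fun i => im_sign b * part false (cf i)) (~~ b)).
by rewrite E; congr segment_ftc; apply/funext => k; rewrite E.
Qed.

Variables (h : R) (Psi : 'rV[R]_n -> R) (cA : R) (z : 'rV[R]_n).
Hypothesis n0 : (0 < n)%N.
Hypothesis h0 : 0 < h.
Hypothesis hK : forall x y i, K x -> K y -> `|(x - y) ord0 i| <= h.
Hypothesis mPsi : measurable_fun setT Psi.
Hypothesis Psi0 : forall x, 0 <= Psi x.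
Hypothesis cA0 : 0 <= cA.
Hypothesis Bz : B z.
Hypothesis Kz : K z.
Hypothesis comb0 : forall j, (mi_order j <= p)%N -> comb j z = 0.
Hypothesis combP : forall j x, mi_order j = p.+1 -> K x -> normc (comb j x) <= Psi x + cA.
Hypothesis ok1 : {ae mu n, forall e, K (z + e) ->
  {ae (@dirac _ _ (1 : measurableTypeR R) R), forall t : R, 0 <= t <= 1 -> family_segment_ftc z e t}}.
Hypothesis okL : {ae mu n, forall e, K (z + e) ->
  {ae lambda, forall t : R, 0 <= t <= 1 -> family_segment_ftc z e t}}.
Hypothesis mcomb : forall j, (mi_order j <= p)%N -> measurable_parts K (comb j).

Let Psi2 x : \bar R := (Psi x ^+ 2)%:E.

Let mK : measurable K.
Proof. exact: open_row_measurable. Qed.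

(** [line_bound] applies to both components along the segment from z to y, and
    Cauchy-Schwarz moves the square under the integral. *)
Lemma comb_pointwise j : (mi_order j <= p)%N ->
  {ae mu n, forall y, K y -> ((normc (comb j y) ^+ 2)%:E <=
     (4 * (n%:R * h) ^+ (2 * (p.+1 - mi_order j)))%:E * (path_int Psi2 z y + (cA ^+ 2)%:E))%E}.
Proof.
move=> jp; pose k := (p - mi_order j)%N.
have jk : (mi_order j + k = p)%N by rewrite /k subnKC.
pose H := n%:R * h; have H0 : 0 < H by rewrite mulr_gt0// ltr0n.
have ok : {ae mu n, forall e, K (z + e) ->
  {ae (@dirac _ _ (1 : measurableTypeR R) R), forall t : R, 0 <= t <= 1 -> family_segment_ftc z e t} /\
  {ae lambda, forall t : R, 0 <= t <= 1 -> family_segment_ftc z e t}}.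
  by apply: filterS2 ok1 okL => e h1 h2 Ke; split; [exact: h1|exact: h2].
have := ae_shift (- z) ok; apply: filterS => y; rewrite addrCA subrr addr0 => Hy Ky.
have {Hy}[ok1' okL'] := Hy Ky.
set e := y - z in ok1' okL' *.
have ye : y = z + 1 *: e by rewrite scale1r /e addrC subrK.
pose T : set R := [set t | family_segment_ftc z e t].
have T1 : T 1.
  have [N [mN N0 sub]] := ok1'; apply: contrapT => nT.
  (* 1 carries the Dirac mass, so it lies outside every null set *)
  have N1 : N 1 by apply: sub => /= /(_ _)/nT; apply; rewrite ler01 lexx.
  by move: N0; rewrite diracE mem_set// => /eqP; rewrite onee_eq0.
have eH : \sum_i `|e ord0 i| <= H.
  apply: (@le_trans _ _ (\sum_(i < n) h)); first by apply: ler_sum => i _; exact: hK.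
  by rewrite sumr_const card_ord /H mulr_natl.
pose G s := (Psi (z + s *: e) + cA)%:E.
have mPe : measurable_fun setT (fun s : R => Psi (z + s *: e)).
  apply: measurableT_comp => //; apply: measurable_fun_rowP => i; under eq_fun do rewrite !mxE.
  by apply: measurable_funD => //; exact: measurable_funM.
have mG : measurable_fun setT G by apply/measurable_EFinP; exact: measurable_funD.
have G0 s : (0 <= G s)%E by rewrite lee_fin addr_ge0.
have Kl s : 0 <= s <= 1 -> K (z + s *: e).
  move=> /andP[s0 s1]; have -> : z + s *: e = (1 - (1 - s)) *: y + (1 - s) *: z.
    by rewrite subKr /e scalerBr scalerBl scale1r [RHS]addrC -addrA [- _ + _]addrC.
  by apply: starK => //; rewrite subr_ge0 s1/= lerBlDr lerDl.
pose q := (\int[lambda]_s (\1_(`[0, 1]%classic) s * (Psi (z + s *: e) + cA))%:E)%E.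
have bnd b : (`|part b (comb j y)|%:E <= (H ^+ k.+1)%:E * q)%E.
  have extE j' x : K x -> ext0 K (comb j') x = comb j' x by move=> Kx; rewrite /ext0 mem_set.
  have -> : part b (comb j y) = (part b \o ext0 K (comb j)) (z + 1 *: e) by rewrite -ye /= extE.
  have -> : q = (\int[lambda]_s ((\1_(`[0, 1]%classic) s)%:E * G s))%E.
    by apply: eq_integral => s _; rewrite -EFinM.
  apply: (@line_bound R n (fun j => part b \o ext0 K (comb j)) z e H H0 eH p G T mG G0 okL' _ _ _ k j 1 jk _ T1).
  - by move=> j' t j'p _ ok'; exact: segment_ftc_comb.
  - by move=> j' j'p; rewrite /= extE// comb0// part0.
  - move=> j' s j's s01; rewrite /= extE; last exact: Kl.
    rewrite lee_fin; apply: le_trans (part_le _ _) _; apply: combP => //; exact: Kl.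
  - by rewrite ler01 lexx.
have q0 : (0 <= q)%E.
  by apply: integral_ge0 => s _; rewrite lee_fin mulr_ge0// addr_ge0.
have CS : (q * q <= 2%:E * (path_int Psi2 z y + (cA ^+ 2)%:E))%E.
  apply: le_trans (ge0_integral_itv01_sqr _ _) _.
  - exact: measurable_funD.
  - by move=> s; rewrite addr_ge0.
  pose i01 (s : R) : R := \1_(`[0, 1]%classic) s.
  have mi : measurable_fun setT i01 by apply: measurable_indic; exact: measurable_itv.
  have -> : ((cA ^+ 2)%:E = \int[lambda]_s ((i01 s)%:E * (cA ^+ 2)%:E))%E.
    have mi1 : measurable_fun setT (fun s : measurableTypeR R => (i01 s)%:E : \bar R).
      by apply/measurable_EFinP.
    rewrite ge0_integralZr// ?lee_fin ?sqr_ge0//.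
      by rewrite integral_indic// setIT [X in (X * _)%E](lebesgue_itv01 R) mul1e.
    by move=> x _; rewrite lee_fin.
  have mP2 : measurable_fun setT (fun s : R => (i01 s)%:E * Psi2 (z + s *: (y - z)))%E.
    apply: emeasurable_funM; first exact/measurable_EFinP.
    by apply/measurable_EFinP; exact: measurable_funX.
  rewrite /path_int -ge0_integralD//; first last.
  - by apply: emeasurable_funM => //; exact/measurable_EFinP.
  - by move=> s _; rewrite -EFinM lee_fin mulr_ge0// sqr_ge0.
  - by move=> s _; rewrite -EFinM lee_fin mulr_ge0// sqr_ge0.
  rewrite -ge0_integralZl//; first last.
  - by move=> s _; rewrite -!EFinM -EFinD lee_fin addr_ge0// mulr_ge0// sqr_ge0.
  - apply: emeasurable_funD => //.
    by apply: emeasurable_funM => //; exact/measurable_EFinP.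
  apply: ge0_le_integral => //.
  - by move=> s _; rewrite lee_fin mulr_ge0// sqr_ge0.
  - apply/measurable_EFinP; apply: measurable_funM => //; apply: measurable_funX.
    exact: measurable_funD.
  - apply: measurable_funeM; apply: emeasurable_funD => //.
    by apply: emeasurable_funM => //; exact/measurable_EFinP.
  move=> s _; rewrite /Psi2 -/e -/(i01 s).
  rewrite (_ : (2%:E * _ = (2 * (i01 s * Psi (z + s *: e) ^+ 2 + i01 s * cA ^+ 2))%:E)%E); last first.
    by rewrite [RHS]EFinM EFinD !EFinM.
  rewrite lee_fin -mulrDr [leRHS]mulrCA; apply: ler_wpM2l => //.
  by have := sqr_ge0 (Psi (z + s *: e) - cA); rewrite !expr2; move: (Psi _) => P; lra.
have hb : ((normc (comb j y) ^+ 2)%:E <= (2 * H ^+ (2 * k.+1))%:E * (q * q))%E.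
  rewrite normc_sqr; have := bnd true; have := bnd false.
  have Hk : 0 < H ^+ k.+1 by exact: exprn_gt0.
  have Hkk : H ^+ (2 * k.+1) = H ^+ k.+1 ^+ 2 by rewrite mulnC exprM.
  move: q0; case: (q) => [r| |] //.
    rewrite lee_fin => r0; rewrite -!EFinM !lee_fin Hkk => b1 b2.
    have sq b : part b (comb j y) ^+ 2 = `|part b (comb j y)| ^+ 2.
      by rewrite real_normK ?num_real.
    rewrite !sq (_ : 2 * _ ^+ 2 * _ = (H ^+ k.+1 * r) ^+ 2 + (H ^+ k.+1 * r) ^+ 2).
      by apply: lerD; rewrite ler_pXn2r ?nnegrE// mulr_ge0// ltW.
    by rewrite !expr2; ring.
  by move=> _ _ _; rewrite mulyy gt0_muley ?leey// lte_fin mulr_gt0// Hkk exprn_gt0.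
apply: le_trans hb _; rewrite subSn// -/k.
have -> : ((4 * H ^+ (2 * k.+1))%:E = (2 * H ^+ (2 * k.+1))%:E * 2%:E)%E.
  by rewrite -EFinM; congr (_%:E); ring.
rewrite -muleA; apply: lee_wpmul2l => //.
by rewrite lee_fin mulr_ge0// exprn_ge0// ltW.
Qed.

Lemma comb_sqL2_bound j : (mi_order j <= p)%N ->
  (sqL2 K (comb j) <= (4 * (n%:R * h) ^+ (2 * (p.+1 - mi_order j)))%:E *
    (\int[mu n]_(y in K) path_int Psi2 z y + (cA ^+ 2)%:E * mu n K))%E.
Proof.
move=> jp; set c := 4 * _.
have c0 : 0 <= c by rewrite mulr_ge0// exprn_ge0// mulr_ge0// ltW.
have mP2 : measurable_fun setT Psi2 by apply/measurable_EFinP; exact: measurable_funX.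
have P20 x : (0 <= Psi2 x)%E by rewrite lee_fin sqr_ge0.
have mpath : measurable_fun K (fun y => path_int Psi2 z y).
  apply: measurable_funTS.
  have mr : measurable_fun setT (fun y : 'rV[R]_n => (z, y)).
    by apply/measurable_fun_pairP; split; [exact: measurable_cst|exact: measurable_id].
  exact: (measurableT_comp (measurable_path_int mP2 P20) mr).
have mrhs : measurable_fun K (fun y => path_int Psi2 z y + (cA ^+ 2)%:E)%E.
  by apply: emeasurable_funD => //; exact: measurable_cst.
have rhs0 y : (0 <= path_int Psi2 z y + (cA ^+ 2)%:E)%E.
  by rewrite adde_ge0// ?path_int_ge0// lee_fin sqr_ge0.
apply: (@le_trans _ _ (\int[mu n]_(y in K) (c%:E * (path_int Psi2 z y + (cA ^+ 2)%:E)))%E).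
  apply: ae_ge0_le_integral => //.
  - by move=> x _; rewrite lee_fin sqr_ge0.
  - by apply: mparts_sqr; exact: mcomb.
  - by move=> x _; rewrite mule_ge0.
  - exact: measurable_funeM.
  - exact: comb_pointwise.
rewrite ge0_integralZl// ge0_integralD//; first by rewrite integral_cst.
- by move=> y _; exact: path_int_ge0.
- by move=> y _; rewrite lee_fin sqr_ge0.
Qed.

End segment_ftc_family.

(** * Choice of the expansion point *)

Section good_point.
Context d (T : measurableType d) (R : realType) (m : {measure set T -> \bar R}).

(** Each of f and g exceeds three times its mean on at most a third of B, and P
    fails on a null set; these sets do not cover B. *)
Lemma good_point (B : set T) (P : T -> Prop) (f g : T -> \bar R) : measurable B ->
  (0 < m B)%E -> (m B < +oo)%E -> {ae m, forall x, B x -> P x} ->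
  measurable_fun B f -> (forall x, B x -> 0 <= f x)%E ->
  measurable_fun B g -> (forall x, B x -> 0 <= g x)%E ->
  exists x, [/\ B x, P x, (m B * f x <= 3%:E * \int[m]_(y in B) f y)%E &
    (m B * g x <= 3%:E * \int[m]_(y in B) g y)%E].
Proof.
move=> mB B0 Boo [N [mN N0 sub]] mf f0 mg g0; apply: contrapT => nex.
have Sf := markov_third mB Boo mf f0; have Sg := markov_third mB Boo mg g0.
set A1 := B `&` _ in Sf; set A2 := B `&` _ in Sg.
have mA1 : measurable A1 by apply: measurable_lte => //; exact: measurable_funeM.
have mA2 : measurable A2 by apply: measurable_lte => //; exact: measurable_funeM.
have cov : B `<=` (A1 `|` A2) `|` N.
  move=> x Bx; apply: contrapT => nx; apply: nex; exists x; split => //.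
  - by apply: contrapT => nP; apply: nx; right; apply: sub => /= /(_ Bx).
  - by rewrite leNgt; apply/negP => h; apply: nx; left; left.
  - by rewrite leNgt; apply/negP => h; apply: nx; left; right.
have le : (m B <= m A1 + m A2)%E.
  apply: (@le_trans _ _ (m ((A1 `|` A2) `|` N))).
    by apply: le_measure => //; rewrite inE//; do 2?apply: measurableU.
  have e : (m (A1 `|` A2) + m N <= m A1 + m A2)%E by rewrite N0 adde0; exact: measureU2.
  by apply: le_trans (measureU2 _ (measurableU _ _ mA1 mA2) mN) _; exact: e.
have Bf : m B \is a fin_num by rewrite ge0_fin_numE.
have A1f : m A1 \is a fin_num.
  rewrite ge0_fin_numE//; apply: le_lt_trans Boo.
  by apply: le_measure; rewrite ?inE// => x [].
have A2f : m A2 \is a fin_num.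
  rewrite ge0_fin_numE//; apply: le_lt_trans Boo.
  by apply: le_measure; rewrite ?inE// => x [].
move: Bf A1f A2f B0 Sf Sg le => /fineK <- /fineK <- /fineK <-.
rewrite -!EFinM -EFinD !lee_fin lte_fin; lra.
Qed.

End good_point.

Section constants.
Context {R : realType}.

(** Here be, ka and si stand for |B|, |K| and the square of the norm of psi, r
    bounds |K| / |B|, s and t are the constants of the matching condition and of
    the basis, and Q and A are the two quantities controlled at the expansion
    point. *)
Lemma constant_bound (n p k : nat) (be ka si r Q A s t h : R) : (0 < n)%N -> (k <= p.+1)%N ->
  0 < be -> 0 <= ka -> 0 <= si -> 0 <= r -> 0 <= A -> 0 <= h -> ka <= r * be ->
  be * Q <= 3 * (2 ^+ n * (be + ka) * si) ->
  be * A <= 3 * (s * Num.sqrt ka * Num.sqrt si) ->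
  4 * (n%:R * h) ^+ (2 * k) * (Q + (t * A) ^+ 2 * ka) <=
  (2 * n%:R ^+ p.+1 * (1 + (3 * 2 ^+ n * (1 + r) + 9 * r ^+ 2 * (s * t) ^+ 2)) * h ^+ k) ^+ 2 * si.
Proof.
move=> n0 kp be0 ka0 si0 r0 A0 h0 kar HQ HA.
set D := 3 * 2 ^+ n * (1 + r) + _.
have n1 : 1 <= n%:R :> R by rewrite ler1n.
have N2 : 0 <= 2 ^+ n :> R by exact: exprn_ge0.
have D1 : 0 <= 3 * 2 ^+ n * (1 + r) by rewrite !mulr_ge0// addr_ge0.
have D2 : 0 <= 9 * r ^+ 2 * (s * t) ^+ 2 by rewrite mulr_ge0 ?sqr_ge0// mulr_ge0 ?sqr_ge0.
have D0 : 0 <= D by rewrite addr_ge0.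
have Qle : Q <= 3 * 2 ^+ n * (1 + r) * si.
  rewrite -(ler_pM2l be0); apply: le_trans HQ _.
  rewrite (_ : be * _ = 3 * (2 ^+ n * (be + r * be) * si)); last by ring.
  by rewrite ler_wpM2l// ler_wpM2r// ler_wpM2l// lerD2l.
have Ale : A ^+ 2 * ka <= 9 * r ^+ 2 * s ^+ 2 * si.
  have be2 : 0 < be ^+ 2 by rewrite exprn_gt0.
  rewrite -(ler_pM2l be2).
  apply: (@le_trans _ _ (9 * (s ^+ 2 * ka * si) * ka)).
    rewrite [leLHS]mulrA; apply: ler_wpM2r => //; rewrite -exprMn.
    have -> : 9 * (s ^+ 2 * ka * si) = (3 * (s * Num.sqrt ka * Num.sqrt si)) ^+ 2.
      by rewrite !exprMn !sqr_sqrtr//; ring.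
    have bA : 0 <= be * A by rewrite mulr_ge0// ltW.
    by rewrite ler_pXn2r ?nnegrE// (le_trans bA).
  apply: (@le_trans _ _ (9 * (s ^+ 2 * si) * (r * be) ^+ 2)).
    rewrite (_ : 9 * _ * ka = 9 * (s ^+ 2 * si) * ka ^+ 2); last by ring.
    apply: ler_wpM2l; first by rewrite mulr_ge0// mulr_ge0 ?sqr_ge0.
    by rewrite ler_pXn2r ?nnegrE// (le_trans ka0).
  by rewrite le_eqVlt; apply/orP; left; apply/eqP; ring.
have S : Q + (t * A) ^+ 2 * ka <= D * si.
  rewrite /D mulrDl; apply: lerD => //.
  rewrite (_ : 9 * _ * _ * si = t ^+ 2 * (9 * r ^+ 2 * s ^+ 2 * si)); last by ring.
  by rewrite exprMn -[leLHS]mulrA; apply: ler_wpM2l => //; exact: sqr_ge0.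
apply: (@le_trans _ _ (4 * (n%:R * h) ^+ (2 * k) * (D * si))).
  by apply: ler_wpM2l => //; rewrite mulr_ge0// exprn_ge0// mulr_ge0.
rewrite mulrA; apply: ler_wpM2r => //.
have -> : (n%:R * h) ^+ (2 * k) = (n%:R ^+ k) ^+ 2 * (h ^+ k) ^+ 2 :> R.
  by rewrite mulnC exprM -exprMn -exprMn.
have nk : (n%:R ^+ k) ^+ 2 <= (n%:R ^+ p.+1) ^+ 2 :> R.
  rewrite ler_pXn2r ?nnegrE ?exprn_ge0//.
  by apply: ler_weXn2l.
have DD : D <= (1 + D) ^+ 2 by rewrite expr2; nra.
rewrite (_ : (2 * _ * (1 + D) * _) ^+ 2 = 4 * ((n%:R ^+ p.+1) ^+ 2 * (h ^+ k) ^+ 2) * (1 + D) ^+ 2); last by ring.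
apply: ler_pM => //.
  by rewrite mulr_ge0// mulr_ge0 ?sqr_ge0.
by rewrite ler_wpM2l// ler_wpM2r// sqr_ge0.
Qed.

Lemma constant_bound_ereal (n p k : nat) (be ka si Q w : \bar R) (r A s t h : R) : (0 < n)%N -> (k <= p.+1)%N ->
  be \is a fin_num -> ka \is a fin_num -> si \is a fin_num ->
  (0 < be)%E -> (0 <= ka)%E -> (0 <= si)%E -> (0 <= Q)%E -> 0 <= r -> 0 <= A -> 0 <= h ->
  (ka <= r%:E * be)%E ->
  (be * Q <= 3%:E * ((2 ^+ n)%:E * (be + ka) * si))%E ->
  (be * A%:E <= 3%:E * (s%:E * sqrte ka * sqrte si))%E ->
  (w <= (4 * (n%:R * h) ^+ (2 * k))%:E * (Q + ((t * A) ^+ 2)%:E * ka))%E ->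
  (sqrte w <= (2 * n%:R ^+ p.+1 * (1 + (3 * 2 ^+ n * (1 + r) + 9 * r ^+ 2 * (s * t) ^+ 2)) * h ^+ k)%:E * sqrte si)%E.
Proof.
move=> n0 kp; move: be ka si => [be| |] [ka| |] [si| |] // _ _ _ be0 ka0 si0.
rewrite lte_fin in be0; rewrite !lee_fin in ka0 si0.
case: Q => [Q| |] // Q0 r0 A0 h0; last by rewrite gt0_muley// => _; rewrite leNgt ltey.
move=> kar HQ HA Hw.
have {}kar : ka <= r * be by rewrite -lee_fin.
have {}HQ : be * Q <= 3 * (2 ^+ n * (be + ka) * si) by rewrite -lee_fin.
have {}HA : be * A <= 3 * (s * Num.sqrt ka * Num.sqrt si) by rewrite -lee_fin.
set X := 2 * n%:R ^+ p.+1 * (1 + _).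
have X0 : 0 <= X * h ^+ k.
  rewrite mulr_ge0 ?exprn_ge0// mulr_ge0 ?mulr_ge0 ?exprn_ge0// addr_ge0// addr_ge0//.
    by rewrite mulr_ge0 ?addr_ge0// mulr_ge0// exprn_ge0.
  by rewrite mulr_ge0 ?sqr_ge0// mulr_ge0 ?sqr_ge0.
have H := constant_bound t n0 kp be0 ka0 si0 r0 A0 h0 kar HQ HA.
case: w Hw => [w| |] Hw; [|by []|].
  have {}Hw : w <= 4 * (n%:R * h) ^+ (2 * k) * (Q + (t * A) ^+ 2 * ka) by rewrite -lee_fin.
  rewrite /sqrte -EFinM -(ger0_norm X0) -sqrtr_sqr -sqrtrM ?sqr_ge0//.
  by rewrite lee_fin ler_wsqrtr// (le_trans Hw).
by rewrite /sqrte -EFinM lee_fin mulr_ge0.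
Qed.

End constants.

Section assembly.
Context {R : realType}.
Local Notation mu := (@lebesgue_row R).
Local Notation lambda := (@lebesgue_measure R).
Local Notation normc := (@ComplexField.Normc.normc R).
Variables (n p N : nat) (K : set 'rV[R]_n) (phi : 'I_N -> 'rV[R]_n -> R[i]).
Hypothesis oK : open K.
Hypothesis bK : bounded_set K.

Let mK : measurable K.
Proof. exact: open_row_measurable. Qed.

(** The supremum is finite because only finitely many multi-indices occur and
    each derivative is bounded on K. *)
Lemma Cnorm_bound (m : nat) : (forall l, csmooth_closure K (phi l)) -> K !=set0 ->
  0 <= Cnorm K m phi /\ forall l j x, (mi_order j <= m)%N -> K x ->
    normc (cmpartial j (phi l) x) <= Cnorm K m phi.
Proof.
move=> sphi [x0 Kx0]; rewrite /Cnorm; set S := [set r | _].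
have ubS : has_ubound S.
  have H (q : 'I_N * {ffun 'I_n -> 'I_m.+1}) : exists M, 0 <= M /\ forall x, K x ->
      normc (cmpartial (mi_of_ffun q.2) (phi q.1) x) <= M.
    by have [M M0 HM] := csmooth_bounded bK (mi_of_ffun q.2) (sphi q.1); exists M.
  have [M HM] := choice H; exists (\sum_q M q) => _ [l [j [x [jm Kx ->]]]].
  have [f fj] := mi_of_ffun_exists jm.
  have := (HM (l, f)).2 x Kx; rewrite /= fj => h; apply: le_trans h _.
  by rewrite (bigD1 (l, f))//= lerDl sumr_ge0// => q _; exact: (HM q).1.
have H l j x : (mi_order j <= m)%N -> K x -> normc (cmpartial j (phi l) x) <= sup S.
  by move=> jm Kx; apply: ub_le_sup => //; exists l, j, x.
split=> //.
case: (posnP N) => N0.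
  have -> : S = set0; last by rewrite sup0.
  apply/seteqP; split => // r [l _].
  by move: (ltn_ord l); rewrite {2}N0.
apply: le_trans (normc_ge0 (cmpartial (fun=> 0%N) (phi (Ordinal N0)) x0)) (H _ _ _ _ Kx0).
by rewrite /mi_order big1.
Qed.

Section measurable_average.
Variable T : 'rV[R]_n -> \bar R.
Hypothesis mT : measurable_fun setT T.
Hypothesis T0 : forall x, (0 <= T x)%E.

Lemma measurable_star_average :
  measurable_fun setT (fun z => \int[mu n]_(y in K) path_int T z y)%E.
Proof.
pose f (q : 'rV[R]_n * 'rV[R]_n) : \bar R := ((\1_K q.2)%:E * path_int T q.1 q.2)%E.
have mf : measurable_fun setT f.
  apply: emeasurable_funM; last exact: measurable_path_int.
  apply/measurable_EFinP.
  have mK1 : measurable_fun setT (\1_K : 'rV[R]_n -> R) by exact: measurable_indic.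
  exact: (measurableT_comp mK1 measurable_snd).
have f0 q : (0 <= f q)%E by rewrite mule_ge0// path_int_ge0.
have := @measurable_fun_fubini_tonelli_F _ _ _ _ R (mu n) _ mf f0.
congr (measurable_fun _ _); apply/funext => z; rewrite /fubini_F [RHS]integral_mkcond.
apply: eq_integral => y _; rewrite /f /patch /= indicE.
by case: ifP; rewrite ?mul1e ?mul0e.
Qed.

End measurable_average.

Variable psi : 'rV[R]_n -> R[i].
Hypothesis Hpsi : in_H K p.+1 psi.

Local Notation idx := {ffun 'I_n -> 'I_p.+2}.

Definition Hnorm_sq : \bar R :=
  (\sum_(j : idx | (mi_order (mi_of_ffun j) <= p.+1)%N) sqL2 K (wderiv K (mi_of_ffun j) psi))%E.

Lemma HnormE : Hnorm K p.+1 psi = (Hnorm_sq `^ 2^-1)%E.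
Proof.
by rewrite /Hnorm /Hnorm_sq; congr (_ `^ _)%E; apply: eq_bigr => j _; exact: L2norm_sqr.
Qed.

Lemma wderiv_H j : (mi_order j <= p.+1)%N -> is_wderiv K j psi (wderiv K j psi).
Proof. by move=> jp; have [g Hg] := Hpsi.2 j jp; exact: wderivP Hg. Qed.

Lemma Hnorm_sq_ge0 : (0 <= Hnorm_sq)%E.
Proof. by apply: sume_ge0 => j _; exact: sqL2_ge0. Qed.

Lemma Hnorm_sq_fin : (Hnorm_sq < +oo)%E.
Proof.
apply: lte_sum_pinfty => j jp; have [L _] := wderiv_H jp.
by have /in_L2P[_] := L.
Qed.

(** The Euclidean norm of the vector of derivatives, rather than their sum,
    makes the integral of the square equal to the square of [Hnorm]. *)
Definition majorant (x : 'rV[R]_n) : R := if x \in K then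
  Num.sqrt (\sum_(j : idx | (mi_order (mi_of_ffun j) <= p.+1)%N)
    normc (wderiv K (mi_of_ffun j) psi x) ^+ 2) else 0.

Lemma majorant_ge0 x : 0 <= majorant x.
Proof. by rewrite /majorant; case: ifP. Qed.

Lemma le_majorant j x : (mi_order j <= p.+1)%N -> K x ->
  normc (wderiv K j psi x) <= majorant x.
Proof.
move=> jp Kx; have [f fj] := mi_of_ffun_exists jp.
rewrite /majorant mem_set// -[leLHS]ger0_norm ?normc_ge0// -sqrtr_sqr ler_wsqrtr//.
rewrite (bigD1 f) ?fj//= lerDl sumr_ge0// => g _; exact: sqr_ge0.
Qed.

Lemma measurable_majorant : measurable_fun setT majorant.
Proof.
rewrite (_ : majorant = (Num.sqrt \o (fun x => \sum_(j : idx | (mi_order (mi_of_ffun j) <= p.+1)%N)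
    normc (wderiv K (mi_of_ffun j) psi x) ^+ 2)) \_ K); last first.
  by apply/funext => x; rewrite /majorant patchE.
apply/(measurable_restrict _ mK measurableT); rewrite setTI.
apply: measurableT_comp; first by apply: continuous_measurable_fun; exact: sqrt_continuous.
rewrite (_ : (fun x => _) = (fun x => \sum_(j <- index_enum idx)
    (if (mi_order (mi_of_ffun j) <= p.+1)%N then normc (wderiv K (mi_of_ffun j) psi x) ^+ 2 else 0))); last first.
  by apply/funext => x; rewrite big_mkcond.
apply: measurable_sum => j; case: (boolP (mi_order (mi_of_ffun j) <= p.+1)%N) => jp; last exact: measurable_cst.
apply: measurable_funX; apply: mparts_normc.
by have [/in_L2P[]] := wderiv_H jp.
Qed.

Lemma integral_majorant : (\int[mu n]_x (majorant x ^+ 2)%:E = Hnorm_sq)%E.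
Proof.
rewrite (_ : (fun x => (majorant x ^+ 2)%:E) = (fun x => (\sum_(j : idx | (mi_order (mi_of_ffun j) <= p.+1)%N)
    normc (wderiv K (mi_of_ffun j) psi x) ^+ 2)%:E) \_ K); last first.
  apply/funext => x; rewrite patchE /majorant; case: ifP => _; last by rewrite expr0n.
  by rewrite sqr_sqrtr// sumr_ge0// => j _; exact: sqr_ge0.
rewrite -integral_mkcond /Hnorm_sq /sqL2.
transitivity (\int[mu n]_(x in K) \sum_(j <- index_enum idx)
    ((if (mi_order (mi_of_ffun j) <= p.+1)%N then normc (wderiv K (mi_of_ffun j) psi x) ^+ 2 else 0)%:E))%E.
  by apply: eq_integral => x _; rewrite -sumEFin big_mkcond; apply: eq_bigr => j _; case: ifP.
rewrite ge0_integral_sum//.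
- rewrite [RHS]big_mkcond; apply: eq_bigr => j _; case: ifP => // _.
  by rewrite integral0.
- move=> j; case: (boolP (mi_order (mi_of_ffun j) <= p.+1)%N) => jp; last exact: measurable_cst.
  by apply: mparts_sqr; have [/in_L2P[]] := wderiv_H jp.
- by move=> j x _; case: ifP => _; rewrite lee_fin ?sqr_ge0.
Qed.

Hypothesis sphi : forall l, csmooth_closure K (phi l).

(** Index 0 stands for psi and the index lift ord0 l for phi_l, so that the
    remainder is a combination [comb] of a single family, with coefficients 1
    and - a_l. *)
Definition family (i : 'I_N.+1) : 'rV[R]_n -> R[i] :=
  if unlift ord0 i is Some l then phi l else psi.
Definition dfamily (i : 'I_N.+1) (j : 'I_n -> nat) : 'rV[R]_n -> R[i] :=
  if unlift ord0 i is Some l then cmpartial j (phi l) else wderiv K j psi.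
Definition coef (a : 'I_N -> R[i]) (i : 'I_N.+1) : R[i] :=
  if unlift ord0 i is Some l then - a l else 1.

Lemma phi_in_L2 l : in_L2 K (phi l).
Proof. by rewrite -[phi l]mi0_cmpartial; exact: csmooth_in_L2. Qed.

Lemma family_in_L2 i : in_L2 K (family i).
Proof.
rewrite /family; case: unlift => [l|]; [exact: phi_in_L2|exact: Hpsi.1].
Qed.

Lemma dfamily_wderiv i j : (mi_order j <= p.+1)%N -> is_wderiv K j (family i) (dfamily i j).
Proof.
move=> jp; rewrite /family /dfamily; case: unlift => [l|]; last exact: wderiv_H.
exact: csmooth_is_wderiv.
Qed.

Lemma comb_remainder a j x : comb dfamily (coef a) j x =
  wderiv K j psi x - \sum_l a l * cmpartial j (phi l) x.
Proof.
rewrite /comb big_ord_recl /coef /dfamily unlift_none mul1r; congr (_ + _).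
by rewrite -sumrN; apply: eq_bigr => l _; rewrite liftK mulNr.
Qed.

Variables (c : 'rV[R]_n) (rho Cs : R) (a : 'I_N -> 'rV[R]_n -> R[i]).
Local Notation h := (diam K).
Local Notation B := (eball c (rho * h)).
Hypothesis n0 : (0 < n)%N.
Hypothesis rho0 : 0 < rho.
Hypothesis nK : K !=set0.
Hypothesis BK : B `<=` K.
Hypothesis starK : star_shaped K B.
Hypothesis aL1 : forall l, in_L1 B (a l).
Hypothesis match_a : forall j, (mi_order j <= p)%N ->
  {ae mu n, forall z, B z -> wderiv K j psi z = \sum_l a l z * cmpartial j (phi l) z}.
Hypothesis bound_a : (\int[mu n]_(z in B) (\sum_l normc (a l z))%:E <=
  Cs%:E * mu n K `^ 2^-1 * Hnorm K p.+1 psi)%E.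

Lemma remainder_bound : exists z, forall j, (mi_order j <= p)%N ->
  (L2norm K (wderiv K j (fun x => psi x - \sum_l a l z * phi l x)%R) <=
   (2 * n%:R ^+ p.+1 * (1 + (3 * 2 ^+ n * (1 + (4 * n%:R / rho) ^+ n) +
      9 * ((4 * n%:R / rho) ^+ n) ^+ 2 * (Cs * Cnorm K p.+1 phi) ^+ 2)) *
      h ^+ (p.+1 - mi_order j))%:E * Hnorm K p.+1 psi)%E.
Proof.
set r := (4 * n%:R / rho) ^+ n.
have h0 : 0 < h by exact: diam_gt0.
have [B0 KB] := eball_ratio n0 oK bK rho0 h0 BK.
have oB : open B by exact: eball_open.
have mB : measurable B by exact: open_row_measurable.
have Koo : (mu n K < +oo)%E by exact: bounded_lebesgue_row_fin.
have Boo : (mu n B < +oo)%E.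
  by apply: le_lt_trans Koo; apply: le_measure; rewrite ?inE.
pose T (x : 'rV[R]_n) : \bar R := (majorant x ^+ 2)%:E.
have mT : measurable_fun setT T.
  by apply/measurable_EFinP; apply: measurable_funX; exact: measurable_majorant.
have T0 x : (0 <= T x)%E by rewrite lee_fin sqr_ge0.
pose Q (z : 'rV[R]_n) : \bar R := (\int[mu n]_(y in K) path_int T z y)%E.
have Q0 z : (0 <= Q z)%E by apply: integral_ge0 => y _; exact: path_int_ge0.
have mQ : measurable_fun B Q by apply: measurable_funTS; exact: measurable_star_average.
pose A (z : 'rV[R]_n) : R := \sum_l normc (a l z).
have A0 z : 0 <= A z by apply: sumr_ge0 => l _; exact: normc_ge0.
have mA : measurable_fun B (EFin \o A).
  apply/measurable_EFinP; apply: measurable_sum => l; apply: mparts_normc => b.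
  have [/integrableP[m1 _] /integrableP[m2 _]] := aL1 l.
  by apply/measurable_EFinP; case: b.
pose P (z : 'rV[R]_n) := [/\ forall j, (mi_order j <= p)%N ->
     wderiv K j psi z = \sum_l a l z * cmpartial j (phi l) z,
   {ae mu n, forall e, K (z + e) -> {ae (@dirac _ _ (1 : measurableTypeR R) R),
      forall t : R, 0 <= t <= 1 -> family_segment_ftc p K dfamily z e t}} &
   {ae mu n, forall e, K (z + e) -> {ae lambda,
      forall t : R, 0 <= t <= 1 -> family_segment_ftc p K dfamily z e t}}].
have aeP : {ae mu n, forall z, B z -> P z}.
  have H1 : {ae mu n, forall z, forall f : {ffun 'I_n -> 'I_p.+1}, (mi_order (mi_of_ffun f) <= p)%N ->
      B z -> wderiv K (mi_of_ffun f) psi z = \sum_l a l z * cmpartial (mi_of_ffun f) (phi l) z}.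
    apply: ae_forall_fin => f.
    have [fp|fp] := boolP (mi_order (mi_of_ffun f) <= p)%N; last by apply: aeW.
    by apply: filterS (match_a fp) => z Hz _.
  have H2 := ae_family_segment_ftc oK bK oB starK family_in_L2 dfamily_wderiv (@dirac _ _ (1 : measurableTypeR R) R).
  have H3 := ae_family_segment_ftc oK bK oB starK family_in_L2 dfamily_wderiv lambda.
  apply: filterS3 H1 H2 H3 => z z1 z2 z3 Bz; split; [|exact: z2|exact: z3].
  by move=> j jp; have [f fj] := mi_of_ffun_exists jp; rewrite -fj; apply: z1 => //; rewrite fj.
have [z [Bz [Pz ok1 okL] Qz Az]] := good_point mB B0 Boo aeP mQ (fun x _ => Q0 x) mA
  (fun x _ => A0 x : (0 <= (A x)%:E)%E).
exists z => j jp.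
have [Cn0 Cn] := Cnorm_bound p.+1 sphi nK.
set Cp := Cnorm K p.+1 phi in Cn0 Cn *.
have Aw := A0 z.
pose cA := Cp * A z.
have cA0 : 0 <= cA by exact: mulr_ge0.
pose W i x := wderiv K i psi x - \sum_l a l z * cmpartial i (phi l) x.
have Wd i : (mi_order i <= p.+1)%N ->
    is_wderiv K i (fun x => psi x - \sum_l a l z * phi l x) (W i).
  move=> ip; apply: (is_wderiv_sum oK bK) => //.
  - exact: Hpsi.1.
  - by move=> l; exact: phi_in_L2.
  - exact: wderiv_H.
  - by move=> l; exact: csmooth_is_wderiv.
have WE i : comb dfamily (coef (a ^~ z)) i = W i.
  by apply/funext => x; rewrite comb_remainder.
have hK x y i : K x -> K y -> `|(x - y) ord0 i| <= h.
  by move=> Kx Ky; apply: le_trans (coord_le_enorm _ _) (le_diam bK Kx Ky).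
have W0 i : (mi_order i <= p)%N -> comb dfamily (coef (a ^~ z)) i z = 0.
  by move=> ip; rewrite WE /W Pz// subrr.
have WP i x : mi_order i = p.+1 -> K x -> normc (comb dfamily (coef (a ^~ z)) i x) <= majorant x + cA.
  move=> ip Kx; rewrite WE; apply: le_trans (normcDE _ _) _; rewrite normcN; apply: lerD.
    by apply: le_majorant => //; rewrite ip.
  apply: le_trans (normc_sum _ _) _; rewrite /cA mulrC /A mulr_suml.
  apply: ler_sum => l _; rewrite ComplexField.Normc.normcM ler_wpM2l ?normc_ge0//.
  by apply: Cn => //; rewrite ip.
have mW i : (mi_order i <= p)%N -> measurable_parts K (comb dfamily (coef (a ^~ z)) i).
  move=> ip; rewrite WE; have [/in_L2P[]] := Wd i (leq_trans ip (leqnSn p)).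
  by [].
have := comb_sqL2_bound oK starK n0 h0 hK measurable_majorant majorant_ge0 cA0 Bz (BK Bz) W0 WP ok1 okL mW jp.
have -> : L2norm K (wderiv K j (fun x => psi x - \sum_l a l z * phi l x)) = (sqL2 K (W j) `^ 2^-1)%E.
  rewrite L2normE (sqL2_wderiv oK bK _ (Wd j (leq_trans jp (leqnSn p))))//.
  by apply: in_L2_sum => //; [exact: Hpsi.1|exact: phi_in_L2].
rewrite WE HnormE -/(T _) -/(Q z).
have fB : mu n B \is a fin_num by rewrite ge0_fin_numE.
have fK : mu n K \is a fin_num by rewrite ge0_fin_numE.
have fS : Hnorm_sq \is a fin_num by rewrite ge0_fin_numE ?Hnorm_sq_ge0// Hnorm_sq_fin.
have iQ : (\int[mu n]_(y in B) Q y <= (2 ^+ n)%:E * (mu n B + mu n K) * Hnorm_sq)%E.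
  by rewrite -integral_majorant; exact: star_average.
have iA := bound_a.
rewrite HnormE in iA.
have S0 := Hnorm_sq_ge0; have K0 : (0 <= mu n K)%E by exact: measure_ge0.
set I2 := (\int[mu n]_(y in B) Q y)%E in Qz iQ; set I1 := (\int[mu n]_(y in B) _)%E in Az iA.
have I2le : (mu n B * Q z <= 3%:E * ((2 ^+ n)%:E * (mu n B + mu n K) * Hnorm_sq))%E.
  by apply: le_trans Qz _; apply: lee_wpmul2l.
have I1le : (mu n B * (A z)%:E <= 3%:E * (Cs%:E * mu n K `^ 2^-1 * Hnorm_sq `^ 2^-1))%E.
  by apply: le_trans Az _; apply: lee_wpmul2l.
clear Qz Az iQ iA.
rewrite !poweR12_sqrt// ?sqL2_ge0//; rewrite !poweR12_sqrt// in I1le.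
move=> bnd; apply: (@constant_bound_ereal R n p _ (mu n B) (mu n K) Hnorm_sq (Q z) _ r (A z) Cs Cp h) => //.
- exact: leq_subr.
- by rewrite exprn_ge0// divr_ge0 ?mulr_ge0// ltW.
- exact: ltW.
Qed.

End assembly.

(** * The approximation estimate *)

Theorem proposition4p6 (R : realType) (d p : nat) (hd : (1 <= d)%N)
    (hp : (1 <= p)%N) (rho : R) (hrho : 0 < rho <= 2^-1) :
  exists C : R -> R -> R, (forall s t, 0 < C s t) /\
  forall (Kx : set 'rV[R]_d) (a b V : R) (c : 'rV[R]_(d + 1))
    (N : nat) (phi : 'I_N -> 'rV[R]_(d + 1) -> R[i])
    (Tp : set ('rV[R]_(d + 1) -> R[i])) (Cstar : R),
  let I := time_interval a b in
  let K := cylinder Kx I in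
  let h := diam K in
  let B := eball c (rho * h) in
  open_polytope Kx -> a < b ->
  B `<=` K -> star_shaped K B ->
  Tp `<=` trefftz Kx I V -> is_basis K Tp phi ->
  (forall l, csmooth_closure K (phi l)) ->
  0 < Cstar -> taylor_matching Kx I V B p phi Cstar ->
  forall psi, trefftz Kx I V psi -> in_H K p.+1 psi ->
  exists Phi, Tp Phi /\
    forall j : 'I_(d + 1) -> nat, (mi_order j <= p)%N ->
      (L2norm K (wderiv K j (fun z => (psi z - Phi z)%R)) <=
       (C Cstar (Cnorm K p.+1 phi) * h ^+ (p.+1 - mi_order j))%:E *
         Hnorm K p.+1 psi)%E.
Proof.
pose n := (d + 1)%N; pose r : R := (4 * n%:R / rho) ^+ n.
have /andP[rho0 _] := hrho.
have n0 : (0 < n)%N by rewrite /n addn1.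
have r0 : 0 <= r by rewrite exprn_ge0// divr_ge0 ?mulr_ge0// ltW.
exists (fun s t => 2 * n%:R ^+ p.+1 *
  (1 + (3 * 2 ^+ n * (1 + r) + 9 * r ^+ 2 * (s * t) ^+ 2))); split.
  move=> s t; rewrite mulr_gt0//; first by rewrite mulr_gt0// exprn_gt0// ltr0n.
  rewrite ltr_wpDr// addr_ge0//.
    by rewrite mulr_ge0 ?addr_ge0// mulr_ge0// exprn_ge0.
  by rewrite mulr_ge0 ?sqr_ge0// mulr_ge0 ?sqr_ge0.
move=> Kx a b V c N phi Tp Cstar I K h B pK ab BK starK TpT [basis _] sphi Cs0 match_phi psi Tpsi Hpsi.
have [oKx bKx nKx] := open_polytopeP pK.
have oK : open K by exact: cylinder_open.
have bK : bounded_set K by exact: cylinder_bounded.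
have nK : K !=set0 by exact: cylinder_nonempty.
have [al [aL1 amatch abound]] := match_phi psi Tpsi Hpsi.
have [z Hz] := remainder_bound oK bK Hpsi sphi n0 rho0 nK BK starK aL1 amatch abound.
exists (fun x => \sum_l al l z * phi l x); split.
  by apply/basis; exists (al ^~ z).
by move=> j jp; exact: Hz.
Qed.
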